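(* For every $n\ge 0$, $$\mu_n(a,b,c,d\,|\,q)=\frac{1}{2^n}\sum_{k=0}^n \frac{(ab,ac,ad;q)_k}{(abcd;q)_k}\,q^k\sum_{j=0}^k q^{-j^2}a^{-2j}\,\frac{(q^{j}a+q^{-j}/a)^n}{(q,q^{-2j+1}/a^2;q)_{j}\,(q,q^{2j+1}a^2;q)_{k-j}}.$$
   Context: $(x;q)_n=\prod_{k=0}^{n-1}(1-xq^k)$ (also for $n=\infty$), $(a_1,\dots,a_s;q)_n=\prod_{r=1}^s(a_r;q)_n$. With $x=\cos\theta=(z+z^{-1})/2$, $z=e^{i\theta}$, let $h_0(a,b,c,d,q)=\frac{(abcd;q)_\infty}{(q,ab,ac,ad,bc,bd,cd;q)_\infty}$ and $w(x)=w(x,a,b,c,d|q)=\frac{(z^2,z^{-2};q)_\infty}{h_0(a,b,c,d,q)\,(az,a/z,bz,b/z,cz,c/z,dz,d/z;q)_\infty}$. For $|a|,|b|,|c|,|d|<1$, the Askey–Wilson moments are $\mu_n(a,b,c,d|q)=\oint_C \frac{dz}{4\pi i z}\,w\big(\tfrac{z+z^{-1}}{2}\big)\big(\tfrac{z+z^{-1}}{2}\big)^n$, where $C$ is a closed contour enclosing the poles $aq^k,bq^k,cq^k,dq^k$ ($k\ge 0$) and excluding $(aq^k)^{-1},(bq^k)^{-1},(cq^k)^{-1},(dq^k)^{-1}$; for other parameter values they are defined by analytic continuation. *)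

(* Defs.v *)
From Stdlib Require Import Reals List.
From Coquelicot Require Import Coquelicot.
Import ListNotations.

Open Scope R_scope.
Open Scope C_scope.

Fixpoint qpoch (x q : C) (n : nat) : C :=
  match n with
  | O => 1
  | S m => qpoch x q m * (1 - x * q ^ m)
  end.

Definition qpochs (xs : list C) (q : C) (n : nat) : C :=
  fold_right (fun x r => qpoch x q n * r) 1 xs.

(* [iota] returns the limit of the partial products, which exists for
   |q| < 1. *)
Definition qpoch_inf (x q : C) : C :=
  iota (T := C_CompleteNormedModule) (fun l : C => filterlim (qpoch x q) eventually (locally l)).

Definition qpochs_inf (xs : list C) (q : C) : C :=
  fold_right (fun x r => qpoch_inf x q * r) 1 xs.

(* A parameter quadruple (a, b, c, d). *)
Definition C4 : Type := (C * C * C * C)%type.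

Definition C4_NormedModule : NormedModule C_AbsRing :=
  prod_NormedModule C_AbsRing
    (prod_NormedModule C_AbsRing
      (prod_NormedModule C_AbsRing C_NormedModule C_NormedModule)
      C_NormedModule)
    C_NormedModule.

Definition h0 (p : C4) (q : C) : C :=
  let '(a, b, c, d) := p in
  qpoch_inf (a * b * c * d) q
    / qpochs_inf [q; a * b; a * c; a * d; b * c; b * d; c * d] q.

(* The weight w(x, a, b, c, d | q) at x = (z + 1/z) / 2, as a function of z;
   it is invariant under z -> 1/z. *)
Definition aw_weight (p : C4) (q z : C) : C :=
  let '(a, b, c, d) := p in
  qpochs_inf [z ^ 2; / z ^ 2] q
    / (h0 p q
       * qpochs_inf [a * z; a / z; b * z; b / z; c * z; c / z; d * z; d / z] q).

(* Closed C^1 curves.  The velocity may vanish, so every piecewise C^1 closed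
   curve is covered up to reparametrisation. *)
Record contour : Type := Contour {
  path : R -> C;
  vel : R -> C;
  path_derive : forall t : R, (0 <= t <= 1)%R ->
    is_derive (K := R_AbsRing) (V := C_R_NormedModule) path t (vel t);
  vel_continuous : forall t : R, (0 <= t <= 1)%R -> continuous vel t;
  path_closed : path 0 = path 1
}.

Definition is_contour_integral (f : C -> C) (g : contour) (v : C) : Prop :=
  is_RInt (V := C_R_NormedModule) (fun t => f (path g t) * vel g t) 0 1 v.

Definition has_winding_number (g : contour) (z0 m : C) : Prop :=
  (forall t : R, (0 <= t <= 1)%R -> path g t <> z0) /\
  is_contour_integral (fun z => / (z - z0)) g (2 * PI * Ci * m).

Definition encloses (g : contour) (z0 : C) : Prop := has_winding_number g z0 1.
Definition excludes (g : contour) (z0 : C) : Prop := has_winding_number g z0 0.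

(* The poles e q^k accumulate at 0, an essential singularity of the integrand,
   so 0 has to be enclosed too; this is only an extra requirement when
   a = b = c = d = 0.  The points (e q^k)^-1 are written as the solutions z of
   e q^k z = 1, so that nothing is excluded when e = 0. *)
Definition separates_poles (g : contour) (p : C4) (q : C) : Prop :=
  let '(a, b, c, d) := p in
  encloses g 0 /\
  forall e : C, In e [a; b; c; d] -> forall k : nat,
    encloses g (e * q ^ k) /\
    (forall z : C, e * q ^ k * z = 1 -> excludes g z).

Definition is_aw_integral (q : C) (n : nat) (p : C4) (v : C) : Prop :=
  exists g : contour,
    separates_poles g p q /\
    is_contour_integral
      (fun z => / (4 * PI * Ci * z) * aw_weight p q z * ((z + / z) / 2) ^ n)
      g v.

Definition polydisc (p : C4) : Prop :=
  let '(a, b, c, d) := p in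
  (Cmod a < 1 /\ Cmod b < 1 /\ Cmod c < 1 /\ Cmod d < 1)%R.

Definition connected_set {T : UniformSpace} (D : T -> Prop) : Prop :=
  forall U V : T -> Prop, open U -> open V ->
    (forall p, D p -> U p \/ V p) ->
    (exists p, D p /\ U p) -> (exists p, D p /\ V p) ->
    exists p, D p /\ U p /\ V p.

(* Complex (Frechet) differentiability at every point of D; D is meant to be
   open. *)
Definition analytic_on (D : C4 -> Prop) (f : C4 -> C) : Prop :=
  forall p : C4_NormedModule, D p ->
    ex_filterdiff (U := C4_NormedModule) (V := C_NormedModule) f (locally p).

(* f on D is an analytic continuation, in (a, b, c, d), of the moment integral
   on the polydisc. *)
Definition is_aw_continuation (q : C) (n : nat) (D : C4 -> Prop) (f : C4 -> C)
    : Prop :=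
  open (T := C4_NormedModule) D /\
  connected_set (T := C4_NormedModule) D /\
  analytic_on D f /\
  (exists p, D p /\ polydisc p) /\
  (forall p, D p -> polydisc p -> is_aw_integral q n p (f p)).

Definition is_aw_moment (n : nat) (a b c d q v : C) : Prop :=
  let p := (a, b, c, d) in
  (polydisc p /\ is_aw_integral q n p v) \/
  (~ polydisc p /\
   exists (D : C4 -> Prop) (f : C4 -> C),
     is_aw_continuation q n D f /\ D p /\ f p = v).

(* [iota] returns the v such that [is_aw_moment n a b c d q v], provided that
   there is exactly one. *)
Definition aw_moment (n : nat) (a b c d q : C) : C :=
  iota (T := C_CompleteNormedModule) (is_aw_moment n a b c d q).

(* Main.v *)
(* For parameters in the unit disc, the moment integral over any separating contour equals the
   one over the unit circle: the integrand is a uniform limit of rational functions whose poles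
   have the same winding numbers, and for these partial fractions suffice.

   On the unit circle let I(a,b,c,d) be the mean of the unnormalised weight. Shifting the contour
   from |z| = 1 to |z| = |q| for a suitable non-symmetric relative of the weight gives the first
   moment in terms of I, which is the recurrence
     (1 - abcd) I(aq,b,c,d) = (1 - ab) (1 - ac) (1 - ad) I(a,b,c,d).
   Iterating it in each parameter reduces I to the constant I(0,0,0,0), which is read off from the
   parameters q, -q, s, -s with s^2 = q. The same recurrence integrates (az, a/z; q)_k, and the
   formula for the moments is the Newton expansion of (z + 1/z)^n in these products, whose nodes are
   q^j a + q^-j / a.

   Outside the polydisc, the right-hand side is a rational function, hence a continuation on the
   complement of the zeros of a polynomial, which is connected. Uniqueness of continuations is the
   identity theorem in C^4, reduced to complex lines. There it follows from Goursat's lemma in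
   logarithmic coordinates: means over circles around 0 do not depend on the radius. *)

Require Import Defs.
From Stdlib Require Import Reals List.
From Coquelicot Require Import Coquelicot.
From Stdlib Require Import Lra Lia Classical ClassicalEpsilon FunctionalExtensionality.
Import ListNotations.
Open Scope R_scope.
Open Scope C_scope.

(* [ring] does not see through equalities stated over the carrier of a canonical structure. *)
Ltac cring := lazymatch goal with |- ?a = ?b => change (@eq C a b); ring end.
Ltac cfield := lazymatch goal with |- ?a = ?b => change (@eq C a b); field end.

(** Residues would bring in infinitely many poles, with separate cases when some of them coincide. A
    recurrence only uses the position of the poles relative to two circles, so no genericity of the
    parameters enters. The symmetric weight cannot be shifted itself, since its poles a, b, c, d may
    lie between the circles; replacing e / z by e q / z removes them at the price of the symmetry,
    which comes back in the difference of the values at z and q z.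

    The terms of the right-hand side are singular at a = 0, which meets the polydisc, and a
    continuation may live on any connected open D. What remains of D without the zeros of the
    denominators is not known to be connected. Hence a continuation f is not compared with a
    quotient N / E: it is f E that is compared with N, on all of D, starting from a point of the
    polydisc with a <> 0.

    A separating contour is known only through winding numbers, which are integrals themselves; it
    is compared with the circle by algebra on integrands, without any homotopy. *)

(** * Complex inverses, moduli and balls *)

Lemma C_eq (x y : C) : fst x = fst y -> snd x = snd y -> x = y.
Proof. destruct x, y; simpl; intros -> ->; reflexivity. Qed.

Lemma Cinv_0 : / (0 : C) = 0.
Proof. apply C_eq; simpl; unfold Rdiv; ring. Qed.

(** Since / 0 = 0, inversion is multiplicative without exception. Denominators that are long
    products can thus be taken apart for [ring], and nonvanishing matters only for a factor that is
    cancelled. *)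
Lemma Cinv_mult_total (x y : C) : / (x * y) = / x * / y.
Proof.
  destruct (classic (x = 0)) as [-> | hx].
  { replace (0 * y) with (0 : C) by ring. rewrite Cinv_0; ring. }
  destruct (classic (y = 0)) as [-> | hy].
  { replace (x * 0) with (0 : C) by ring. rewrite Cinv_0; ring. }
  field; split; assumption.
Qed.

Lemma Cmult_neq_0_iff (x y : C) : x * y <> 0 <-> x <> 0 /\ y <> 0.
Proof.
  split.
  - intros h; split; intros ->; apply h; ring.
  - intros [h1 h2]; apply Cmult_neq_0; assumption.
Qed.

Lemma Cinv_neq_0 (x : C) : x <> 0 -> / x <> 0.
Proof.
  intros hx h. apply C1_nz. rewrite <- (Cinv_r x hx), h. ring.
Qed.

Lemma RtoC_neq_0 (x : R) : x <> 0%R -> (x : C) <> 0.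
Proof. intros h e. apply h. now injection e. Qed.

Lemma Cmod_dist_sym (x y : C) : Cmod (x - y) = Cmod (y - x).
Proof. rewrite <- Cmod_opp. f_equal; ring. Qed.

Lemma Cmod_triangle_sub (x y z : C) : (Cmod (x - z) <= Cmod (x - y) + Cmod (y - z))%R.
Proof. replace (x - z) with ((x - y) + (y - z)) by ring. apply Cmod_triangle. Qed.

Lemma Cmod_triangle_rev (x y : C) : (Cmod x - Cmod y <= Cmod (x - y))%R.
Proof.
  pose proof (Cmod_triangle (x - y) y) as h.
  replace (x - y + y) with x in h by ring. lra.
Qed.

Lemma im_le_Cmod (c : C) : (Rabs (snd c) <= Cmod c)%R.
Proof. eapply Rle_trans; [apply Rmax_r | apply Rmax_Cmod]. Qed.

Lemma Cmod_le_sum (c : C) : (Cmod c <= Rabs (fst c) + Rabs (snd c))%R.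
Proof.
  destruct c as [x y]. cbv [fst snd].
  assert (e : ((x, y) : C) = (x : C) + Ci * y) by (apply C_eq; simpl; ring).
  rewrite e. eapply Rle_trans; [apply Cmod_triangle |].
  rewrite Cmod_mult, Cmod_Ci, !Cmod_R, Rmult_1_l. apply Rle_refl.
Qed.

Lemma ball_of_Cmod (z w : C) (e : R) : (Cmod (w - z) < e)%R -> ball z e w.
Proof.
  intros h. split.
  - exact (Rle_lt_trans _ _ _ (re_le_Cmod (w - z)) h).
  - exact (Rle_lt_trans _ _ _ (im_le_Cmod (w - z)) h).
Qed.

(** Balls of C are open squares, since C carries the product structure of R x R; radius e / 2 makes
    the square fit into the disc of radius e. *)
Lemma Cmod_of_ball (z w : C) (e : R) : ball z (e / 2) w -> (Cmod (w - z) < e)%R.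
Proof.
  intros [h1 h2]. eapply Rle_lt_trans; [apply Cmod_le_sum |].
  change (Rabs (fst w - fst z) < e / 2)%R in h1.
  change (Rabs (snd w - snd z) < e / 2)%R in h2.
  simpl. unfold Rminus in *. lra.
Qed.

(** * Continuity and complex differentiation *)

Section Continuity.
Context {T : UniformSpace}.
Implicit Types f g : T -> C.

Lemma continuous_C_parts f x :
  continuous (fun y => fst (f y) : R) x -> continuous (fun y => snd (f y) : R) x ->
  continuous f x.
Proof.
  intros h1 h2.
  apply continuous_ext with (f := fun y => (fst (f y), snd (f y))).
  { intros y; destruct (f y); reflexivity. }
  apply (continuous_comp_2 (fun y => fst (f y)) (fun y => snd (f y)) (fun u v => (u, v)) x h1 h2).
  apply continuous_ext with (f := fun z : R * R => z).
  { intros [u v]; reflexivity. }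
  apply continuous_id.
Qed.

Lemma continuous_Re f x : continuous f x -> continuous (fun y => fst (f y) : R) x.
Proof.
  intros h. apply (continuous_comp f (fst : C -> R)); [exact h |].
  destruct (f x); apply continuous_fst.
Qed.

Lemma continuous_Im f x : continuous f x -> continuous (fun y => snd (f y) : R) x.
Proof.
  intros h. apply (continuous_comp f (snd : C -> R)); [exact h |].
  destruct (f x); apply continuous_snd.
Qed.

Lemma continuous_Cplus f g x :
  continuous f x -> continuous g x -> continuous (fun y => f y + g y) x.
Proof.
  intros h1 h2. apply continuous_C_parts; simpl.
  - apply (continuous_plus (V := R_NormedModule)); apply continuous_Re; assumption.
  - apply (continuous_plus (V := R_NormedModule)); apply continuous_Im; assumption.
Qed.

Lemma continuous_Copp f x : continuous f x -> continuous (fun y => - f y) x.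
Proof.
  intros h1. apply continuous_C_parts; simpl.
  - apply (continuous_opp (V := R_NormedModule)); apply continuous_Re; assumption.
  - apply (continuous_opp (V := R_NormedModule)); apply continuous_Im; assumption.
Qed.

Lemma continuous_Cminus f g x :
  continuous f x -> continuous g x -> continuous (fun y => f y - g y) x.
Proof. intros h1 h2. apply continuous_Cplus; [| apply continuous_Copp]; assumption. Qed.

Lemma continuous_Rprod (u v : T -> R) x :
  continuous u x -> continuous v x -> continuous (fun y => (u y * v y)%R) x.
Proof. apply (continuous_mult (K := R_AbsRing)). Qed.

Lemma continuous_Cmult f g x :
  continuous f x -> continuous g x -> continuous (fun y => f y * g y) x.
Proof.
  intros h1 h2.
  pose proof (continuous_Re _ _ h1); pose proof (continuous_Im _ _ h1).
  pose proof (continuous_Re _ _ h2); pose proof (continuous_Im _ _ h2).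
  apply continuous_C_parts; simpl.
  - apply (continuous_minus (V := R_NormedModule)); apply continuous_Rprod; assumption.
  - apply (continuous_plus (V := R_NormedModule)); apply continuous_Rprod; assumption.
Qed.

Lemma continuous_Cinv f x : continuous f x -> f x <> 0 -> continuous (fun y => / f y) x.
Proof.
  intros h1 hn.
  pose proof (continuous_Re _ _ h1) as hr; pose proof (continuous_Im _ _ h1) as hi.
  assert (hd : continuous (fun y => (/ (fst (f y) * fst (f y) + snd (f y) * snd (f y)))%R) x).
  { apply (continuous_comp (fun y => (fst (f y) * fst (f y) + snd (f y) * snd (f y))%R) Rinv).
    - apply (continuous_plus (V := R_NormedModule)
        (fun y => fst (f y) * fst (f y))%R (fun y => snd (f y) * snd (f y))%R);
        apply continuous_Rprod; assumption.
    - apply continuous_Rinv. intros e. apply hn. apply C_eq; simpl; nra. }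
  assert (e : forall u v : R, (u * (u * 1) + v * (v * 1) = u * u + v * v)%R) by (intros; ring).
  apply continuous_C_parts; simpl; unfold Rdiv.
  1: apply (continuous_ext (fun y => (fst (f y) * / (fst (f y) * fst (f y) + snd (f y) * snd (f y)))%R));
    [intros y; now rewrite e |].
  2: apply (continuous_ext (fun y => (- snd (f y) * / (fst (f y) * fst (f y) + snd (f y) * snd (f y)))%R));
    [intros y; now rewrite e |].
  all: apply continuous_Rprod; try assumption.
  apply (continuous_opp (V := R_NormedModule)); assumption.
Qed.

Lemma continuous_Cdiv f g x :
  continuous f x -> continuous g x -> g x <> 0 -> continuous (fun y => f y / g y) x.
Proof. intros h1 h2 h3. apply continuous_Cmult; [| apply continuous_Cinv]; assumption. Qed.

Lemma continuous_Cpow f n x : continuous f x -> continuous (fun y => f y ^ n) x.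
Proof.
  intros h; induction n as [|n IH]; simpl.
  - apply continuous_const.
  - apply continuous_Cmult; assumption.
Qed.

Lemma continuous_C_eps f x :
  continuous f x <-> forall eps, (0 < eps)%R -> locally x (fun y => (Cmod (f y - f x) < eps)%R).
Proof.
  split.
  - intros h eps he.
    assert (he2 : (0 < eps / 2)%R) by lra.
    apply (h (fun w => (Cmod (w - f x) < eps)%R)).
    exists (mkposreal _ he2). intros w hw. now apply Cmod_of_ball.
  - intros h P [eps hP].
    refine (filter_imp _ _ _ (h eps (cond_pos eps))). intros y hy. now apply hP, ball_of_Cmod.
Qed.

Lemma continuous_C_neq_0 f x : continuous f x -> f x <> 0 -> locally x (fun y => f y <> 0).
Proof.
  intros h hn. apply continuous_C_eps with (eps := Cmod (f x)) in h.
  2: { now apply Cmod_gt_0. }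
  revert h; apply filter_imp. intros y hy e. rewrite e in hy.
  replace (0 - f x) with (- f x) in hy by ring. rewrite Cmod_opp in hy. lra.
Qed.

Lemma continuous_Cmod f x : continuous f x -> continuous (fun y => Cmod (f y) : R) x.
Proof.
  intros h P [eps hP].
  apply continuous_C_eps with (eps := eps) in h; [| apply cond_pos].
  refine (filter_imp _ _ _ h). intros y hy. apply hP.
  change (Rabs (Cmod (f y) - Cmod (f x)) < eps)%R.
  pose proof (Cmod_triangle_rev (f y) (f x)). pose proof (Cmod_triangle_rev (f x) (f y)).
  rewrite (Cmod_dist_sym (f x)) in H0. apply Rabs_def1; lra.
Qed.

End Continuity.

Lemma locally_C_Cmod (z : C) (P : C -> Prop) :
  locally z P <-> exists d, (0 < d)%R /\ forall w, (Cmod (w - z) < d)%R -> P w.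
Proof.
  split.
  - intros [d h]. exists d. split; [apply cond_pos |]. intros w hw. now apply h, ball_of_Cmod.
  - intros [d [hd h]].
    assert (hd2 : (0 < d / 2)%R) by lra.
    exists (mkposreal _ hd2). intros w hw. now apply h, Cmod_of_ball.
Qed.

(** Continuity by recursion on the expression. What remains are the nonvanishing of denominators and
    the leaves that are not among the hypotheses. *)
Ltac ccont := lazymatch goal with
  | |- continuous (fun x => x) _ => apply continuous_id
  | |- continuous (fun _ => ?c) _ => apply continuous_const
  | |- continuous (fun x => @?f x + @?g x) _ => apply (continuous_Cplus f g); ccont
  | |- continuous (fun x => @?f x - @?g x) _ => apply (continuous_Cminus f g); ccont
  | |- continuous (fun x => - @?f x) _ => apply (continuous_Copp f); ccont
  | |- continuous (fun x => @?f x * @?g x) _ => apply (continuous_Cmult f g); ccont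
  | |- continuous (fun x => @?f x ^ ?n) _ => apply (continuous_Cpow f n); ccont
  | |- continuous (fun x => @?f x / @?g x) _ => apply (continuous_Cdiv f g); [ccont | ccont |]
  | |- continuous (fun x => / @?f x) _ => apply (continuous_Cinv f); [ccont |]
  | |- _ => try assumption
  end.

(* Caratheodory's form of complex differentiability. *)
Definition cderiv (f : C -> C) (z l : C) : Prop :=
  exists phi : C -> C, continuous phi z /\ phi z = l /\
    locally z (fun w => f w - f z = phi w * (w - z)).

Lemma cderiv_continuous f z l : cderiv f z l -> continuous f z.
Proof.
  intros [phi [h1 [_ h2]]].
  apply continuous_ext_loc with (g := fun w => f z + phi w * (w - z)).
  - revert h2; apply filter_imp. intros w hw. rewrite <- hw. cring.
  - ccont.
Qed.

Lemma cderiv_ext_loc f g z l :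
  locally z (fun w => f w = g w) -> cderiv f z l -> cderiv g z l.
Proof.
  intros he [phi [h1 [h2 h3]]]. exists phi. refine (conj h1 (conj h2 _)).
  pose proof (locally_singleton _ _ he) as h0.
  generalize (filter_and _ _ he h3). apply filter_imp. intros w [e1 e2].
  rewrite <- e1, <- h0. exact e2.
Qed.

Lemma cderiv_const c z : cderiv (fun _ => c) z 0.
Proof.
  exists (fun _ => 0). refine (conj _ (conj eq_refl _)); [ccont |]. apply filter_forall. intros; ring.
Qed.

Lemma cderiv_id z : cderiv (fun w => w) z 1.
Proof.
  exists (fun _ => 1). refine (conj _ (conj eq_refl _)); [ccont |]. apply filter_forall. intros; ring.
Qed.

Lemma cderiv_plus f g z lf lg :
  cderiv f z lf -> cderiv g z lg -> cderiv (fun w => f w + g w) z (lf + lg).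
Proof.
  intros [p [h1 [h2 h3]]] [r [k1 [k2 k3]]].
  exists (fun w => p w + r w). refine (conj _ (conj _ _)).
  - ccont.
  - now rewrite h2, k2.
  - generalize (filter_and _ _ h3 k3). apply filter_imp. intros w [e1 e2].
    replace (f w + g w - (f z + g z)) with ((f w - f z) + (g w - g z)) by ring.
    rewrite e1, e2. ring.
Qed.

Lemma cderiv_mult f g z lf lg :
  cderiv f z lf -> cderiv g z lg -> cderiv (fun w => f w * g w) z (lf * g z + f z * lg).
Proof.
  intros hf hg. pose proof (cderiv_continuous _ _ _ hg) as cg.
  destruct hf as [p [h1 [h2 h3]]], hg as [r [k1 [k2 k3]]].
  exists (fun w => p w * g w + f z * r w). refine (conj _ (conj _ _)).
  - ccont.
  - now rewrite h2, k2.
  - generalize (filter_and _ _ h3 k3). apply filter_imp. intros w [e1 e2].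
    replace (f w * g w - f z * g z) with ((f w - f z) * g w + f z * (g w - g z)) by ring.
    rewrite e1, e2. ring.
Qed.

Lemma cderiv_inv f z l :
  cderiv f z l -> f z <> 0 -> cderiv (fun w => / f w) z (- l / (f z * f z)).
Proof.
  intros hf hn. pose proof (cderiv_continuous _ _ _ hf) as cf.
  pose proof (continuous_C_neq_0 _ _ cf hn) as hn'.
  destruct hf as [p [h1 [h2 h3]]].
  exists (fun w => - p w / (f w * f z)). refine (conj _ (conj _ _)).
  - ccont. apply Cmult_neq_0; assumption.
  - now rewrite h2.
  - generalize (filter_and _ _ h3 hn'). apply filter_imp. intros w [e1 e2].
    replace (/ f w - / f z) with (- (f w - f z) / (f w * f z)).
    + rewrite e1. field. split; assumption.
    + field. split; assumption.
Qed.

Lemma cderiv_comp f g z lf lg :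
  cderiv g z lg -> cderiv f (g z) lf -> cderiv (fun w => f (g w)) z (lf * lg).
Proof.
  intros hg hf. pose proof (cderiv_continuous _ _ _ hg) as cg.
  destruct hf as [p [h1 [h2 h3]]], hg as [r [k1 [k2 k3]]].
  exists (fun w => p (g w) * r w). refine (conj _ (conj _ _)).
  - apply continuous_Cmult; [| assumption].
    apply (continuous_comp g p); assumption.
  - now rewrite h2, k2.
  - pose proof (cg _ h3) as h3'. unfold filtermap in h3'.
    generalize (filter_and _ _ h3' k3). apply filter_imp. intros w [e1 e2].
    rewrite e1, e2. ring.
Qed.

(** The difference quotient with [l] filled in at [z]: a witness [phi] for [cderiv] that is defined
    everywhere. In Cauchy's formula it serves as the integrand whose singularity has been
    removed. *)
Definition dquot (f : C -> C) (z l w : C) : C :=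
  if excluded_middle_informative (w = z) then l else (f w - f z) / (w - z).

Lemma dquot_eq f z l w : f w - f z = dquot f z l w * (w - z).
Proof.
  unfold dquot. destruct excluded_middle_informative as [-> | h].
  - ring.
  - field. intros e. apply h. replace w with (w - z + z) by ring. rewrite e; ring.
Qed.

Lemma dquot_at f z l : dquot f z l z = l.
Proof. unfold dquot. now destruct excluded_middle_informative. Qed.

Lemma dquot_neq f z l w : w <> z -> dquot f z l w = (f w - f z) / (w - z).
Proof. intros h. unfold dquot. destruct excluded_middle_informative; [contradiction | reflexivity]. Qed.

Lemma Cminus_neq_0 (x y : C) : x <> y -> x - y <> 0.
Proof. intros h e. apply h. replace x with (x - y + y) by ring. rewrite e; ring. Qed.

Lemma continuous_dquot f z l : cderiv f z l -> continuous (dquot f z l) z.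
Proof.
  intros [p [h1 [h2 h3]]].
  apply continuous_ext_loc with (g := p); [| exact h1].
  revert h3; apply filter_imp. intros w hw. unfold dquot.
  destruct excluded_middle_informative as [-> | hn]; [now symmetry |].
  rewrite hw. cfield. now apply Cminus_neq_0.
Qed.

(** * Derivatives of complex curves *)

Lemma norm_C_R (z : C) : norm (K := R_AbsRing) (V := C_R_NormedModule) z = Cmod z.
Proof.
  destruct z as [x y].
  change (sqrt (Rabs x ^ 2 + Rabs y ^ 2) = sqrt (x ^ 2 + y ^ 2))%R.
  now rewrite !pow2_abs.
Qed.

Notation is_derive_RC := (is_derive (K := R_AbsRing) (V := C_R_NormedModule)).
Notation is_RInt_C := (is_RInt (V := C_R_NormedModule)).

Lemma is_derive_RC_continuous (u : R -> C) t l : is_derive_RC u t l -> continuous u t.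
Proof.
  intros h. apply (ex_derive_continuous (K := R_AbsRing) (V := C_R_NormedModule)). now exists l.
Qed.

Lemma is_derive_RC_eps (u : R -> C) (t : R) (l : C) :
  is_derive_RC u t l <->
  forall eps, (0 < eps)%R ->
    locally t (fun s => (Cmod (u s - u t - (s - t)%R * l) <= eps * Rabs (s - t))%R).
Proof.
  assert (E : forall s, norm (K := R_AbsRing) (V := C_R_NormedModule)
      (minus (minus (u s) (u t)) (scal (minus s t) l)) = Cmod (u s - u t - (s - t)%R * l)).
  { intros s. eapply eq_trans; [apply norm_C_R |]. apply f_equal. apply C_eq;
      unfold minus, plus, opp, scal; simpl; unfold mult, scal, plus, opp; simpl;
      unfold mult; simpl; ring. }
  split.
  - intros [_ h] eps he. specialize (h t (fun P H => H) (mkposreal _ he)).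
    revert h; apply filter_imp. intros s hs. eapply Rle_trans; [right; symmetry; apply E | exact hs].
  - intros h. split; [apply is_linear_scal_l |].
    intros x hx. apply (is_filter_lim_locally_unique (K := R_AbsRing) (V := R_NormedModule)) in hx.
    subst x. intros eps. refine (filter_imp _ _ _ (h eps (cond_pos eps))).
    intros s hs. eapply Rle_trans; [right; apply E | exact hs].
Qed.

Definition rquot (u : R -> C) (t : R) (l : C) (s : R) : C :=
  if excluded_middle_informative (s = t) then l else (u s - u t) / (s - t)%R.

Lemma rquot_eq u t l s : u s - u t = rquot u t l s * (s - t)%R.
Proof.
  unfold rquot. destruct excluded_middle_informative as [-> | h].
  - rewrite RtoC_minus. ring.
  - field. apply RtoC_neq_0. lra.
Qed.

Lemma rquot_at u t l : rquot u t l t = l.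
Proof. unfold rquot. now destruct excluded_middle_informative. Qed.

Lemma continuous_rquot u t l : is_derive_RC u t l -> continuous (rquot u t l) t.
Proof.
  intros h. rewrite is_derive_RC_eps in h. apply continuous_C_eps. intros eps he.
  generalize (h (eps / 2)%R ltac:(lra)). apply filter_imp. intros s hs.
  pose proof (rquot_at u t l) as e0.
  rewrite e0. rewrite rquot_eq with (l := l) in hs.
  destruct (classic (s = t)) as [-> | hne].
  - rewrite e0. replace (l - l) with (RtoC 0) by ring. rewrite Cmod_0. assumption.
  - replace (rquot u t l s * (s - t)%R - (s - t)%R * l) with ((rquot u t l s - l) * (s - t)%R) in hs by ring.
    rewrite Cmod_mult, Cmod_R in hs. assert (hp : (0 < Rabs (s - t))%R) by (apply Rabs_pos_lt; lra).
    apply Rmult_le_reg_r in hs; [lra | assumption].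
Qed.

Lemma is_derive_RC_of_quot (u psi : R -> C) t :
  continuous psi t -> locally t (fun s => u s - u t = psi s * (s - t)%R) ->
  is_derive_RC u t (psi t).
Proof.
  intros hc hl. apply is_derive_RC_eps. intros eps he.
  generalize (filter_and _ _ (proj1 (continuous_C_eps psi t) hc eps he) hl).
  apply filter_imp. intros s [h ->].
  replace (psi s * (s - t)%R - (s - t)%R * psi t) with ((psi s - psi t) * (s - t)%R) by ring.
  rewrite Cmod_mult, Cmod_R. apply Rmult_le_compat_r; [apply Rabs_pos | lra].
Qed.

(** The Caratheodory factors of [F] and [p] multiply, so values of [s] with p s = p t need no
    separate treatment. *)
Lemma is_derive_RC_comp (F : C -> C) (p : R -> C) t l v :
  cderiv F (p t) l -> is_derive_RC p t v -> is_derive_RC (fun s => F (p s)) t (l * v).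
Proof.
  intros [phi [h1 [<- h3]]] hp. pose proof (is_derive_RC_continuous _ _ _ hp) as cp.
  rewrite <- (rquot_at p t v). apply (is_derive_RC_of_quot _ (fun s => phi (p s) * rquot p t v s)).
  - apply continuous_Cmult; [now apply (continuous_comp p phi) | now apply continuous_rquot].
  - pose proof (cp _ h3) as h. unfold filtermap in h.
    revert h; apply filter_imp. intros s e.
    rewrite e, (rquot_eq p t v). ring.
Qed.

Lemma is_derive_RC_parts (u : R -> C) t (l : C) :
  is_derive (fun s => fst (u s) : R) t (fst l) -> is_derive (fun s => snd (u s) : R) t (snd l) ->
  is_derive_RC u t l.
Proof.
  intros [_ h1] [_ h2]. rewrite is_derive_RC_eps. intros eps he.
  assert (he2 : (0 < eps / 2)%R) by lra.
  specialize (h1 t (fun P H => H) (mkposreal _ he2)).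
  specialize (h2 t (fun P H => H) (mkposreal _ he2)).
  generalize (filter_and _ _ h1 h2). apply filter_imp. intros s [k1 k2].
  eapply Rle_trans; [apply Cmod_le_sum |].
  change (Rabs (fst (u s) - fst (u t) - (s - t) * fst l) <= eps / 2 * Rabs (s - t))%R in k1.
  change (Rabs (snd (u s) - snd (u t) - (s - t) * snd l) <= eps / 2 * Rabs (s - t))%R in k2.
  replace (fst (u s - u t - (s - t)%R * l)) with (fst (u s) - fst (u t) - (s - t) * fst l)%R
    by (simpl; ring).
  replace (snd (u s - u t - (s - t)%R * l)) with (snd (u s) - snd (u t) - (s - t) * snd l)%R
    by (simpl; ring).
  lra.
Qed.

(** * Integrals of complex valued functions of a real variable *)

Lemma is_RInt_C_unique (f : R -> C) a b v w : is_RInt_C f a b v -> is_RInt_C f a b w -> v = w.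
Proof.
  intros h1 h2. rewrite <- (is_RInt_unique (V := C_R_CompleteNormedModule) _ _ _ _ h1).
  apply (is_RInt_unique (V := C_R_CompleteNormedModule) _ _ _ _ h2).
Qed.

Lemma is_RInt_C_plus (f g : R -> C) a b v w :
  is_RInt_C f a b v -> is_RInt_C g a b w -> is_RInt_C (fun t => f t + g t) a b (v + w).
Proof. apply (is_RInt_plus (V := C_R_NormedModule)). Qed.

Lemma is_RInt_C_minus (f g : R -> C) a b v w :
  is_RInt_C f a b v -> is_RInt_C g a b w -> is_RInt_C (fun t => f t - g t) a b (v - w).
Proof. apply (is_RInt_minus (V := C_R_NormedModule)). Qed.

(** [C_R_NormedModule] is a module over R; a complex factor mixes real and imaginary parts, which
    are therefore integrated separately. *)
Lemma is_RInt_C_scal (f : R -> C) a b c v :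
  is_RInt_C f a b v -> is_RInt_C (fun t => c * f t) a b (c * v).
Proof.
  intros h.
  pose proof (is_RInt_fct_extend_fst (U := R_NormedModule) (V := R_NormedModule) _ _ _ _ h) as h1.
  pose proof (is_RInt_fct_extend_snd (U := R_NormedModule) (V := R_NormedModule) _ _ _ _ h) as h2.
  apply (is_RInt_fct_extend_pair (U := R_NormedModule) (V := R_NormedModule)); simpl.
  - apply (is_RInt_minus (V := R_NormedModule));
      apply (is_RInt_scal (V := R_NormedModule)); assumption.
  - apply (is_RInt_plus (V := R_NormedModule));
      apply (is_RInt_scal (V := R_NormedModule)); assumption.
Qed.

Lemma is_RInt_C_const (c : C) a b : is_RInt_C (fun _ => c) a b ((b - a)%R * c).
Proof.
  replace ((b - a)%R * c) with (scal (b - a)%R c : C_R_NormedModule).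
  - apply (is_RInt_const (V := C_R_NormedModule)).
  - apply C_eq; unfold scal; simpl; unfold scal; simpl; unfold mult; simpl; ring.
Qed.

Lemma is_RInt_C_ext (f g : R -> C) a b v :
  (a <= b)%R -> (forall t, (a <= t <= b)%R -> f t = g t) -> is_RInt_C f a b v -> is_RInt_C g a b v.
Proof.
  intros hab h. apply (is_RInt_ext (V := C_R_NormedModule)).
  rewrite Rmin_left, Rmax_right by assumption. intros; apply h; lra.
Qed.

Lemma is_RInt_C_bound (f : R -> C) a b v M :
  (a <= b)%R -> (forall t, (a <= t <= b)%R -> (Cmod (f t) <= M)%R) -> is_RInt_C f a b v ->
  (Cmod v <= (b - a) * M)%R.
Proof.
  intros hab h hi. rewrite <- norm_C_R.
  apply (norm_RInt_le_const (V := C_R_NormedModule) f a b v M hab); [| exact hi].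
  intros t ht. rewrite norm_C_R. auto.
Qed.

Lemma ex_RInt_C (f : R -> C) a b :
  (a <= b)%R -> (forall t, (a <= t <= b)%R -> continuous f t) -> exists v, is_RInt_C f a b v.
Proof.
  intros hab h. apply (ex_RInt_continuous (V := C_R_CompleteNormedModule)).
  rewrite Rmin_left, Rmax_right by assumption. exact h.
Qed.

Lemma is_RInt_C_derive (f df : R -> C) a b :
  (a <= b)%R -> (forall t, (a <= t <= b)%R -> is_derive_RC f t (df t)) ->
  (forall t, (a <= t <= b)%R -> continuous df t) -> is_RInt_C df a b (f b - f a).
Proof.
  intros hab h1 h2.
  apply (is_RInt_derive (V := C_R_CompleteNormedModule));
    rewrite Rmin_left, Rmax_right by assumption; assumption.
Qed.

Lemma is_RInt_C_Chasles (f : R -> C) a b c v w :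
  is_RInt_C f a b v -> is_RInt_C f b c w -> is_RInt_C f a c (v + w).
Proof. apply (is_RInt_Chasles (V := C_R_NormedModule)). Qed.

(** * Uniform convergence on [0, 1] *)

Definition unif_cv (u : nat -> R -> C) (v : R -> C) : Prop :=
  forall eps, (0 < eps)%R -> exists N, forall n, (N <= n)%nat ->
    forall t, (0 <= t <= 1)%R -> (Cmod (u n t - v t) < eps)%R.

Definition cont01 (u : R -> C) : Prop := forall t, (0 <= t <= 1)%R -> continuous u t.

Lemma cont01_bounded u : cont01 u ->
  exists M, (0 < M)%R /\ forall t, (0 <= t <= 1)%R -> (Cmod (u t) <= M)%R.
Proof.
  intros h. destruct (continuity_ab_maj (fun t => Cmod (u t)) 0 1) as [m [h1 h2]].
  - lra.
  - intros c hc. apply continuity_pt_filterlim. apply continuous_Cmod. apply h, hc.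
  - exists (Cmod (u m) + 1)%R. split.
    + pose proof (Cmod_ge_0 (u m)); lra.
    + intros t ht. specialize (h1 t ht). simpl in h1. lra.
Qed.

Lemma cont01_away u : cont01 u -> (forall t, (0 <= t <= 1)%R -> u t <> 0) ->
  exists m, (0 < m)%R /\ forall t, (0 <= t <= 1)%R -> (m <= Cmod (u t))%R.
Proof.
  intros h hn. destruct (continuity_ab_min (fun t => Cmod (u t)) 0 1) as [m [h1 h2]].
  - lra.
  - intros c hc. apply continuity_pt_filterlim. apply continuous_Cmod. apply h, hc.
  - exists (Cmod (u m)). split.
    + apply Cmod_gt_0. auto.
    + exact h1.
Qed.

Lemma unif_cv_const v : unif_cv (fun _ => v) v.
Proof.
  intros eps he. exists O. intros. replace (v t - v t) with (0 : C) by ring. rewrite Cmod_0. lra.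
Qed.

Lemma unif_cv_mult u v u' v' :
  cont01 u' -> cont01 v' -> unif_cv u u' -> unif_cv v v' ->
  unif_cv (fun n t => u n t * v n t) (fun t => u' t * v' t).
Proof.
  intros cu cv hu hv eps he.
  destruct (cont01_bounded _ cu) as [M1 [p1 b1]], (cont01_bounded _ cv) as [M2 [p2 b2]].
  (* With errors x, y < e <= 1 the product is off by at most x y + x M2 + M1 y, hence by at most e
     (1 + M1 + M2). *)
  set (e := Rmin 1 (eps / (1 + M1 + M2))).
  assert (he1 : (0 < e)%R) by (apply Rmin_glb_lt; [| apply Rdiv_lt_0_compat]; lra).
  assert (he2 : (e * (1 + M1 + M2) <= eps)%R).
  { apply Rle_trans with (eps / (1 + M1 + M2) * (1 + M1 + M2))%R.
    - apply Rmult_le_compat_r; [lra | apply Rmin_r].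
    - right; field; lra. }
  pose proof (Rmin_l 1 (eps / (1 + M1 + M2)) : (e <= 1)%R) as he3.
  destruct (hu e he1) as [N1 h1], (hv e he1) as [N2 h2].
  exists (max N1 N2). intros n hn t ht.
  specialize (h1 n ltac:(lia) t ht). specialize (h2 n ltac:(lia) t ht).
  specialize (b1 t ht). specialize (b2 t ht).
  replace (u n t * v n t - u' t * v' t)
    with ((u n t - u' t) * (v n t - v' t) + (u n t - u' t) * v' t + u' t * (v n t - v' t)) by ring.
  eapply Rle_lt_trans; [apply Cmod_triangle |].
  eapply Rle_lt_trans; [apply Rplus_le_compat_r, Cmod_triangle |]. rewrite !Cmod_mult.
  pose proof (Cmod_ge_0 (u n t - u' t)). pose proof (Cmod_ge_0 (v n t - v' t)).
  generalize dependent (Cmod (u n t - u' t)). generalize dependent (Cmod (v n t - v' t)).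
  intros y hy1 hy2 x hx1 hx2.
  assert (x * y <= e * y)%R by nra. assert (x * Cmod (v' t) <= e * M2)%R by nra.
  assert (Cmod (u' t) * y <= M1 * e)%R by nra. nra.
Qed.

Lemma unif_cv_inv u u' :
  cont01 u' -> (forall t, (0 <= t <= 1)%R -> u' t <> 0) -> unif_cv u u' ->
  unif_cv (fun n t => / u n t) (fun t => / u' t).
Proof.
  intros cu hn hu eps he.
  destruct (cont01_away _ cu hn) as [m [pm hm]].
  (* The first bound keeps |u n| above m / 2, so the product of the denominators exceeds m^2 / 2;
     the second bound compensates for that. *)
  destruct (hu (Rmin (m / 2) (eps * m * m / 2))) as [N h].
  { apply Rmin_glb_lt; [lra |]. repeat apply Rmult_lt_0_compat; lra. }
  exists N. intros n hN t ht. specialize (h n hN t ht). specialize (hm t ht). specialize (hn t ht).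
  apply Rmin_Rgt_l in h. destruct h as [h1 h2].
  pose proof (Cmod_triangle_rev (u' t) (u n t)) as h3. rewrite Cmod_dist_sym in h3.
  assert (hun : (m / 2 < Cmod (u n t))%R) by lra.
  assert (u n t <> 0) by (apply Cmod_gt_0; lra).
  replace (/ u n t - / u' t) with (- (u n t - u' t) / (u n t * u' t)) by (field; split; assumption).
  rewrite Cmod_div by (apply Cmult_neq_0; assumption). rewrite Cmod_opp, Cmod_mult.
  apply Rmult_lt_reg_r with (Cmod (u n t) * Cmod (u' t))%R; [nra |].
  unfold Rdiv. rewrite Rmult_assoc, Rinv_l, Rmult_1_r by nra.
  apply Rlt_le_trans with (1 := h2).
  assert (m / 2 * m <= Cmod (u n t) * Cmod (u' t))%R by (apply Rmult_le_compat; lra). nra.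
Qed.

Lemma is_RInt_unif_cv u v h :
  unif_cv u v -> (forall n, is_RInt_C (u n) 0 1 (h n)) ->
  exists l, filterlim h eventually (locally (l : C)) /\ is_RInt_C v 0 1 l.
Proof.
  intros huv hi.
  (* Convergence in the function space is uniform on all of R, whereas [unif_cv] controls [0, 1]
     only; with the value 0 outside, the two agree. *)
  set (cut := fun (f : R -> C) t => if excluded_middle_informative (0 <= t <= 1)%R then f t else 0).
  assert (hc : forall f t, (0 <= t <= 1)%R -> cut f t = f t).
  { intros f t ht. unfold cut. destruct excluded_middle_informative; [reflexivity | contradiction]. }
  destruct (filterlim_RInt (V := C_R_CompleteNormedModule) (fun n => cut (u n)) 0 1 eventually _
    (cut v) h) as [l [h1 h2]].
  - intros n. apply is_RInt_C_ext with (u n); [lra | | apply hi].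
    intros t ht. now rewrite hc.
  - apply filterlim_locally. intros eps.
    destruct (huv eps (cond_pos eps)) as [N hN]. exists N. intros n hn t.
    assert (hb : (Cmod (cut (u n) t - cut v t) < eps)%R).
    { unfold cut. destruct excluded_middle_informative as [ht | ht].
      - apply hN; assumption.
      - replace (0 - 0) with (0 : C) by ring. rewrite Cmod_0. apply cond_pos. }
    exact (ball_of_Cmod _ _ _ hb).
  - exists l. split; [exact h1 |].
    apply is_RInt_C_ext with (cut v); [lra | apply hc | exact h2].
Qed.

(** * Contour integrals of rational functions and their limits *)

Lemma cderiv_pow f z l n :
  cderiv f z l -> cderiv (fun w => f w ^ S n) z (INR (S n) * f z ^ n * l).
Proof.
  intros h. induction n as [|n IH].
  - simpl. replace (1 * 1 * l) with (l * 1 + f z * 0) by ring.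
    apply cderiv_mult; [assumption | apply cderiv_const].
  - replace (INR (S (S n)) * f z ^ S n * l)
      with (l * f z ^ S n + f z * (INR (S n) * f z ^ n * l)).
    + apply (cderiv_mult f (fun w => f w ^ S n)); assumption.
    + rewrite (S_INR (S n)), RtoC_plus. rewrite Cpow_S. ring.
Qed.

Lemma cderiv_sub_const p z : cderiv (fun w => w - p) z 1.
Proof.
  replace (1 : C) with (1 + 0) by ring.
  apply (cderiv_plus (fun w => w) (fun _ => - p)); [apply cderiv_id | apply cderiv_const].
Qed.

Lemma path_continuous (g : contour) t : (0 <= t <= 1)%R -> continuous (path g) t.
Proof. intros ht. apply is_derive_RC_continuous with (vel g t). now apply path_derive. Qed.

Lemma contour_integral_primitive (g : contour) (F f : C -> C) :
  (forall t, (0 <= t <= 1)%R -> cderiv F (path g t) (f (path g t))) ->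
  (forall t, (0 <= t <= 1)%R -> continuous f (path g t)) ->
  is_contour_integral f g 0.
Proof.
  intros h1 h2. unfold is_contour_integral.
  replace (0 : C) with (F (path g 1) - F (path g 0)) by (rewrite path_closed; ring).
  apply (is_RInt_C_derive (fun t => F (path g t))); [lra | |].
  - intros t ht. apply is_derive_RC_comp; [now apply h1 | now apply path_derive].
  - intros t ht. apply (continuous_Cmult (fun s => f (path g s))).
    + apply (continuous_comp (path g) f); [now apply path_continuous | now apply h2].
    + now apply vel_continuous.
Qed.

Lemma Cdiv_1_r (x : C) : x / 1 = x.
Proof. field. Qed.

Fixpoint prod_inv (ps : list C) (z : C) : C :=
  match ps with
  | [] => 1
  | p :: ps' => / (z - p) * prod_inv ps' z
  end.

Section TwoContours.

Variables (g1 g2 : contour) (Pole : C -> Prop).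

(** The existence of both integrals is part of the notion, so that it passes to sums and limits
    together with the equality. *)
Definition same_int (f : C -> C) : Prop :=
  exists v, is_contour_integral f g1 v /\ is_contour_integral f g2 v.

Hypothesis avoid1 : forall p, Pole p -> forall t, (0 <= t <= 1)%R -> path g1 t <> p.
Hypothesis avoid2 : forall p, Pole p -> forall t, (0 <= t <= 1)%R -> path g2 t <> p.
Hypothesis same_winding : forall p, Pole p -> same_int (fun z => / (z - p)).

Definition regular (z : C) : Prop := forall p, Pole p -> z <> p.

Lemma same_int_ext f h : (forall z, regular z -> f z = h z) -> same_int f -> same_int h.
Proof.
  intros he [v [h1 h2]]. exists v; split.
  - apply is_RInt_C_ext with (3 := h1); [lra |]. intros t ht. rewrite he; [reflexivity |].
    intros p hp. now apply avoid1.
  - apply is_RInt_C_ext with (3 := h2); [lra |]. intros t ht. rewrite he; [reflexivity |].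
    intros p hp. now apply avoid2.
Qed.

Lemma same_int_plus f h : same_int f -> same_int h -> same_int (fun z => f z + h z).
Proof.
  intros [v [h1 h2]] [w [k1 k2]]. exists (v + w); split.
  - apply is_RInt_C_ext with (3 := is_RInt_C_plus _ _ _ _ _ _ h1 k1); [lra |]. intros; ring.
  - apply is_RInt_C_ext with (3 := is_RInt_C_plus _ _ _ _ _ _ h2 k2); [lra |]. intros; ring.
Qed.

Lemma same_int_scal c f : same_int f -> same_int (fun z => c * f z).
Proof.
  intros [v [h1 h2]]. exists (c * v); split.
  - apply is_RInt_C_ext with (3 := is_RInt_C_scal _ _ _ c _ h1); [lra |]. intros; ring.
  - apply is_RInt_C_ext with (3 := is_RInt_C_scal _ _ _ c _ h2); [lra |]. intros; ring.
Qed.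

Lemma same_int_primitive F f :
  (forall z, regular z -> cderiv F z (f z)) -> (forall z, regular z -> continuous f z) ->
  same_int f.
Proof.
  intros h1 h2. exists 0. split; apply contour_integral_primitive with F; intros t ht.
  1, 2 : (apply h1 || apply h2); intros p hp; now apply avoid1.
  all: (apply h1 || apply h2); intros p hp; now apply avoid2.
Qed.

Lemma same_int_monomial m : same_int (fun z => z ^ m).
Proof.
  assert (hm : RtoC (INR (S m)) <> 0) by (apply RtoC_neq_0, not_0_INR; discriminate).
  apply same_int_primitive with (fun z => / INR (S m) * z ^ S m).
  - intros z _.
    replace (z ^ m) with (0 * z ^ S m
      + / INR (S m) * (INR (S m) * z ^ m * 1)) by (field; assumption).
    apply (cderiv_mult (fun _ => _) (fun w => w ^ S m)).
    + apply cderiv_const.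
    + apply (cderiv_pow (fun w => w)), cderiv_id.
  - intros z _. ccont.
Qed.

Lemma same_int_inv_pow p k : Pole p -> same_int (fun z => (/ (z - p)) ^ k).
Proof.
  intros hp. destruct k as [|[|k]].
  - apply (same_int_monomial 0).
  - apply same_int_ext with (fun z => / (z - p)); [| now apply same_winding].
    intros; simpl; ring.
  - assert (hm : RtoC (INR (S k)) <> 0) by (apply RtoC_neq_0, not_0_INR; discriminate).
    apply same_int_primitive with (fun z => - / INR (S k) * (/ (z - p)) ^ S k).
    + intros z hz. pose proof (Cminus_neq_0 _ _ (hz p hp)).
      replace ((/ (z - p)) ^ S (S k)) with (0 * (/ (z - p)) ^ S k
        + - / INR (S k) * (INR (S k) * (/ (z - p)) ^ k
            * (- (1) / ((z - p) * (z - p))))).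
      * apply (cderiv_mult (fun _ => _) (fun w => (/ (w - p)) ^ S k)).
        -- apply cderiv_const.
        -- apply (cderiv_pow (fun w => / (w - p))).
           apply (cderiv_inv (fun w => w - p)); [apply cderiv_sub_const | assumption].
      * rewrite !Cpow_S. field. split; assumption.
    + intros z hz. ccont. now apply Cminus_neq_0, hz.
Qed.

(* Partial fractions: two distinct poles are split until a single one is left, where either a
   primitive exists or the winding number decides. *)
Lemma same_int_prod_inv ps : List.Forall Pole ps -> forall p k, Pole p ->
  same_int (fun z => (/ (z - p)) ^ k * prod_inv ps z).
Proof.
  induction 1 as [|r ps hr hps IH]; intros p k hp.
  - apply same_int_ext with (fun z => (/ (z - p)) ^ k); [| now apply same_int_inv_pow].
    intros; simpl; ring.
  - destruct (classic (r = p)) as [-> | hne].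
    + apply same_int_ext with (fun z => (/ (z - p)) ^ S k * prod_inv ps z);
        [| now apply IH].
      intros; simpl; ring.
    + pose proof (Cminus_neq_0 _ _ (not_eq_sym hne)) as hd.
      induction k as [|k IHk].
      * apply same_int_ext with (fun z => (/ (z - r)) ^ 1 * prod_inv ps z); [| now apply IH].
        intros; simpl; ring.
      * apply same_int_ext with (fun z => / (p - r) * ((/ (z - p)) ^ S k * prod_inv ps z
          + - (1) * ((/ (z - p)) ^ k * prod_inv (r :: ps) z))).
        -- intros z hz. simpl. pose proof (Cminus_neq_0 _ _ (hz p hp)).
           pose proof (Cminus_neq_0 _ _ (hz r hr)). field. repeat split; assumption.
        -- apply same_int_scal, same_int_plus; [now apply IH |]. apply same_int_scal, IHk.
Qed.

(** Writing z = (z - p) + p for one of the poles p lowers the degree of the numerator, until only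
    inverse factors remain. *)
Lemma same_int_rational m : forall ps, List.Forall Pole ps -> same_int (fun z => z ^ m * prod_inv ps z).
Proof.
  induction m as [|m IH]; intros ps hps; destruct hps as [|p ps hp hps].
  - apply same_int_ext with (2 := same_int_monomial 0). intros; simpl; ring.
  - apply same_int_ext with (2 := same_int_prod_inv ps hps p 1 hp). intros; simpl; ring.
  - apply same_int_ext with (2 := same_int_monomial (S m)). intros; simpl; ring.
  - apply same_int_ext with (fun z => z ^ m * prod_inv ps z
      + p * (z ^ m * prod_inv (p :: ps) z)).
    + intros z hz. pose proof (Cminus_neq_0 _ _ (hz p hp)). simpl. field. assumption.
    + apply same_int_plus; [| apply same_int_scal]; apply IH; [| constructor]; assumption.
Qed.

(* [ratl] holds for every rational function with poles in [Pole]; quantifying over the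
   cofactor makes it stable under multiplication by [z] and by [/ (z - p)]. *)
Definition ratl (f : C -> C) : Prop :=
  forall m ps, List.Forall Pole ps -> same_int (fun z => f z * (z ^ m * prod_inv ps z)).

Lemma ratl_same_int f : ratl f -> same_int f.
Proof.
  intros h. apply same_int_ext with (2 := h O [] (List.Forall_nil _)). intros; simpl; ring.
Qed.

Lemma ratl_ext f h : (forall z, regular z -> f z = h z) -> ratl f -> ratl h.
Proof.
  intros he hf m ps hps. apply same_int_ext with (2 := hf m ps hps).
  intros z hz. now rewrite he.
Qed.

Lemma ratl_1 : ratl (fun _ => 1).
Proof.
  intros m ps hps. apply same_int_ext with (2 := same_int_rational m ps hps). intros; ring.
Qed.

Lemma ratl_plus f h : ratl f -> ratl h -> ratl (fun z => f z + h z).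
Proof.
  intros hf hh m ps hps.
  apply same_int_ext with (2 := same_int_plus _ _ (hf m ps hps) (hh m ps hps)). intros; ring.
Qed.

Lemma ratl_scal c f : ratl f -> ratl (fun z => c * f z).
Proof.
  intros hf m ps hps.
  apply same_int_ext with (2 := same_int_scal c _ (hf m ps hps)). intros; ring.
Qed.

Lemma ratl_mult_id f : ratl f -> ratl (fun z => f z * z).
Proof.
  intros hf m ps hps.
  apply same_int_ext with (2 := hf (S m) ps hps). intros; simpl; ring.
Qed.

Lemma ratl_mult_inv f p : Pole p -> ratl f -> ratl (fun z => f z * / (z - p)).
Proof.
  intros hp hf m ps hps.
  apply same_int_ext with (2 := hf m (p :: ps) (List.Forall_cons _ hp hps)). intros; simpl; ring.
Qed.

(** 1 - c z = -c (z - 1 / c) has its zero in [Pole], except for c = 0, when the factor is 1: a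
    vanishing parameter has no exterior poles. *)
Lemma ratl_div_factor f c : (forall z, c * z = 1 -> Pole z) ->
  ratl f -> ratl (fun z => f z / (1 - c * z)).
Proof.
  intros hc hf. destruct (classic (c = 0)) as [-> | hn].
  - apply ratl_ext with (2 := hf). intros z _.
    replace (1 - 0 * z) with (1 : C) by ring. field.
  - assert (hs : Pole (/ c)) by (apply hc; now apply Cinv_r).
    apply ratl_ext with (2 := ratl_scal (- / c) _ (ratl_mult_inv _ _ hs hf)).
    intros z hz. pose proof (Cminus_neq_0 _ _ (hz _ hs)) as hd.
    assert (1 - c * z <> 0).
    { intros e. apply hd. replace (z - / c) with (- / c * (1 - c * z)) by (field; assumption).
      rewrite e; ring. }
    assert (z * c - 1 <> 0).
    { intros e. apply H. replace (1 - c * z) with (- (z * c - 1)) by ring. rewrite e. ring. }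
    field. repeat split; assumption.
Qed.

Lemma ratl_div_factor_inv f c : Pole 0 -> Pole c -> ratl f -> ratl (fun z => f z / (1 - c / z)).
Proof.
  intros h0 hc hf.
  apply ratl_ext with (2 := ratl_mult_id _ (ratl_mult_inv _ _ hc hf)).
  intros z hz. pose proof (Cminus_neq_0 _ _ (hz _ hc)). pose proof (hz _ h0).
  field. split; assumption.
Qed.

Lemma ratl_sq q c n f : Pole 0 ->
  ratl f -> ratl (fun z => f z * (qpoch (z ^ 2) q n * qpoch (c / z ^ 2) q n)).
Proof.
  intros h0 hf. induction n as [|n IH].
  - apply ratl_ext with (2 := hf). intros; simpl; ring.
  - assert (IH' : ratl (fun z => f z * (qpoch (z ^ 2) q n * qpoch (c / z ^ 2) q n)
      * (1 - z ^ 2 * q ^ n))).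
    { apply ratl_ext
        with (2 := ratl_plus _ _ IH (ratl_scal (- q ^ n) _ (ratl_mult_id _ (ratl_mult_id _ IH)))).
      intros; simpl; ring. }
    apply ratl_ext with (2 := ratl_plus _ _ IH'
      (ratl_scal (- c * q ^ n) _ (ratl_mult_inv _ 0 h0 (ratl_mult_inv _ 0 h0 IH')))).
    intros z hz. simpl qpoch. replace (z - 0) with z by ring.
    unfold Cdiv. simpl Cpow. rewrite !Cmult_1_r, Cinv_mult_total. ring.
Qed.

Lemma ratl_div_qpochs q n f es :
  (forall e, In e es -> forall k z, e * q ^ k * z = 1 -> Pole z) ->
  ratl f -> ratl (fun z => f z / qpochs (map (fun e => e * z) es) q n).
Proof.
  intros he hf. induction es as [|e es IH].
  - apply ratl_ext with (2 := hf). intros; simpl; now rewrite Cdiv_1_r.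
  - specialize (IH (fun e' h => he e' (or_intror h))).
    assert (H : forall m, ratl (fun z => f z / qpochs (map (fun e => e * z) es) q n
      / qpoch (e * z) q m)).
    { induction m as [|j IHj].
      - apply ratl_ext with (2 := IH). intros; simpl; now rewrite Cdiv_1_r.
      - apply ratl_ext with (2 := ratl_div_factor _ _ (he e (or_introl eq_refl) j) IHj).
        intros z _. simpl qpoch. unfold Cdiv. rewrite Cinv_mult_total.
        replace (e * q ^ j * z) with (e * z * q ^ j) by ring. ring. }
    apply ratl_ext with (2 := H n).
    intros z _. simpl. unfold Cdiv. rewrite Cinv_mult_total. ring.
Qed.

Lemma ratl_div_qpochs_inv q n f es : Pole 0 ->
  (forall e, In e es -> forall k, Pole (e * q ^ k)) ->
  ratl f -> ratl (fun z => f z / qpochs (map (fun e => e / z) es) q n).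
Proof.
  intros h0 he hf. induction es as [|e es IH].
  - apply ratl_ext with (2 := hf). intros; simpl; now rewrite Cdiv_1_r.
  - specialize (IH (fun e' h => he e' (or_intror h))).
    assert (H : forall m, ratl (fun z => f z / qpochs (map (fun e => e / z) es) q n
      / qpoch (e / z) q m)).
    { induction m as [|j IHj].
      - apply ratl_ext with (2 := IH). intros; simpl; now rewrite Cdiv_1_r.
      - apply ratl_ext with (2 := ratl_div_factor_inv _ _ h0 (he e (or_introl eq_refl) j) IHj).
        intros z _. simpl qpoch. unfold Cdiv. rewrite Cinv_mult_total.
        replace (e * q ^ j * / z) with (e * / z * q ^ j) by ring. ring. }
    apply ratl_ext with (2 := H n).
    intros z _. simpl. unfold Cdiv. rewrite Cinv_mult_total. ring.
Qed.

(** The approximants have one common sequence of integrals over the two contours, and uniform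
    convergence makes it tend to both integrals of [G]. *)
Lemma same_int_lim (F : nat -> C -> C) (G : C -> C) :
  (forall n, same_int (F n)) ->
  cont01 (fun t => G (path g1 t)) -> cont01 (fun t => G (path g2 t)) ->
  unif_cv (fun n t => F n (path g1 t)) (fun t => G (path g1 t)) ->
  unif_cv (fun n t => F n (path g2 t)) (fun t => G (path g2 t)) ->
  same_int G.
Proof.
  intros hF c1 c2 u1 u2.
  assert (hm : forall g : contour, cont01 (fun t => G (path g t)) ->
    unif_cv (fun n t => F n (path g t)) (fun t => G (path g t)) ->
    unif_cv (fun n t => F n (path g t) * vel g t) (fun t => G (path g t) * vel g t)).
  { intros g hc hu. apply (unif_cv_mult (fun n t => F n (path g t)) (fun _ => vel g)); try assumption.
    - intros t ht. now apply vel_continuous.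
    - apply unif_cv_const. }
  set (v := fun n => proj1_sig (constructive_indefinite_description _ (hF n))).
  assert (hv : forall n, is_contour_integral (F n) g1 (v n) /\ is_contour_integral (F n) g2 (v n)).
  { intros n. unfold v. destruct constructive_indefinite_description; simpl. assumption. }
  destruct (is_RInt_unif_cv _ _ v (hm _ c1 u1) (fun n => proj1 (hv n))) as [l1 [k1 k2]].
  destruct (is_RInt_unif_cv _ _ v (hm _ c2 u2) (fun n => proj2 (hv n))) as [l2 [j1 j2]].
  assert (l1 = l2) as <-.
  { apply (filterlim_locally_unique (F := eventually) (V := C_NormedModule) v); assumption. }
  exists l1. split; assumption.
Qed.

End TwoContours.

(** * Circles *)

Definition cis (t : R) : C := (cos (2 * PI * t), sin (2 * PI * t)).

Lemma Cmod_cis t : Cmod (cis t) = 1%R.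
Proof.
  unfold Cmod, cis; simpl. rewrite !Rmult_1_r.
  pose proof (sin2_cos2 (2 * PI * t)) as h. unfold Rsqr in h. rewrite Rplus_comm, h. apply sqrt_1.
Qed.

Lemma cis_neq_0 t : cis t <> 0.
Proof. apply Cmod_gt_0. rewrite Cmod_cis. lra. Qed.

Lemma is_derive_cis t : is_derive_RC cis t (2 * PI * Ci * cis t).
Proof.
  apply is_derive_RC_parts; simpl; auto_derive; trivial; ring.
Qed.

Lemma continuous_cis t : continuous cis t.
Proof. eapply is_derive_RC_continuous, is_derive_cis. Qed.

Lemma cis_period : cis 0 = cis 1.
Proof.
  unfold cis. rewrite Rmult_0_r, Rmult_1_r, cos_0, sin_0, cos_2PI, sin_2PI. reflexivity.
Qed.

Lemma circle_derive r t : is_derive_RC (fun s => r * cis s) t (2 * PI * Ci * (r * cis t)).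
Proof.
  replace (2 * PI * Ci * (r * cis t)) with ((0 * cis t + r * 1) * (2 * PI * Ci * cis t)) by ring.
  apply (is_derive_RC_comp (fun z => r * z)).
  - apply (cderiv_mult (fun _ => r) (fun z => z)); [apply cderiv_const | apply cderiv_id].
  - apply is_derive_cis.
Qed.

Lemma circle_vel_continuous r t : continuous (fun s => 2 * PI * Ci * (r * cis s)) t.
Proof. ccont. apply continuous_cis. Qed.

(** The radius is complex: [circle q] is the image of the unit circle under z -> q z with its
    parametrisation, so an integral over it is a mean over the unit circle of values at q z. *)
Definition circle (r : C) : contour :=
  Contour (fun t => r * cis t) (fun t => 2 * PI * Ci * (r * cis t))
    (fun t _ => circle_derive r t) (fun t _ => circle_vel_continuous r t)
    (f_equal (Cmult r) cis_period).

Lemma two_PI_i_neq_0 : 2 * PI * Ci <> 0.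
Proof.
  intros h. apply (f_equal snd) in h. simpl in h. pose proof PI_RGT_0. lra.
Qed.

Lemma mean_cis_pow k : is_RInt_C (fun t => cis t ^ S k) 0 1 (RtoC 0).
Proof.
  pose proof (contour_integral_primitive (circle 1) (fun z => / INR (S k) * z ^ S k) (fun z => z ^ k)) as h.
  assert (hm : RtoC (INR (S k)) <> 0) by (apply RtoC_neq_0, not_0_INR; discriminate).
  unfold is_contour_integral in h; simpl path in h; simpl vel in h.
  assert (h' : is_RInt_C (fun t => (1 * cis t) ^ k * (2 * PI * Ci * (1 * cis t))) 0 1 (RtoC 0)).
  { apply h; intros t _.
    - replace ((1 * cis t) ^ k) with (0 * (1 * cis t) ^ S k
        + / INR (S k) * (INR (S k) * (1 * cis t) ^ k * 1)) by (field; assumption).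
      apply (cderiv_mult (fun _ => _) (fun w => w ^ S k)).
      + apply cderiv_const.
      + apply (cderiv_pow (fun w => w)), cderiv_id.
    - ccont. }
  apply (is_RInt_C_scal _ _ _ (/ (2 * PI * Ci))) in h'.
  replace (/ (2 * PI * Ci) * 0) with (0 : C) in h' by ring.
  apply is_RInt_C_ext with (3 := h'); [lra |]. intros t _.
  replace (1 * cis t) with (cis t) by ring. rewrite Cpow_S.
  pose proof two_PI_i_neq_0 as h2.
  transitivity (/ (2 * PI * Ci) * (2 * PI * Ci) * (cis t * cis t ^ k)); [ring |].
  rewrite Cinv_l by assumption. ring.
Qed.

Lemma cis_opp t : cis (1 - t) = / cis t.
Proof.
  assert (h : cis (1 - t) * cis t = 1).
  { unfold cis. replace (2 * PI * (1 - t))%R with (- (2 * PI * t) + 2 * PI)%R by ring.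
    rewrite cos_plus, sin_plus, cos_2PI, sin_2PI, cos_neg, sin_neg.
    pose proof (sin2_cos2 (2 * PI * t)) as h. unfold Rsqr in h.
    apply C_eq; simpl; lra. }
  pose proof (cis_neq_0 t).
  replace (cis (1 - t)) with (cis (1 - t) * cis t * / cis t) by (field; assumption).
  rewrite h. ring.
Qed.

Lemma is_RInt_C_reflect (f : R -> C) v :
  is_RInt_C f 0 1 v -> is_RInt_C (fun t => f (1 - t)%R) 0 1 v.
Proof.
  intros h.
  assert (h' : is_RInt_C f (-1 * 1 + 1)%R (-1 * 0 + 1)%R v).
  { replace (-1 * 1 + 1)%R with 0%R by ring. replace (-1 * 0 + 1)%R with 1%R by ring. exact h. }
  apply (is_RInt_comp_lin (V := C_R_NormedModule)) in h'.
  apply (is_RInt_swap (V := C_R_NormedModule)) in h'.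
  apply (is_RInt_scal (V := C_R_NormedModule)) with (k := (-1)%R) in h'.
  replace v with (scal (-1)%R (opp v : C_R_NormedModule) : C).
  - apply is_RInt_C_ext with (3 := h'); [lra |]. intros t _.
    replace (-1 * t + 1)%R with (1 - t)%R by ring.
    apply C_eq; unfold scal; simpl; unfold scal; simpl; unfold mult; simpl; ring.
  - apply C_eq; unfold scal, opp; simpl; unfold scal, opp; simpl; unfold mult; simpl; ring.
Qed.

Lemma mean_cis_inv_pow k : is_RInt_C (fun t => (/ cis t) ^ S k) 0 1 (RtoC 0).
Proof.
  apply is_RInt_C_ext with (3 := is_RInt_C_reflect _ _ (mean_cis_pow k)); [lra |].
  intros t _. now rewrite cis_opp.
Qed.

Fixpoint geom (x : C) (n : nat) : C :=
  match n with O => 1 | S m => geom x m + x ^ S m end.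

Lemma unif_cv_geom (x : R -> C) (r : R) :
  (r < 1)%R -> (forall t, (0 <= t <= 1)%R -> (Cmod (x t) <= r)%R) ->
  unif_cv (fun n t => geom (x t) n) (fun t => / (1 - x t)).
Proof.
  intros hr hx eps he.
  assert (hr0 : (0 <= r)%R).
  { eapply Rle_trans; [apply (Cmod_ge_0 (x 0)) | apply hx; lra]. }
  destruct (pow_lt_1_zero r) with (y := (eps * (1 - r))%R) as [N hN].
  { rewrite Rabs_pos_eq; assumption. }
  { apply Rmult_lt_0_compat; lra. }
  exists N. intros n hn t ht. specialize (hx t ht). specialize (hN (S n) ltac:(lia)).
  rewrite Rabs_pos_eq in hN by now apply pow_le.
  assert (hd : (1 - r <= Cmod (1 - x t))%R).
  { pose proof (Cmod_triangle_rev 1 (x t)). rewrite Cmod_1 in H. lra. }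
  assert (hz : 1 - x t <> 0) by (apply Cmod_gt_0; lra).
  assert (e : geom (x t) n * (1 - x t) = 1 - x t ^ S n).
  { clear. induction n as [|n IH]; simpl geom; [simpl; ring |].
    rewrite Cmult_plus_distr_r, IH. rewrite !Cpow_S. ring. }
  replace (geom (x t) n - / (1 - x t)) with (- x t ^ S n / (1 - x t)).
  2: { replace (geom (x t) n) with (geom (x t) n * (1 - x t) / (1 - x t)) by (field; assumption).
       rewrite e. field. assumption. }
  rewrite Cmod_div, Cmod_opp, Cmod_pow by assumption.
  apply Rmult_lt_reg_r with (Cmod (1 - x t)); [lra |].
  unfold Rdiv. rewrite Rmult_assoc, Rinv_l, Rmult_1_r by lra.
  apply Rle_lt_trans with (r ^ S n)%R.
  - apply pow_incr. split; [apply Cmod_ge_0 | assumption].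
  - nra.
Qed.

Lemma mean_geom (x : R -> C) (r : R) :
  (r < 1)%R -> (forall t, (0 <= t <= 1)%R -> (Cmod (x t) <= r)%R) ->
  (forall k, is_RInt_C (fun t => x t ^ S k) 0 1 (RtoC 0)) -> is_RInt_C (fun t => / (1 - x t)) 0 1 (RtoC 1).
Proof.
  intros hr hx hk.
  destruct (is_RInt_unif_cv _ _ (fun _ => RtoC 1) (unif_cv_geom x r hr hx)) as [l [h1 h2]].
  - intros n. induction n as [|n IH].
    + pose proof (is_RInt_C_const 1 0 1) as h.
      replace ((1 - 0)%R * 1) with (RtoC 1) in h by (rewrite RtoC_minus; ring). exact h.
    + replace (RtoC 1) with (RtoC 1 + RtoC 0) by ring. apply is_RInt_C_plus; [exact IH | apply hk].
  - assert (e : l = RtoC 1); [| now rewrite e in h2].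
    apply (filterlim_locally_unique (F := eventually) (V := C_NormedModule) (fun _ => RtoC 1)).
    + exact h1.
    + apply filterlim_const.
Qed.

(** In the geometric series of 1 / (1 - w / z) every power except the zeroth has mean 0. In
    [mean_kernel_outside] the same series is applied to 1 - 1 / (1 - z / w). Together they give the
    winding numbers of all circles. *)
Lemma mean_kernel_inside w : (Cmod w < 1)%R -> is_RInt_C (fun t => cis t / (cis t - w)) 0 1 (RtoC 1).
Proof.
  intros hw.
  assert (hd : forall t, cis t - w <> 0).
  { intros t. apply Cmod_gt_0. pose proof (Cmod_triangle_rev (cis t) w).
    rewrite Cmod_cis in H. lra. }
  apply is_RInt_C_ext with (fun t => / (1 - w * / cis t)); [lra | |].
  { intros t _. pose proof (cis_neq_0 t). field. split; [apply hd | assumption]. }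
  apply (mean_geom (fun t => w * / cis t) (Cmod w)); [assumption | |].
  - intros t _. rewrite Cmod_mult, Cmod_inv, Cmod_cis by apply cis_neq_0. lra.
  - intros k. replace (0 : C) with (w ^ S k * 0) by ring.
    apply is_RInt_C_ext with (3 := is_RInt_C_scal _ _ _ (w ^ S k) _ (mean_cis_inv_pow k)); [lra |].
    intros t _. now rewrite Cpow_mult_l.
Qed.

Lemma mean_kernel_outside w : (1 < Cmod w)%R -> is_RInt_C (fun t => cis t / (cis t - w)) 0 1 (RtoC 0).
Proof.
  intros hw.
  assert (hw0 : w <> 0) by (apply Cmod_gt_0; lra).
  assert (hd : forall t, cis t - w <> 0).
  { intros t. apply Cmod_gt_0. pose proof (Cmod_triangle_rev w (cis t)).
    rewrite Cmod_cis, Cmod_dist_sym in H. lra. }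
  replace (0 : C) with ((1 - 0)%R * 1 - 1) by (rewrite RtoC_minus; ring).
  apply is_RInt_C_ext with (fun t => 1 - / (1 - / w * cis t)); [lra | |].
  { intros t _. pose proof (hd t).
    assert (w - cis t <> 0).
    { intros e. apply H. replace (cis t - w) with (- (w - cis t)) by ring. rewrite e; ring. }
    field. repeat split; assumption. }
  apply is_RInt_C_minus; [apply is_RInt_C_const |].
  assert (hi : (/ Cmod w < 1)%R) by (rewrite <- Rinv_1; apply Rinv_lt_contravar; lra).
  apply (mean_geom (fun t => / w * cis t) (/ Cmod w)); [assumption | |].
  - intros t _. rewrite Cmod_mult, Cmod_inv, Cmod_cis by assumption. lra.
  - intros k. replace (0 : C) with ((/ w) ^ S k * 0) by ring.
    apply is_RInt_C_ext with (3 := is_RInt_C_scal _ _ _ ((/ w) ^ S k) _ (mean_cis_pow k)); [lra |].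
    intros t _. now rewrite Cpow_mult_l.
Qed.

Lemma circle_integral r f v :
  is_RInt_C (fun t => (r * cis t) * f (r * cis t)) 0 1 v ->
  is_contour_integral f (circle r) (2 * PI * Ci * v).
Proof.
  intros h. apply is_RInt_C_ext with (3 := is_RInt_C_scal _ _ _ (2 * PI * Ci) _ h); [lra |].
  intros t _. simpl. ring.
Qed.

Lemma circle_integral_inv r f v :
  is_contour_integral f (circle r) v ->
  is_RInt_C (fun t => (r * cis t) * f (r * cis t)) 0 1 (/ (2 * PI * Ci) * v).
Proof.
  intros h. apply is_RInt_C_ext with (3 := is_RInt_C_scal _ _ _ (/ (2 * PI * Ci)) _ h); [lra |].
  intros t _. simpl. pose proof two_PI_i_neq_0 as h2.
  transitivity (/ (2 * PI * Ci) * (2 * PI * Ci) * (r * cis t * f (r * cis t))); [ring |].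
  rewrite Cinv_l by assumption. ring.
Qed.

Lemma circle_kernel_eq (r w : C) t : r <> 0 -> r * cis t - w = r * (cis t - w / r).
Proof. intros hr. field. assumption. Qed.

Lemma circle_winding (r w v : C) : r <> 0 ->
  is_RInt_C (fun t => cis t / (cis t - w / r)) 0 1 v ->
  is_contour_integral (fun z => / (z - w)) (circle r) (2 * PI * Ci * v).
Proof.
  intros hr h. apply circle_integral. apply is_RInt_C_ext with (3 := h); [lra |].
  intros t _. rewrite circle_kernel_eq, Cinv_mult_total by assumption. unfold Cdiv.
  transitivity (r * / r * (cis t * / (cis t - w * / r))); [| ring].
  rewrite Cinv_r by assumption. ring.
Qed.

Lemma circle_encloses (r w : C) : (Cmod w < Cmod r)%R -> encloses (circle r) w.
Proof.
  intros hw. pose proof (Cmod_ge_0 w).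
  assert (hr : r <> 0) by (apply Cmod_gt_0; lra). split.
  - intros t _ e. simpl in e. rewrite <- e, Cmod_mult, Cmod_cis in hw. lra.
  - apply circle_winding, mean_kernel_inside; [assumption |]. rewrite Cmod_div by assumption.
    apply Rmult_lt_reg_r with (Cmod r); [lra |]. unfold Rdiv. rewrite Rmult_assoc, Rinv_l; lra.
Qed.

Lemma circle_excludes (r w : C) : r <> 0 -> (Cmod r < Cmod w)%R -> excludes (circle r) w.
Proof.
  intros hr hw. pose proof (proj1 (Cmod_gt_0 r) hr). split.
  - intros t _ e. simpl in e. rewrite <- e, Cmod_mult, Cmod_cis in hw. lra.
  - apply circle_winding, mean_kernel_outside; [assumption |]. rewrite Cmod_div by assumption.
    apply Rmult_lt_reg_r with (Cmod r); [lra |]. unfold Rdiv. rewrite Rmult_assoc, Rinv_l; lra.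
Qed.

(** * Infinite q-shifted factorials *)

Lemma filterlim_C_eps (u : nat -> C) (l : C) :
  filterlim u eventually (locally l) <->
  forall eps, (0 < eps)%R -> exists N, forall n, (N <= n)%nat -> (Cmod (u n - l) < eps)%R.
Proof.
  split.
  - intros h eps he. apply (h (fun w => (Cmod (w - l) < eps)%R)).
    apply locally_C_Cmod. exists eps. split; auto.
  - intros h P hP. apply locally_C_Cmod in hP. destruct hP as [d [hd hP]].
    destruct (h d hd) as [N hN]. exists N. intros n hn. apply hP. now apply hN.
Qed.

Lemma filterlim_C_unique (u : nat -> C) (l m : C) :
  filterlim u eventually (locally l) -> filterlim u eventually (locally m) -> l = m.
Proof. apply (filterlim_locally_unique (F := eventually) (V := C_NormedModule)). Qed.

Lemma filterlim_Cmult (u v : nat -> C) (l m : C) :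
  filterlim u eventually (locally l) -> filterlim v eventually (locally m) ->
  filterlim (fun n => u n * v n) eventually (locally (l * m)).
Proof.
  intros h1 h2. apply (filterlim_comp_2 (G := locally l) (H := locally m) u v Cmult); try assumption.
  pose proof (continuous_Cmult (fun z : C * C => fst z) (fun z : C * C => snd z) (l, m)) as h.
  intros P hP. destruct (h (continuous_fst _ _) (continuous_snd _ _) P hP) as [e he].
  exists (ball l e) (ball m e); try (now exists e).
  intros a b ha hb. apply (he (a, b)). split; assumption.
Qed.

Lemma filterlim_shift (u : nat -> C) (l : C) N :
  filterlim u eventually (locally l) -> filterlim (fun n => u (N + n)%nat) eventually (locally l).
Proof.
  intros h P hP. destruct (h P hP) as [M hM]. exists M. intros n hn. apply hM. lia.
Qed.

Lemma qpoch_0_l q n : qpoch 0 q n = 1.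
Proof. induction n as [|n IH]; simpl; [reflexivity |]. rewrite IH. ring. Qed.

Lemma qpoch_add x q n m : qpoch x q (n + m) = qpoch x q n * qpoch (x * q ^ n) q m.
Proof.
  induction m as [|m IH].
  - rewrite Nat.add_0_r. simpl. ring.
  - rewrite Nat.add_succ_r. simpl. rewrite IH, Cpow_add_r. ring.
Qed.

Lemma qpoch_neq_0 x q n : qpoch x q n <> 0 <-> forall k, (k < n)%nat -> 1 - x * q ^ k <> 0.
Proof.
  induction n as [|n IH]; simpl.
  - split; [intros; lia | intros; apply C1_nz].
  - rewrite Cmult_neq_0_iff, IH. split.
    + intros [h1 h2] k hk. destruct (Nat.eq_dec k n) as [-> | hn]; [assumption | apply h1; lia].
    + intros h. split; [intros k hk; apply h; lia | apply h; lia].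
Qed.

Section InfiniteProduct.

Variable q : C.
Hypothesis hq : (Cmod q < 1)%R.

Let hq0 : (0 <= Cmod q)%R := Cmod_ge_0 q.

(** It comes from |1 - x q^k| <= 1 + M |q|^k <= exp (M |q|^k) and the sum of the geometric series,
    and bounds all partial products with |x| <= M at once. *)
Definition qpoch_majorant (M : R) : R := exp (M / (1 - Cmod q)).

Lemma qpoch_bound x M n : (Cmod x <= M)%R -> (Cmod (qpoch x q n) <= qpoch_majorant M)%R.
Proof.
  intros hx.
  assert (hM : (0 <= M)%R) by (eapply Rle_trans; [apply Cmod_ge_0 | exact hx]).
  assert (h : (Cmod (qpoch x q n) <= exp (M * (1 - Cmod q ^ n) / (1 - Cmod q)))%R).
  { induction n as [|n IH].
    - simpl. rewrite Cmod_1. replace (M * (1 - 1) / (1 - Cmod q))%R with 0%R by (field; lra).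
      rewrite exp_0; lra.
    - replace (M * (1 - Cmod q ^ S n) / (1 - Cmod q))%R
        with (M * (1 - Cmod q ^ n) / (1 - Cmod q) + M * Cmod q ^ n)%R by (simpl; field; lra).
      simpl qpoch. rewrite Cmod_mult, exp_plus. pose proof (pow_le _ n hq0).
      apply Rmult_le_compat; try apply Cmod_ge_0; [assumption |].
      apply Rle_trans with (1 + M * Cmod q ^ n)%R; [| apply exp_ineq1_le].
      eapply Rle_trans; [apply Cmod_triangle |].
      rewrite Cmod_1, Cmod_opp, Cmod_mult, Cmod_pow. nra. }
  eapply Rle_trans; [exact h |]. unfold qpoch_majorant.
  assert (0 <= M * Cmod q ^ n)%R by (apply Rmult_le_pos; [| apply pow_le]; assumption).
  assert (M * (1 - Cmod q ^ n) / (1 - Cmod q) <= M / (1 - Cmod q))%R as [hl | ->].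
  { apply Rmult_le_compat_r; [left; apply Rinv_0_lt_compat |]; lra. }
  - left. now apply exp_increasing.
  - lra.
Qed.

(** Consecutive partial products differ by at most B M |q|^k with B = [qpoch_majorant M]; summed
    from k = n on, this is the constant times |q|^n. Only M enters, so the convergence is uniform on
    discs. *)
Definition qpoch_rate (M : R) : R := (qpoch_majorant M * M / (1 - Cmod q))%R.

Lemma qpoch_cauchy x M n m : (Cmod x <= M)%R ->
  (Cmod (qpoch x q (n + m) - qpoch x q n) <= qpoch_rate M * Cmod q ^ n)%R.
Proof.
  intros hx.
  assert (hM : (0 <= M)%R) by (eapply Rle_trans; [apply Cmod_ge_0 | exact hx]).
  pose proof (exp_pos (M / (1 - Cmod q))) as hB. fold (qpoch_majorant M) in hB.
  assert (h : (Cmod (qpoch x q (n + m) - qpoch x q n)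
    <= qpoch_majorant M * M * Cmod q ^ n * (1 - Cmod q ^ m) / (1 - Cmod q))%R).
  { induction m as [|m IH].
    - rewrite Nat.add_0_r. replace (qpoch x q n - qpoch x q n) with (RtoC 0) by ring.
      rewrite Cmod_0. simpl. right; field; lra.
    - rewrite Nat.add_succ_r. simpl qpoch.
      replace (qpoch x q (n + m) * (1 - x * q ^ (n + m)) - qpoch x q n)
        with ((qpoch x q (n + m) - qpoch x q n) + - (qpoch x q (n + m) * (x * q ^ (n + m)))) by ring.
      eapply Rle_trans; [apply Cmod_triangle |]. rewrite Cmod_opp, !Cmod_mult, Cmod_pow.
      replace (qpoch_majorant M * M * Cmod q ^ n * (1 - Cmod q ^ S m) / (1 - Cmod q))%R
        with (qpoch_majorant M * M * Cmod q ^ n * (1 - Cmod q ^ m) / (1 - Cmod q)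
          + qpoch_majorant M * (M * Cmod q ^ (n + m)))%R.
      2: { rewrite pow_add. simpl. field. lra. }
      apply Rplus_le_compat; [exact IH |].
      pose proof (pow_le _ (n + m) hq0).
      apply Rmult_le_compat; [apply Cmod_ge_0 | | now apply qpoch_bound |].
      + apply Rmult_le_pos; [apply Cmod_ge_0 | assumption].
      + now apply Rmult_le_compat_r. }
  eapply Rle_trans; [exact h |]. unfold qpoch_rate, Rdiv.
  replace (qpoch_majorant M * M * / (1 - Cmod q) * Cmod q ^ n)%R
    with (qpoch_majorant M * M * Cmod q ^ n * 1 * / (1 - Cmod q))%R by ring.
  pose proof (pow_le _ n hq0). pose proof (pow_le _ m hq0).
  apply Rmult_le_compat_r; [left; apply Rinv_0_lt_compat; lra |].
  apply Rmult_le_compat_l; [| lra].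
  repeat apply Rmult_le_pos; lra.
Qed.

Lemma qpoch_rate_pos M : (0 <= M)%R -> (0 <= qpoch_rate M)%R.
Proof.
  intros h. unfold qpoch_rate, Rdiv. pose proof (exp_pos (M / (1 - Cmod q))).
  repeat apply Rmult_le_pos; try assumption.
  - unfold qpoch_majorant; lra.
  - left; apply Rinv_0_lt_compat; lra.
Qed.

Lemma geometric_small K eps : (0 <= K)%R -> (0 < eps)%R ->
  exists N, forall n, (N <= n)%nat -> (K * Cmod q ^ n < eps)%R.
Proof.
  intros hK he.
  destruct (pow_lt_1_zero (Cmod q)) with (y := (eps / (K + 1))%R) as [N hN].
  { rewrite Rabs_pos_eq; assumption. }
  { apply Rdiv_lt_0_compat; lra. }
  exists N. intros n hn. specialize (hN n hn). rewrite Rabs_pos_eq in hN by now apply pow_le.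
  pose proof (pow_le _ n hq0).
  apply Rle_lt_trans with ((K + 1) * Cmod q ^ n)%R; [nra |].
  apply Rlt_le_trans with ((K + 1) * (eps / (K + 1)))%R.
  - apply Rmult_lt_compat_l; lra.
  - right; field; lra.
Qed.

(** [iota] is determined only by existence and uniqueness together; existence is the Cauchy property
    contained in [qpoch_cauchy]. *)
Lemma qpoch_inf_lim x : filterlim (qpoch x q) eventually (locally (qpoch_inf x q)).
Proof.
  unfold qpoch_inf.
  apply (iota_correct (V := C_CompleteNormedModule)
    (fun l : C => filterlim (qpoch x q) eventually (locally l))).
  assert (hex : exists l : C, filterlim (qpoch x q) eventually (locally l)).
  { apply (filterlim_locally_cauchy (U := C_R_CompleteNormedModule) (F := eventually)).
    intros eps.
    destruct (geometric_small (qpoch_rate (Cmod x)) (eps / 2)) as [N hN].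
    { apply qpoch_rate_pos, Cmod_ge_0. }
    { pose proof (cond_pos eps); lra. }
    exists (fun n => (N <= n)%nat). split; [now exists N |].
    intros u v hu hv.
    assert (hd : (Cmod (qpoch x q v - qpoch x q u) < eps)%R).
    { replace u with (N + (u - N))%nat by lia. replace v with (N + (v - N))%nat by lia.
      pose proof (qpoch_cauchy x _ N (u - N) (Rle_refl _)).
      pose proof (qpoch_cauchy x _ N (v - N) (Rle_refl _)).
      specialize (hN N (Nat.le_refl _)).
      eapply Rle_lt_trans; [apply (Cmod_triangle_sub _ (qpoch x q N)) |].
      rewrite (Cmod_dist_sym (qpoch x q N)). lra. }
    exact (ball_of_Cmod _ _ _ hd). }
  destruct hex as [l hl]. exists l. split; [exact hl |].
  intros l' hl'. apply (filterlim_C_unique (qpoch x q)); assumption.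
Qed.

Lemma qpoch_inf_rate x M n : (Cmod x <= M)%R ->
  (Cmod (qpoch x q n - qpoch_inf x q) <= qpoch_rate M * Cmod q ^ n)%R.
Proof.
  intros hx. apply le_epsilon. intros eps he.
  pose proof (qpoch_inf_lim x) as hl. rewrite filterlim_C_eps in hl.
  destruct (hl eps he) as [N hN]. specialize (hN (n + N)%nat ltac:(lia)).
  pose proof (qpoch_cauchy x M n N hx) as hc. rewrite Cmod_dist_sym in hc.
  eapply Rle_trans; [apply (Cmod_triangle_sub _ (qpoch x q (n + N))) |]. lra.
Qed.

Lemma qpoch_inf_shift x n : qpoch_inf x q = qpoch x q n * qpoch_inf (x * q ^ n) q.
Proof.
  apply (filterlim_C_unique (fun m => qpoch x q (n + m))).
  - apply filterlim_shift, qpoch_inf_lim.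
  - apply filterlim_ext with (fun m => qpoch x q n * qpoch (x * q ^ n) q m).
    { intros m. now rewrite qpoch_add. }
    apply filterlim_Cmult; [apply filterlim_const | apply qpoch_inf_lim].
Qed.

Lemma qpoch_inf_step x : qpoch_inf x q = (1 - x) * qpoch_inf (x * q) q.
Proof. rewrite (qpoch_inf_shift x 1). simpl. rewrite !Cmult_1_r, Cmult_1_l. reflexivity. Qed.

Lemma qpoch_inf_0 : qpoch_inf 0 q = 1.
Proof.
  apply (filterlim_C_unique (qpoch 0 q)); [apply qpoch_inf_lim |].
  apply filterlim_ext with (fun _ : nat => RtoC 1); [| apply filterlim_const].
  intros n. now rewrite qpoch_0_l.
Qed.

Lemma continuous_qpoch n (x : C) : continuous (fun y : C => qpoch y q n) x.
Proof.
  induction n as [|n IH]; simpl.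
  - ccont.
  - apply (continuous_Cmult (fun y => qpoch y q n)); [exact IH | ccont].
Qed.

Lemma continuous_qpoch_inf (x : C) : continuous (fun y : C => qpoch_inf y q) x.
Proof.
  apply continuous_C_eps. intros eps he.
  set (M := (Cmod x + 1)%R).
  destruct (geometric_small (qpoch_rate M) (eps / 3)) as [N hN].
  { apply qpoch_rate_pos. unfold M. pose proof (Cmod_ge_0 x); lra. }
  { lra. }
  specialize (hN N (Nat.le_refl _)).
  pose proof (continuous_qpoch N x) as hc. rewrite continuous_C_eps in hc.
  specialize (hc (eps / 3)%R ltac:(lra)).
  assert (hM : locally x (fun y : C => (Cmod y <= M)%R)).
  { apply locally_C_Cmod. exists 1%R. split; [lra |]. intros w hw.
    pose proof (Cmod_triangle_rev w x). unfold M. lra. }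
  generalize (filter_and _ _ hc hM). apply filter_imp. intros y [h1 h2].
  pose proof (qpoch_inf_rate y M N h2) as r1. rewrite Cmod_dist_sym in r1.
  pose proof (qpoch_inf_rate x M N ltac:(unfold M; lra)) as r2.
  eapply Rle_lt_trans; [apply (Cmod_triangle_sub _ (qpoch y q N)) |].
  eapply Rle_lt_trans; [apply Rplus_le_compat_l, (Cmod_triangle_sub _ (qpoch x q N)) |]. lra.
Qed.

Lemma filterlim_Cmult_pow (x : C) : filterlim (fun n => x * q ^ n) eventually (locally (0 : C)).
Proof.
  apply filterlim_C_eps. intros eps he.
  destruct (geometric_small (Cmod x) eps) as [N hN]; [apply Cmod_ge_0 | assumption |].
  exists N. intros n hn. replace (x * q ^ n - 0) with (x * q ^ n) by ring.
  rewrite Cmod_mult, Cmod_pow. now apply hN.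
Qed.

(** As a function of x the infinite product is continuous with value 1 at 0, hence nonzero at x q^N
    for large N; the N factors split off are nonzero by hypothesis. No logarithm is involved. *)
Lemma qpoch_inf_neq_0 x : (forall k, 1 - x * q ^ k <> 0) -> qpoch_inf x q <> 0.
Proof.
  intros h.
  assert (h0 : locally (0 : C) (fun y : C => qpoch_inf y q <> 0)).
  { apply (continuous_C_neq_0 (fun y : C => qpoch_inf y q)); [apply continuous_qpoch_inf |].
    rewrite qpoch_inf_0. apply C1_nz. }
  destruct (filterlim_Cmult_pow x _ h0) as [N hN].
  rewrite (qpoch_inf_shift x N). apply Cmult_neq_0.
  - apply qpoch_neq_0. intros; apply h.
  - apply (hN N (Nat.le_refl _)).
Qed.

Lemma qpoch_of_qpoch_inf_neq_0 x n : qpoch_inf x q <> 0 -> qpoch x q n <> 0.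
Proof. rewrite (qpoch_inf_shift x n), Cmult_neq_0_iff. tauto. Qed.

Lemma one_sub_pow_neq_0 x k : (Cmod x < 1)%R -> 1 - x * q ^ k <> 0.
Proof.
  intros hx. apply Cmod_gt_0.
  pose proof (Cmod_triangle_rev 1 (x * q ^ k)) as h. rewrite Cmod_1, Cmod_mult, Cmod_pow in h.
  assert (Cmod q ^ k <= 1)%R.
  { rewrite <- (pow1 k). apply pow_incr. lra. }
 pose proof (Cmod_ge_0 x). nra.
Qed.

Lemma qpoch_inf_neq_0_lt_1 x : (Cmod x < 1)%R -> qpoch_inf x q <> 0.
Proof. intros hx. apply qpoch_inf_neq_0. intros k. now apply one_sub_pow_neq_0. Qed.

Lemma unif_cv_qpoch (u : R -> C) : cont01 u ->
  unif_cv (fun n t => qpoch (u t) q n) (fun t => qpoch_inf (u t) q).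
Proof.
  intros hu eps he. destruct (cont01_bounded u hu) as [M [hM hb]].
  destruct (geometric_small (qpoch_rate M) eps) as [N hN].
  { apply qpoch_rate_pos; lra. }
  { assumption. }
  exists N. intros n hn t ht. eapply Rle_lt_trans; [apply qpoch_inf_rate, hb, ht | now apply hN].
Qed.

Lemma cont01_qpoch_inf (u : R -> C) : cont01 u -> cont01 (fun t => qpoch_inf (u t) q).
Proof.
  intros hu t ht. apply (continuous_comp u (fun y : C => qpoch_inf y q)).
  - now apply hu.
  - apply continuous_qpoch_inf.
Qed.

End InfiniteProduct.

Lemma cont01_mult u v : cont01 u -> cont01 v -> cont01 (fun t => u t * v t).
Proof. intros h1 h2 t ht. apply continuous_Cmult; auto. Qed.

Lemma cont01_inv u : cont01 u -> (forall t, (0 <= t <= 1)%R -> u t <> 0) -> cont01 (fun t => / u t).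
Proof. intros h1 h2 t ht. apply continuous_Cinv; auto. Qed.

Lemma cont01_const c : cont01 (fun _ => c).
Proof. intros t ht. apply continuous_const. Qed.

(** * Uniform convergence of truncated weights *)

Section Kernel.

Variable q : C.
Hypothesis hq : (Cmod q < 1)%R.

Notation qi x := (qpoch_inf x q).

Lemma qpochs_uniform (u : C -> R -> C) es : (forall e, In e es -> cont01 (u e)) ->
  cont01 (fun t => qpochs_inf (map (fun e => u e t) es) q) /\
  unif_cv (fun n t => qpochs (map (fun e => u e t) es) q n)
    (fun t => qpochs_inf (map (fun e => u e t) es) q).
Proof.
  induction es as [|e es IH]; intros h; simpl.
  - split; [apply cont01_const | apply unif_cv_const].
  - destruct IH as [IH1 IH2]; [intros e' he'; apply h; now right |].
    pose proof (h e (or_introl eq_refl)) as ce.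
    split.
    + apply cont01_mult; [now apply cont01_qpoch_inf | exact IH1].
    + apply (unif_cv_mult (fun n t => qpoch (u e t) q n)
        (fun n t => qpochs (map (fun e0 => u e0 t) es) q n)).
      * now apply cont01_qpoch_inf.
      * exact IH1.
      * now apply unif_cv_qpoch.
      * exact IH2.
Qed.

Lemma qpochs_inf_neq_0 xs : (forall x, In x xs -> qi x <> 0) -> qpochs_inf xs q <> 0.
Proof.
  induction xs as [|x xs IH]; intros h; simpl.
  - apply C1_nz.
  - apply Cmult_neq_0; [apply h; now left | apply IH; intros; apply h; now right].
Qed.

(** General enough for two uses: c = 1 with equal lists gives the weight, c = q with the second list
    multiplied by q gives the function whose contour is shifted. *)
Definition kernel (c : C) (es es' : list C) (z : C) : C :=
  qi (z ^ 2) * qi (c / z ^ 2)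
    / qpochs_inf (map (fun e => e * z) es) q / qpochs_inf (map (fun e => e / z) es') q.

Lemma kernel_uniform (g : contour) c es es' f :
  (forall t, (0 <= t <= 1)%R -> path g t <> 0) ->
  (forall e k t, In e es -> (0 <= t <= 1)%R -> e * q ^ k * path g t <> 1) ->
  (forall e k t, In e es' -> (0 <= t <= 1)%R -> path g t <> e * q ^ k) ->
  cont01 (fun t => f (path g t)) ->
  cont01 (fun t => f (path g t) * kernel c es es' (path g t)) /\
  unif_cv (fun n t => f (path g t) * (qpoch (path g t ^ 2) q n * qpoch (c / path g t ^ 2) q n)
      / qpochs (map (fun e => e * path g t) es) q n / qpochs (map (fun e => e / path g t) es') q n)
    (fun t => f (path g t) * kernel c es es' (path g t)).
Proof.
  intros h0 h1 h2 hf.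
  assert (cp : cont01 (path g)) by (intros t ht; now apply path_continuous).
  assert (cp2 : cont01 (fun t => path g t ^ 2)).
  { intros t ht. apply (continuous_Cpow (path g)). now apply cp. }
  assert (cpi : cont01 (fun t => c / path g t ^ 2)).
  { intros t ht. apply continuous_Cdiv; [apply continuous_const | now apply cp2 |].
    apply Cpow_nz. now apply h0. }
  destruct (qpochs_uniform (fun e t => e * path g t) es) as [c1 u1].
  { intros e _. apply cont01_mult; [apply cont01_const | assumption]. }
  destruct (qpochs_uniform (fun e t => e / path g t) es') as [c2 u2].
  { intros e _. apply cont01_mult; [apply cont01_const | apply cont01_inv; assumption]. }
  assert (n1 : forall t, (0 <= t <= 1)%R -> qpochs_inf (map (fun e => e * path g t) es) q <> 0).
  { intros t ht. apply qpochs_inf_neq_0. intros x hx. apply in_map_iff in hx.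
    destruct hx as [e [<- he]]. apply qpoch_inf_neq_0; [exact hq |]. intros k hk.
    apply (h1 e k t he ht).
    replace (e * q ^ k * path g t) with (1 - (1 - e * path g t * q ^ k)) by ring. rewrite hk. ring. }
  assert (n2 : forall t, (0 <= t <= 1)%R -> qpochs_inf (map (fun e => e / path g t) es') q <> 0).
  { intros t ht. apply qpochs_inf_neq_0. intros x hx. apply in_map_iff in hx.
    destruct hx as [e [<- he]]. apply qpoch_inf_neq_0; [exact hq |]. intros k hk.
    apply (h2 e k t he ht). pose proof (h0 t ht).
    replace (e * q ^ k) with (path g t * (1 - (1 - e / path g t * q ^ k))) by (field; assumption).
    rewrite hk. ring. }
  pose proof (cont01_mult _ _ (cont01_qpoch_inf q hq _ cp2) (cont01_qpoch_inf q hq _ cpi)) as c3.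
  pose proof (unif_cv_mult _ _ _ _ (cont01_qpoch_inf q hq _ cp2) (cont01_qpoch_inf q hq _ cpi)
    (unif_cv_qpoch q hq _ cp2) (unif_cv_qpoch q hq _ cpi)) as u3.
  pose proof (cont01_mult _ _ c3 (cont01_inv _ c1 n1)) as c4.
  pose proof (unif_cv_mult _ _ _ _ c3 (cont01_inv _ c1 n1) u3 (unif_cv_inv _ _ c1 n1 u1)) as u4.
  pose proof (cont01_mult _ _ c4 (cont01_inv _ c2 n2)) as c5.
  pose proof (unif_cv_mult _ _ _ _ c4 (cont01_inv _ c2 n2) u4 (unif_cv_inv _ _ c2 n2 u2)) as u5.
  split.
  - apply (cont01_mult _ _ hf c5).
  - pose proof (unif_cv_mult _ _ _ _ hf c5 (unif_cv_const _) u5) as u6.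
    intros eps he. destruct (u6 eps he) as [N hN]. exists N. intros n hn t ht.
    specialize (hN n hn t ht). unfold kernel, Cdiv in *.
    replace (f (path g t) * (qpoch (path g t ^ 2) q n * qpoch (c * / path g t ^ 2) q n)
      * / qpochs (map (fun e => e * path g t) es) q n
      * / qpochs (map (fun e => e * / path g t) es') q n)
     with (f (path g t) * (qpoch (path g t ^ 2) q n * qpoch (c * / path g t ^ 2) q n
      * / qpochs (map (fun e => e * path g t) es) q n
      * / qpochs (map (fun e => e * / path g t) es') q n)) by ring.
    exact hN.
Qed.

(** The factor [f] makes room for the elementary part of the moment integrand, 1 / z and the power
    of z + 1 / z. *)
Lemma same_int_kernel (g1 g2 : contour) (Pole : C -> Prop) c es es' f :
  (forall p, Pole p -> forall t, (0 <= t <= 1)%R -> path g1 t <> p) ->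
  (forall p, Pole p -> forall t, (0 <= t <= 1)%R -> path g2 t <> p) ->
  (forall p, Pole p -> same_int g1 g2 (fun z => / (z - p))) ->
  Pole 0 ->
  (forall e, In e es -> forall k z, e * q ^ k * z = 1 -> Pole z) ->
  (forall e, In e es' -> forall k, Pole (e * q ^ k)) ->
  ratl g1 g2 Pole f ->
  cont01 (fun t => f (path g1 t)) -> cont01 (fun t => f (path g2 t)) ->
  same_int g1 g2 (fun z => f z * kernel c es es' z).
Proof.
  intros a1 a2 hw h0 h1 h2 hf cf1 cf2.
  assert (H : forall g, (forall p, Pole p -> forall t, (0 <= t <= 1)%R -> path g t <> p) ->
    (forall t, (0 <= t <= 1)%R -> path g t <> 0) /\
    (forall e k t, In e es -> (0 <= t <= 1)%R -> e * q ^ k * path g t <> 1) /\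
    (forall e k t, In e es' -> (0 <= t <= 1)%R -> path g t <> e * q ^ k)).
  { intros g ag. refine (conj _ (conj _ _)).
    - intros t ht. now apply ag.
    - intros e k t he ht hk. exact (ag _ (h1 e he k _ hk) t ht eq_refl).
    - intros e k t he ht. apply ag; [now apply h2 | assumption]. }
  destruct (H g1 a1) as [x1 [x2 x3]], (H g2 a2) as [y1 [y2 y3]].
  destruct (kernel_uniform g1 c es es' f x1 x2 x3 cf1) as [c1 u1].
  destruct (kernel_uniform g2 c es es' f y1 y2 y3 cf2) as [c2 u2].
  apply (same_int_lim g1 g2 (fun n z => f z * (qpoch (z ^ 2) q n * qpoch (c / z ^ 2) q n)
      / qpochs (map (fun e => e * z) es) q n / qpochs (map (fun e => e / z) es') q n));
    try assumption.
  intros n. apply (ratl_same_int _ _ Pole a1 a2).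
  apply (ratl_div_qpochs_inv _ _ _ a1 a2); [assumption | assumption |].
  apply (ratl_div_qpochs _ _ _ a1 a2); [assumption |].
  now apply (ratl_sq _ _ _ a1 a2).
Qed.

End Kernel.

(** * The Askey-Wilson integral *)

Definition is_mean (f : C -> C) (v : C) : Prop := is_RInt_C (fun t => f (cis t)) 0 1 v.

Lemma is_mean_ext f h v : (forall z, Cmod z = 1%R -> f z = h z) -> is_mean f v -> is_mean h v.
Proof.
  intros e. apply is_RInt_C_ext; [lra |]. intros t _. apply e, Cmod_cis.
Qed.

Lemma is_mean_unique f v w : is_mean f v -> is_mean f w -> v = w.
Proof. apply is_RInt_C_unique. Qed.

Lemma is_mean_plus f h v w : is_mean f v -> is_mean h w -> is_mean (fun z => f z + h z) (v + w).
Proof. apply is_RInt_C_plus. Qed.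

Lemma is_mean_scal c f v : is_mean f v -> is_mean (fun z => c * f z) (c * v).
Proof. apply is_RInt_C_scal. Qed.

Lemma is_mean_const c : is_mean (fun _ => c) c.
Proof.
  pose proof (is_RInt_C_const c 0 1) as h.
  replace ((1 - 0)%R * c) with c in h by (rewrite RtoC_minus; ring). exact h.
Qed.

Lemma Cmod_1_neq_0 z : Cmod z = 1%R -> z <> 0.
Proof. intros h. apply Cmod_gt_0. lra. Qed.

(** Together with [qpoch_interlace] this is the passage between the bases q and q^2: pairing x with
    -x leads to q^2, interleaving x and x q leads back. The special parameters q, -q, s, -s are
    treated by these two rules. *)
Lemma qpoch_mult_opp x q n : qpoch x q n * qpoch (- x) q n = qpoch (x * x) (q * q) n.
Proof.
  induction n as [|n IH]; simpl; [ring |].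
  rewrite <- IH, Cpow_mult_l. ring.
Qed.

Lemma qpoch_interlace x q n :
  qpoch x (q * q) n * qpoch (x * q) (q * q) n = qpoch x q (n + n).
Proof.
  induction n as [|n IH]; [simpl; ring |].
  replace (S n + S n)%nat with (S (S (n + n))) by lia. simpl. rewrite <- IH.
  rewrite Cpow_mult_l, Cpow_add_r. ring.
Qed.

Section AskeyWilsonIntegral.

Variable q : C.
Hypothesis hq : (Cmod q < 1)%R.
Hypothesis hq0 : q <> 0.

Notation qi x := (qpoch_inf x q).

Lemma Cmod_sq_lt_1 : (Cmod (q * q) < 1)%R.
Proof. rewrite Cmod_mult. pose proof (Cmod_ge_0 q). nra. Qed.

Lemma qpoch_inf_mult_opp x : qi x * qi (- x) = qpoch_inf (x * x) (q * q).
Proof.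
  apply (filterlim_C_unique (fun n => qpoch x q n * qpoch (- x) q n)).
  - apply filterlim_Cmult; now apply qpoch_inf_lim.
  - apply filterlim_ext with (fun n => qpoch (x * x) (q * q) n).
    { intros n. now rewrite qpoch_mult_opp. }
    apply qpoch_inf_lim, Cmod_sq_lt_1.
Qed.

Lemma qpoch_inf_interlace x : qpoch_inf x (q * q) * qpoch_inf (x * q) (q * q) = qi x.
Proof.
  apply (filterlim_C_unique (fun n => qpoch x q (n + n))).
  - apply filterlim_ext with (fun n => qpoch x (q * q) n * qpoch (x * q) (q * q) n).
    { intros n. now rewrite qpoch_interlace. }
    apply filterlim_Cmult; apply qpoch_inf_lim, Cmod_sq_lt_1.
  - intros P hP. destruct (qpoch_inf_lim q hq x P hP) as [N hN].
    exists N. intros n hn. apply hN. lia.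
Qed.

(** The contribution of one parameter to the weight. It is symmetric in z and 1 / z, unlike a Jacobi
    theta function, which has q / (e z) in the second factor. *)
Definition theta (e z : C) : C := qi (e * z) * qi (e / z).

Definition W (a b c d z : C) : C :=
  qi (z ^ 2) * qi (/ z ^ 2) / (theta a z * theta b z * theta c z * theta d z).

Lemma theta_neq_0 e z : (Cmod e < 1)%R -> Cmod z = 1%R -> theta e z <> 0.
Proof.
  intros he hz. apply Cmult_neq_0; apply qpoch_inf_neq_0_lt_1; try assumption.
  - rewrite Cmod_mult, hz. lra.
  - rewrite Cmod_div, hz by now apply Cmod_1_neq_0. lra.
Qed.

Definition unit_cont (f : C -> C) : Prop := cont01 (fun t => f (cis t)).

Lemma unit_cont_mult f h : unit_cont f -> unit_cont h -> unit_cont (fun z => f z * h z).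
Proof. apply cont01_mult. Qed.

Lemma unit_cont_id : unit_cont (fun z => z).
Proof. intros t _. apply continuous_cis. Qed.

Lemma unit_cont_scal_inv e : unit_cont (fun z => e / z).
Proof.
  apply cont01_mult; [apply cont01_const |]. apply cont01_inv; [apply unit_cont_id |].
  intros t _. apply cis_neq_0.
Qed.

Lemma unit_cont_scal_id e : unit_cont (fun z => e * z).
Proof. apply cont01_mult; [apply cont01_const | apply unit_cont_id]. Qed.

Lemma unit_cont_theta e : unit_cont (theta e).
Proof.
  apply cont01_mult; apply cont01_qpoch_inf; try assumption;
    [apply unit_cont_scal_id | apply unit_cont_scal_inv].
Qed.

Lemma unit_cont_W a b c d :
  (Cmod a < 1)%R -> (Cmod b < 1)%R -> (Cmod c < 1)%R -> (Cmod d < 1)%R -> unit_cont (W a b c d).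
Proof.
  intros ha hb hc hd.
  assert (h2 : unit_cont (fun z => z ^ 2)).
  { intros t _. apply (continuous_Cpow cis), continuous_cis. }
  apply cont01_mult; [apply cont01_mult; apply cont01_qpoch_inf; try assumption |].
  - apply cont01_inv; [exact h2 |]. intros t _. apply Cpow_nz, cis_neq_0.
  - apply cont01_inv.
    + apply (unit_cont_mult (fun z => theta a z * theta b z * theta c z) (theta d));
        [apply (unit_cont_mult (fun z => theta a z * theta b z) (theta c));
          [apply (unit_cont_mult (theta a) (theta b)) |] |]; apply unit_cont_theta.
    + intros t _. pose proof (Cmod_cis t).
      rewrite !Cmult_neq_0_iff. repeat split; now apply theta_neq_0.
Qed.

Lemma ex_mean f : unit_cont f -> exists v, is_mean f v.
Proof. intros h. apply ex_RInt_C; [lra | exact h]. Qed.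

(** The two halves of [theta e z] are shifted separately: e / z by q as in [shiftable] at z, and e z
    by q as in [shiftable] at q z. Either way [theta e z] loses one linear factor. *)
Lemma mul_inv_shift e z : (Cmod e < 1)%R -> Cmod z = 1%R ->
  / (qi (e * z) * qi (e * q / z)) = (1 - e / z) / theta e z /\
  / (qi (e * (q * z)) * qi (e / z)) = (1 - e * z) / theta e z.
Proof.
  intros he hz. pose proof (theta_neq_0 e z he hz) as hn. unfold theta in *.
  replace (e * (q * z)) with (e * z * q) by ring.
  replace (e * q / z) with (e / z * q) by (unfold Cdiv; ring).
  rewrite (qpoch_inf_step q hq (e * z)), (qpoch_inf_step q hq (e / z)) in *.
  rewrite !Cmult_neq_0_iff in hn. destruct hn as [[h1 h2] [h3 h4]].
  generalize dependent (qpoch_inf (e * z * q) q). generalize dependent (qpoch_inf (e / z * q) q).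
  unfold Cdiv in *. set (u := 1 - e * / z) in *. set (v := 1 - e * z) in *. clearbody u v.
  intros A hA B hB. split; field; repeat split; assumption.
Qed.

(** Its denominator vanishes only at e q^(k+1), where |z| < |q|, and at 1 / (e q^k), where |z| > 1.
    The numerator with q / z^2 is tuned so that the combination in [shiftable_difference] is W times
    a polynomial of degree one in z + 1 / z. *)
Definition shiftable (a b c d z : C) : C :=
  kernel q q [a; b; c; d] [a * q; b * q; c * q; d * q] z.

Definition poles (a b c d p : C) : Prop :=
  p = 0 \/ (exists e k, In e [a; b; c; d] /\ p = e * q * q ^ k) \/
  (exists e k, In e [a; b; c; d] /\ e * q ^ k * p = 1).

Lemma encloses_same_int g1 g2 p :
  encloses g1 p -> encloses g2 p -> same_int g1 g2 (fun z => / (z - p)).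
Proof. intros [_ h1] [_ h2]. now exists (2 * PI * Ci * 1). Qed.

Lemma excludes_same_int g1 g2 p :
  excludes g1 p -> excludes g2 p -> same_int g1 g2 (fun z => / (z - p)).
Proof. intros [_ h1] [_ h2]. now exists (2 * PI * Ci * 0). Qed.

Lemma Cmod_pow_le_1 k : (Cmod q ^ k <= 1)%R.
Proof. rewrite <- (pow1 k). apply pow_incr. pose proof (Cmod_ge_0 q). lra. Qed.

Lemma Cmod_mult_pow_lt_1 e k : (Cmod e < 1)%R -> (Cmod (e * q ^ k) < 1)%R.
Proof.
  intros he. rewrite Cmod_mult, Cmod_pow.
  pose proof (Cmod_pow_le_1 k). pose proof (Cmod_ge_0 e). nra.
Qed.

Lemma pole_outside e k p : (Cmod e < 1)%R -> e * q ^ k * p = 1 -> (1 < Cmod p)%R.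
Proof.
  intros he hp. pose proof (Cmod_mult_pow_lt_1 e k he) as h.
  apply (f_equal Cmod) in hp. rewrite Cmod_mult, Cmod_1 in hp.
 pose proof (Cmod_ge_0 (e * q ^ k)). nra.
Qed.

Section UnitDisc.

Variables a b c d : C.
Hypothesis ha : (Cmod a < 1)%R.
Hypothesis hb : (Cmod b < 1)%R.
Hypothesis hc : (Cmod c < 1)%R.
Hypothesis hd : (Cmod d < 1)%R.

Lemma in_params e : In e [a; b; c; d] -> (Cmod e < 1)%R.
Proof. simpl. intros [<- | [<- | [<- | [<- | []]]]]; assumption. Qed.

Lemma poles_separated p : poles a b c d p ->
  (encloses (circle 1) p /\ encloses (circle q) p) \/ (excludes (circle 1) p /\ excludes (circle q) p).
Proof.
  pose proof (proj1 (Cmod_gt_0 q) hq0) as hqp.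
  intros [-> | [[e [k [he ->]]] | [e [k [he hp]]]]].
  - left. split; apply circle_encloses; rewrite ?Cmod_1, Cmod_0; lra.
  - left. pose proof (Cmod_mult_pow_lt_1 e k (in_params e he)).
    assert (Cmod (e * q * q ^ k) < Cmod q)%R.
    { replace (e * q * q ^ k) with (q * (e * q ^ k)) by ring. rewrite Cmod_mult. nra. }
    split; apply circle_encloses; rewrite ?Cmod_1; lra.
  - right. pose proof (pole_outside e k p (in_params e he) hp).
    split; apply circle_excludes; try assumption; try apply C1_nz; rewrite ?Cmod_1; lra.
Qed.

Lemma shiftable_same_int : same_int (circle 1) (circle q) (shiftable a b c d).
Proof.
  assert (av1 : forall p, poles a b c d p -> forall t, (0 <= t <= 1)%R -> path (circle 1) t <> p).
  { intros p hp. now destruct (poles_separated p hp) as [[[h1 _] _] | [[h1 _] _]]. }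
  assert (av2 : forall p, poles a b c d p -> forall t, (0 <= t <= 1)%R -> path (circle q) t <> p).
  { intros p hp. now destruct (poles_separated p hp) as [[_ [h1 _]] | [_ [h1 _]]]. }
  assert (hw : forall p, poles a b c d p -> same_int (circle 1) (circle q) (fun z => / (z - p))).
  { intros p hp. destruct (poles_separated p hp) as [[h1 h2] | [h1 h2]].
    - now apply encloses_same_int.
    - now apply excludes_same_int. }
  apply (same_int_ext _ _ _ av1 av2) with (fun z => 1 * shiftable a b c d z).
  { intros; ring. }
  apply (same_int_kernel q hq (circle 1) (circle q) (poles a b c d) q _ _ (fun _ => 1)); try assumption.
  - now left.
  - intros e he k z hz. right; right. exists e, k. now split.
  - intros e' he' k. right; left. apply (in_map_iff (fun e => e * q) [a; b; c; d]) in he'.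
    destruct he' as [e [<- he]]. exists e, k. now split.
  - now apply ratl_1.
  - apply cont01_const.
  - apply cont01_const.
Qed.

(* The contour shift from |z| = 1 to |z| = |q| annihilates the mean of the left-hand side, so the
   right-hand side determines the first moment. *)
Lemma shiftable_difference z : Cmod z = 1%R ->
  z * shiftable a b c d z - q * z * shiftable a b c d (q * z) =
  W a b c d z * ((1 - a * b * c * d) * (z + / z)
    - (a + b + c + d - (a * b * c + a * b * d + a * c * d + b * c * d))).
Proof.
  intros hz. pose proof (Cmod_1_neq_0 z hz) as hz0.
  destruct (mul_inv_shift a z ha hz) as [a1 a2], (mul_inv_shift b z hb hz) as [b1 b2],
    (mul_inv_shift c z hc hz) as [c1 c2], (mul_inv_shift d z hd hz) as [d1 d2].
  (* The part common to all three functions: W = (1 - z^2) (1 - 1 / z^2) V, by splitting off the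
     first factor of both products in the numerator. *)
  set (V := qi (q * z ^ 2) * qi (q / z ^ 2)
    / (theta a z * theta b z * theta c z * theta d z)).
  assert (E1 : shiftable a b c d z
    = (1 - z ^ 2) * V * ((1 - a / z) * (1 - b / z) * (1 - c / z) * (1 - d / z))).
  { unfold shiftable, kernel. cbn [map qpochs_inf fold_right].
    rewrite (qpoch_inf_step q hq (z ^ 2)). rewrite (Cmult_comm (z ^ 2) q).
    transitivity ((1 - z ^ 2) * qi (q * z ^ 2) * qi (q / z ^ 2)
      * (/ (qi (a * z) * qi (a * q / z)) * / (qi (b * z) * qi (b * q / z))
      * / (qi (c * z) * qi (c * q / z)) * / (qi (d * z) * qi (d * q / z)))).
    { unfold Cdiv. rewrite !Cinv_mult_total. replace (/ RtoC 1) with (RtoC 1) by field. ring. }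
    rewrite a1, b1, c1, d1. unfold V, Cdiv. rewrite !Cinv_mult_total. ring. }
  assert (E2 : shiftable a b c d (q * z)
    = - (1 - / z ^ 2) / (q * z ^ 2) * V * ((1 - a * z) * (1 - b * z) * (1 - c * z) * (1 - d * z))).
  { unfold shiftable, kernel. cbn [map qpochs_inf fold_right].
    replace (q / (q * z) ^ 2) with (/ (q * z ^ 2)).
    2: { simpl. field. split; assumption. }
    rewrite (qpoch_inf_step q hq (/ (q * z ^ 2))).
    replace (/ (q * z ^ 2) * q) with (/ z ^ 2).
    2: { simpl. field. split; assumption. }
    rewrite (qpoch_inf_step q hq (/ z ^ 2)).
    replace (/ z ^ 2 * q) with (q / z ^ 2) by (unfold Cdiv; ring).
    transitivity (qi ((q * z) ^ 2) * (1 - / (q * z ^ 2)) * (1 - / z ^ 2) * qi (q / z ^ 2)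
      * (/ (qi (a * (q * z)) * qi (a / z)) * / (qi (b * (q * z)) * qi (b / z))
      * / (qi (c * (q * z)) * qi (c / z)) * / (qi (d * (q * z)) * qi (d / z)))).
    { assert (ee : forall e, e * q / (q * z) = e / z) by (intros e; field; split; assumption).
      rewrite !ee.
      unfold Cdiv. rewrite !Cinv_mult_total. replace (/ RtoC 1) with (RtoC 1) by field. ring. }
    rewrite a2, b2, c2, d2. unfold V. rewrite (qpoch_inf_step q hq (q * z ^ 2)).
    replace (q * z ^ 2 * q) with ((q * z) ^ 2) by (simpl; ring).
    transitivity (- (1 - / z ^ 2) / (q * z ^ 2) * ((1 - q * z ^ 2) * qi ((q * z) ^ 2) * qi (q / z ^ 2)
      * (((1 - a * z) / theta a z) * ((1 - b * z) / theta b z) * ((1 - c * z) / theta c z)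
          * ((1 - d * z) / theta d z)))).
    2: { unfold Cdiv. rewrite !Cinv_mult_total. ring. }
    set (Y := (1 - a * z) / theta a z * ((1 - b * z) / theta b z) * ((1 - c * z) / theta c z)
          * ((1 - d * z) / theta d z)).
    (* The surplus factor of the second product becomes the factor 1 - q z^2, which completes the
       product starting at (q z)^2 to the one starting at q z^2. *)
    replace (1 - / (q * z ^ 2)) with (- (1 - q * z ^ 2) / (q * z ^ 2)).
    2: { simpl. field. split; assumption. }
    unfold Cdiv. ring. }
  rewrite E1, E2. unfold W. fold V.
  rewrite (qpoch_inf_step q hq (z ^ 2)), (qpoch_inf_step q hq (/ z ^ 2)).
  rewrite (Cmult_comm (z ^ 2) q), (Cmult_comm (/ z ^ 2) q).
  transitivity ((1 - z ^ 2) * (1 - / z ^ 2) * V * ((1 - a * b * c * d) * (z + / z)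
    - (a + b + c + d - (a * b * c + a * b * d + a * c * d + b * c * d)))).
  2: { unfold V, Cdiv. ring. }
  clearbody V. clear - hz0 hq0. simpl. field. split; assumption.
Qed.

Lemma mean_first_moment v w : is_mean (W a b c d) v ->
  is_mean (fun z => W a b c d z * (z + / z)) w ->
  (1 - a * b * c * d) * w
    = (a + b + c + d - (a * b * c + a * b * d + a * c * d + b * c * d)) * v.
Proof.
  intros hv hw. destruct shiftable_same_int as [m [h1 h2]].
  apply circle_integral_inv in h1, h2.
  assert (hm : is_mean (fun z => z * shiftable a b c d z + - (1) * (q * z * shiftable a b c d (q * z)))
    (/ (2 * PI * Ci) * m + - (1) * (/ (2 * PI * Ci) * m))).
  { apply is_mean_plus; [| apply is_mean_scal; exact h2].
    apply is_RInt_C_ext with (3 := h1); [lra |]. intros t _. now rewrite Cmult_1_l. }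
  set (s := a + b + c + d - (a * b * c + a * b * d + a * c * d + b * c * d)) in *.
  assert (hm' : is_mean (fun z => (1 - a * b * c * d) * (W a b c d z * (z + / z)) + - s * W a b c d z)
    ((1 - a * b * c * d) * w + - s * v)).
  { apply is_mean_plus; now apply is_mean_scal. }
  assert (e : (1 - a * b * c * d) * w + - s * v
    = / (2 * PI * Ci) * m + - (1) * (/ (2 * PI * Ci) * m)).
  { apply (is_mean_unique _ _ _ hm'). apply is_mean_ext with (2 := hm).
    intros z hz. pose proof (shiftable_difference z hz) as h. fold s in h.
    transitivity (z * shiftable a b c d z - q * z * shiftable a b c d (q * z)); [ring |].
    rewrite h. ring. }
  replace ((1 - a * b * c * d) * w) with ((1 - a * b * c * d) * w + - s * v + s * v) by ring.
  rewrite e. ring.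
Qed.

End UnitDisc.

(** This makes (a z, a / z; q)_n the right basis for moments: multiplication by it does not leave
    the family of weights. *)
Lemma W_shift a b c d n z :
  (Cmod a < 1)%R -> (Cmod b < 1)%R -> (Cmod c < 1)%R -> (Cmod d < 1)%R -> Cmod z = 1%R ->
  W (a * q ^ n) b c d z = W a b c d z * (qpoch (a * z) q n * qpoch (a / z) q n).
Proof.
  intros ha hb hc hd hz. unfold W.
  assert (e : theta a z = qpoch (a * z) q n * qpoch (a / z) q n * theta (a * q ^ n) z).
  { unfold theta. rewrite (qpoch_inf_shift q hq (a * z) n), (qpoch_inf_shift q hq (a / z) n).
    replace (a * q ^ n * z) with (a * z * q ^ n) by ring.
    replace (a * q ^ n / z) with (a / z * q ^ n) by (unfold Cdiv; ring). ring. }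
  pose proof (theta_neq_0 a z ha hz) as hn. pose proof hn as hn'. rewrite e in hn'.
  apply Cmult_neq_0_iff in hn'. destruct hn' as [h1 h2].
  rewrite e. unfold Cdiv. rewrite !Cinv_mult_total.
  set (Q := qpoch (a * z) q n * qpoch (a * / z) q n). fold (Cdiv a z) in Q.
  transitivity (qi (z ^ 2) * qi (/ z ^ 2) * (/ theta (a * q ^ n) z * / theta b z * / theta c z
    * / theta d z) * (Q * / Q)).
  - unfold Q, Cdiv at 1. rewrite Cinv_r by assumption. ring.
  - unfold Q, Cdiv. rewrite !Cinv_mult_total. ring.
Qed.

Lemma W_swap12 a b c d z : W a b c d z = W b a c d z.
Proof. unfold W. f_equal. ring. Qed.

Lemma W_swap13 a b c d z : W a b c d z = W c b a d z.
Proof. unfold W. f_equal. ring. Qed.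

Lemma W_swap14 a b c d z : W a b c d z = W d b c a z.
Proof. unfold W. f_equal. ring. Qed.

Lemma mean_W_step a b c d v v' :
  (Cmod a < 1)%R -> (Cmod b < 1)%R -> (Cmod c < 1)%R -> (Cmod d < 1)%R ->
  is_mean (W a b c d) v -> is_mean (W (a * q) b c d) v' ->
  (1 - a * b * c * d) * v' = (1 - a * b) * (1 - a * c) * (1 - a * d) * v.
Proof.
  intros ha hb hc hd hv hv'.
  destruct (ex_mean (fun z => W a b c d z * (z + / z))) as [w hw].
  { apply unit_cont_mult; [now apply unit_cont_W |].
    intros t _. ccont. 1, 2 : apply continuous_cis. apply cis_neq_0. }
  pose proof (mean_first_moment a b c d ha hb hc hd v w hv hw) as h.
  (* (1 - a z) (1 - a / z) = 1 + a^2 - a (z + 1 / z), so the first moment is all that is needed. *)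
  assert (e : v' = (1 + a * a) * v + - a * w).
  { apply (is_mean_unique _ _ _ hv').
    apply is_mean_ext with (2 := is_mean_plus _ _ _ _ (is_mean_scal (1 + a * a) _ _ hv)
      (is_mean_scal (- a) _ _ hw)).
    intros z hz. pose proof (W_shift a b c d 1 z ha hb hc hd hz) as hs.
    simpl in hs. rewrite Cmult_1_r in hs. rewrite hs.
    pose proof (Cmod_1_neq_0 z hz). field. assumption. }
  rewrite e.
  transitivity ((1 - a * b * c * d) * (1 + a * a) * v - a * ((1 - a * b * c * d) * w)); [ring |].
  (* With s the coefficient from [mean_first_moment], (1 - abcd) (1 + a^2) - a s factors as (1 - ab)
     (1 - ac) (1 - ad). *)
  rewrite h. ring.
Qed.

Lemma mean_W_iterate a b c d v n : forall v',
  (Cmod a < 1)%R -> (Cmod b < 1)%R -> (Cmod c < 1)%R -> (Cmod d < 1)%R ->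
  is_mean (W a b c d) v -> is_mean (W (a * q ^ n) b c d) v' ->
  qpoch (a * b * c * d) q n * v'
    = qpoch (a * b) q n * qpoch (a * c) q n * qpoch (a * d) q n * v.
Proof.
  induction n as [|n IH]; intros v' ha hb hc hd hv hv'.
  - simpl in *. rewrite Cmult_1_r in hv'. rewrite (is_mean_unique _ _ _ hv' hv). ring.
  - pose proof (Cmod_mult_pow_lt_1 a n ha) as han.
    destruct (ex_mean (W (a * q ^ n) b c d)) as [u hu]; [now apply unit_cont_W |].
    specialize (IH u ha hb hc hd hv hu).
    replace (a * q ^ S n) with (a * q ^ n * q) in hv' by (simpl; ring).
    pose proof (mean_W_step _ _ _ _ _ _ han hb hc hd hu hv') as hs.
    simpl. transitivity (qpoch (a * b * c * d) q n * ((1 - a * q ^ n * b * c * d) * v')); [ring |].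
    rewrite hs.
    transitivity ((1 - a * q ^ n * b) * (1 - a * q ^ n * c) * (1 - a * q ^ n * d)
      * (qpoch (a * b * c * d) q n * u)); [ring |].
    rewrite IH. ring.
Qed.

(** The weights with a q^n are W (a z, a / z; q)_n and converge uniformly on the circle to W times
    [theta a], which is [W 0 b c d]. So their means converge, and [mean_W_iterate] passes to the
    limit. *)
Lemma mean_W_to_zero a b c d v v0 :
  (Cmod a < 1)%R -> (Cmod b < 1)%R -> (Cmod c < 1)%R -> (Cmod d < 1)%R ->
  is_mean (W a b c d) v -> is_mean (W 0 b c d) v0 ->
  qi (a * b * c * d) * v0 = qi (a * b) * qi (a * c) * qi (a * d) * v.
Proof.
  intros ha hb hc hd hv hv0.
  assert (hex : forall n, exists u, is_mean (W (a * q ^ n) b c d) u).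
  { intros n. apply ex_mean, unit_cont_W; try assumption. now apply Cmod_mult_pow_lt_1. }
  set (u := fun n => proj1_sig (constructive_indefinite_description _ (hex n))).
  assert (hu : forall n, is_mean (W (a * q ^ n) b c d) (u n)).
  { intros n. unfold u. now destruct constructive_indefinite_description. }
  pose proof (unit_cont_W a b c d ha hb hc hd) as cW.
  pose proof (cont01_qpoch_inf q hq _ (unit_cont_scal_id a)) as c1.
  pose proof (cont01_qpoch_inf q hq _ (unit_cont_scal_inv a)) as c2.
  pose proof (unif_cv_mult _ _ _ _ cW (cont01_mult _ _ c1 c2) (unif_cv_const _)
    (unif_cv_mult _ _ _ _ c1 c2 (unif_cv_qpoch q hq _ (unit_cont_scal_id a))
      (unif_cv_qpoch q hq _ (unit_cont_scal_inv a)))) as hun.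
  destruct (is_RInt_unif_cv _ _ u hun) as [l [h1 h2]].
  { intros n. apply is_RInt_C_ext with (3 := hu n); [lra |].
    intros t _. apply W_shift; try assumption. apply Cmod_cis. }
  assert (e : l = v0).
  { apply (is_mean_unique (W 0 b c d)); [| assumption].
    apply is_RInt_C_ext with (3 := h2); [lra |]. intros t _.
    pose proof (theta_neq_0 a _ ha (Cmod_cis t)) as hn.
    change (W a b c d (cis t) * theta a (cis t) = W 0 b c d (cis t)).
    unfold W. assert (e0 : theta 0 (cis t) = 1).
    { unfold theta, Cdiv. rewrite !Cmult_0_l, !qpoch_inf_0 by assumption. ring. }
    rewrite e0. unfold Cdiv. rewrite !Cinv_mult_total.
    replace (/ RtoC 1) with (RtoC 1) by field.
    transitivity (qi (cis t ^ 2) * qi (/ cis t ^ 2) * (/ theta b (cis t) * / theta c (cis t)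
      * / theta d (cis t)) * (/ theta a (cis t) * theta a (cis t))); [ring |].
    rewrite Cinv_l by assumption. ring. }
  subst l.
  apply (filterlim_C_unique (fun n => qpoch (a * b * c * d) q n * u n)).
  - apply filterlim_Cmult; [now apply qpoch_inf_lim | assumption].
  - apply filterlim_ext
      with (fun n => qpoch (a * b) q n * qpoch (a * c) q n * qpoch (a * d) q n * v).
    { intros n. now rewrite (mean_W_iterate a b c d v n (u n)). }
    apply filterlim_Cmult; [| apply filterlim_const].
    apply filterlim_Cmult; [apply filterlim_Cmult |]; now apply qpoch_inf_lim.
Qed.

(** Once a parameter is 0, its later pair products contribute (0; q)_infinity = 1, so the four
    reductions produce each pair exactly once. The symmetry of W brings the next parameter to the
    front. *)
Lemma mean_W_all_zero a b c d v K :
  (Cmod a < 1)%R -> (Cmod b < 1)%R -> (Cmod c < 1)%R -> (Cmod d < 1)%R ->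
  is_mean (W a b c d) v -> is_mean (W 0 0 0 0) K ->
  qi (a * b * c * d) * K
    = qi (a * b) * qi (a * c) * qi (a * d) * qi (b * c) * qi (b * d) * qi (c * d) * v.
Proof.
  intros ha hb hc hd hv hK.
  assert (h0 : (Cmod 0 < 1)%R) by (rewrite Cmod_0; lra).
  destruct (ex_mean (W 0 b c d)) as [v1 h1]; [now apply unit_cont_W |].
  destruct (ex_mean (W 0 0 c d)) as [v2 h2]; [now apply unit_cont_W |].
  destruct (ex_mean (W 0 0 0 d)) as [v3 h3]; [now apply unit_cont_W |].
  pose proof (mean_W_to_zero a b c d v v1 ha hb hc hd hv h1) as e1.
  pose proof (mean_W_to_zero b 0 c d v1 v2 hb h0 hc hd
    (is_mean_ext _ _ _ (fun z _ => W_swap12 _ _ _ _ z) h1) h2) as e2.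
  pose proof (mean_W_to_zero c 0 0 d v2 v3 hc h0 h0 hd
    (is_mean_ext _ _ _ (fun z _ => W_swap13 _ _ _ _ z) h2) h3) as e3.
  pose proof (mean_W_to_zero d 0 0 0 v3 K hd h0 h0 h0
    (is_mean_ext _ _ _ (fun z _ => W_swap14 _ _ _ _ z) h3) hK) as e4.
  assert (q0 : qi 0 = 1) by now apply qpoch_inf_0.
  repeat rewrite ?Cmult_0_r, ?Cmult_0_l, ?q0, ?Cmult_1_l, ?Cmult_1_r in e2.
  repeat rewrite ?Cmult_0_r, ?Cmult_0_l, ?q0, ?Cmult_1_l, ?Cmult_1_r in e3.
  repeat rewrite ?Cmult_0_r, ?Cmult_0_l, ?q0, ?Cmult_1_l, ?Cmult_1_r in e4.
  rewrite e4, e3, e2.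
  transitivity (qi (b * c) * qi (b * d) * qi (c * d) * (qi (a * b * c * d) * v1)); [ring |].
  rewrite e1. ring.
Qed.

Lemma ex_Csqrt (z : C) : exists s, s * s = z.
Proof.
  destruct z as [x y].
  assert (hm : (Rabs x <= Cmod (x, y))%R) by apply (re_le_Cmod (x, y)).
  assert (hp : (0 <= (Cmod (x, y) + x) / 2)%R) by (apply Rabs_le_between in hm; lra).
  assert (hn : (0 <= (Cmod (x, y) - x) / 2)%R) by (apply Rabs_le_between in hm; lra).
  assert (h2 : (Cmod (x, y) * Cmod (x, y) = x * x + y * y)%R).
  { unfold Cmod. rewrite sqrt_sqrt by (simpl; nra). simpl; ring. }
  set (u := sqrt ((Cmod (x, y) + x) / 2)). set (v := sqrt ((Cmod (x, y) - x) / 2)).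
  assert (hu : (u * u = (Cmod (x, y) + x) / 2)%R) by now apply sqrt_sqrt.
  assert (hv : (v * v = (Cmod (x, y) - x) / 2)%R) by now apply sqrt_sqrt.
  assert (huv : (2 * (u * v) = Rabs y)%R).
  { unfold u, v. rewrite <- sqrt_mult by assumption.
    replace ((Cmod (x, y) + x) / 2 * ((Cmod (x, y) - x) / 2))%R with (Rsqr (y / 2)).
    - rewrite sqrt_Rsqr_abs. unfold Rdiv. rewrite Rabs_mult, (Rabs_pos_eq (/ 2)); lra.
    - unfold Rsqr. nra. }
  destruct (Rle_dec 0 y) as [hy | hy].
  - exists (u, v). rewrite Rabs_pos_eq in huv by assumption. apply C_eq; simpl; lra.
  - exists (u, - v)%R. rewrite Rabs_left in huv by lra. apply C_eq; simpl; lra.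
Qed.

(* For the parameters q, -q, s, -s with s^2 = q the weight collapses to (1 - z^2) (1 - z^-2). *)
Lemma mean_W_0 : is_mean (W 0 0 0 0) (2 / qi q).
Proof.
  destruct (ex_Csqrt q) as [s hs].
  assert (hs1 : (Cmod s < 1)%R).
  { assert (h : (Cmod s * Cmod s < 1)%R) by (rewrite <- Cmod_mult, hs; assumption).
 nra. }
  assert (h0 : (Cmod 0 < 1)%R) by (rewrite Cmod_0; lra).
  destruct (ex_mean (W 0 0 0 0)) as [K hK]; [now apply unit_cont_W |].
  assert (hW : is_mean (W q (- q) s (- s)) 2).
  { assert (hm : is_mean (fun z => 2 + (- (1) * z ^ 2 + - (1) * (/ z) ^ 2))
      (2 + (- (1) * 0 + - (1) * 0))).
    { apply is_mean_plus; [apply is_mean_const |]. apply is_mean_plus; apply is_mean_scal.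
      - apply (mean_cis_pow 1).
      - apply (mean_cis_inv_pow 1). }
    replace (2 + (- (1) * 0 + - (1) * 0)) with (RtoC 2) in hm by ring.
    apply is_mean_ext with (2 := hm). intros z hz. pose proof (Cmod_1_neq_0 z hz) as hz0.
    (* In base q^2 the four products become (q^2 x^2; q^2) and (q x^2; q^2), which interleave to (q
       x^2; q). *)
    assert (key : forall x, qi (q * x) * qi (- q * x) * qi (s * x) * qi (- s * x) = qi (x ^ 2 * q)).
    { intros x. replace (- q * x) with (- (q * x)) by ring. replace (- s * x) with (- (s * x)) by ring.
      rewrite <- (Cmult_assoc (_ * _)), !qpoch_inf_mult_opp.
      replace (s * x * (s * x)) with (x ^ 2 * q) by (simpl; rewrite <- hs; ring).
      replace (q * x * (q * x)) with (x ^ 2 * q * q) by (simpl; ring).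
      rewrite Cmult_comm. apply qpoch_inf_interlace. }
    pose proof (key z) as k1. pose proof (key (/ z)) as k2.
    assert (hop : forall x, (Cmod x < 1)%R -> (Cmod (- x) < 1)%R) by (intros; now rewrite Cmod_opp).
    assert (hn : theta q z * theta (- q) z * theta s z * theta (- s) z
      = qi (z ^ 2 * q) * qi (/ z ^ 2 * q)).
    { rewrite <- k1. rewrite Cpow_inv in k2 by assumption. rewrite <- k2.
      unfold theta, Cdiv. ring. }
    assert (hn0 : theta q z * theta (- q) z * theta s z * theta (- s) z <> 0).
    { rewrite !Cmult_neq_0_iff. repeat split; apply theta_neq_0; auto. }
    unfold W. rewrite (qpoch_inf_step q hq (z ^ 2)), (qpoch_inf_step q hq (/ z ^ 2)).
    rewrite hn in *. apply Cmult_neq_0_iff in hn0. destruct hn0 as [n1 n2].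
    set (A := qi (z ^ 2 * q)) in *. set (B := qi (/ z ^ 2 * q)) in *. clearbody A B.
    simpl. field. repeat split; assumption. }
  assert (ho : forall x, (Cmod x < 1)%R -> (Cmod (- x) < 1)%R) by (intros; now rewrite Cmod_opp).
  pose proof (mean_W_all_zero q (- q) s (- s) 2 K hq (ho _ hq) hs1 (ho _ hs1) hW hK) as e.
  assert (hq3 : (Cmod (q * q * q) < 1)%R).
  { rewrite !Cmod_mult. pose proof (Cmod_ge_0 q). nra. }
  pose proof (qpoch_inf_neq_0_lt_1 q hq q hq) as nq.
  pose proof (qpoch_inf_neq_0_lt_1 q hq _ hq3) as nq3.
  (* The pair products are -q^2, q s, -q s, -q s, q s, -q. Together with (q; q), pairing x with -x
     and interleaving give (q^2; q) (q^3; q^2) (-q^2; q) = (q^4; q^2) (q^3; q^2) = (q^3; q), and q^3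
     is the product of the four parameters. *)
  assert (hprod : qi q * (qi (q * - q) * qi (q * s) * qi (q * - s) * qi (- q * s) * qi (- q * - s)
    * qi (s * - s)) = qi (q * q * q)).
  { replace (q * - q) with (- (q * q)) by ring. replace (q * - s) with (- (q * s)) by ring.
    replace (- q * s) with (- (q * s)) by ring. replace (- q * - s) with (q * s) by ring.
    replace (s * - s) with (- q) by (rewrite <- hs; ring).
    assert (i1 : qi (q * s) * qi (- (q * s)) = qpoch_inf (q * q * q) (q * q)).
    { rewrite qpoch_inf_mult_opp. f_equal. rewrite <- hs. ring. }
    pose proof (qpoch_inf_mult_opp q) as i2. pose proof (qpoch_inf_mult_opp (q * q)) as i3.
    pose proof (qpoch_inf_interlace (q * q)) as i4. pose proof (qpoch_inf_interlace (q * q * q)) as i5.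
    replace (q * q * q * q) with (q * q * (q * q)) in i5 by ring.
    transitivity ((qi q * qi (- q)) * (qi (q * s) * qi (- (q * s)))
      * (qi (q * s) * qi (- (q * s))) * qi (- (q * q))); [ring |].
    rewrite i1, i2, i4. rewrite <- i5, <- i3. ring. }
  assert (hK2 : K = 2 / qi q).
  { replace (q * - q * s * - s) with (q * q * q) in e by (rewrite <- hs; ring).
    assert (e' : qi q * (qi (q * q * q) * K) = 2 * qi (q * q * q)).
    { rewrite e. rewrite <- hprod. ring. }
    set (Q := qi (q * q * q)) in *. clearbody Q.
    replace K with (/ qi q * / Q * (qi q * (Q * K))) by (field; split; assumption).
    rewrite e'. field. split; assumption. }
  now rewrite <- hK2.
Qed.

(** The 2 compensates for dz / (4 pi i z), which is half of the mean; the normalised weight thus has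
    total mass 1. *)
Theorem askey_wilson_integral a b c d :
  (Cmod a < 1)%R -> (Cmod b < 1)%R -> (Cmod c < 1)%R -> (Cmod d < 1)%R ->
  is_mean (W a b c d) (2 * h0 (a, b, c, d) q).
Proof.
  intros ha hb hc hd.
  destruct (ex_mean (W a b c d)) as [v hv]; [now apply unit_cont_W |].
  pose proof (mean_W_all_zero a b c d v _ ha hb hc hd hv mean_W_0) as e.
  assert (hn : forall x y, (Cmod x < 1)%R -> (Cmod y < 1)%R -> qi (x * y) <> 0).
  { intros x y hx hy. apply qpoch_inf_neq_0_lt_1; [exact hq |]. rewrite Cmod_mult.
 pose proof (Cmod_ge_0 y). nra. }
  assert (ev : v = 2 * h0 (a, b, c, d) q); [| now rewrite <- ev].
  unfold h0. cbn [qpochs_inf fold_right].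
  pose proof (hn a b ha hb) as n1. pose proof (hn a c ha hc) as n2. pose proof (hn a d ha hd) as n3.
  pose proof (hn b c hb hc) as n4. pose proof (hn b d hb hd) as n5. pose proof (hn c d hc hd) as n6.
  replace v with (/ (qi (a * b) * qi (a * c) * qi (a * d) * qi (b * c) * qi (b * d) * qi (c * d))
    * (qi (a * b) * qi (a * c) * qi (a * d) * qi (b * c) * qi (b * d) * qi (c * d) * v)).
  - rewrite <- e. unfold Cdiv. rewrite !Cinv_mult_total.
    replace (/ RtoC 1) with (RtoC 1) by field. ring.
  - rewrite Cmult_assoc, Cinv_l; [ring |]. rewrite !Cmult_neq_0_iff. tauto.
Qed.

End AskeyWilsonIntegral.

(** * Newton interpolation *)

Fixpoint csum (f : nat -> C) (n : nat) : C :=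
  match n with O => f O | S m => csum f m + f (S m) end.

Lemma sum_n_csum (f : nat -> C) n : sum_n f n = csum f n.
Proof.
  induction n as [|n IH]; [now rewrite sum_O |]. rewrite sum_Sn, IH. reflexivity.
Qed.

Lemma csum_ext f g n : (forall k, (k <= n)%nat -> f k = g k) -> csum f n = csum g n.
Proof.
  induction n as [|n IH]; intros h; simpl; [apply h; lia |].
  rewrite IH by (intros; apply h; lia). now rewrite h.
Qed.

Lemma csum_plus f g n : csum (fun k => f k + g k) n = csum f n + csum g n.
Proof. induction n as [|n IH]; simpl; [reflexivity |]. rewrite IH. ring. Qed.

Lemma csum_scal c f n : csum (fun k => c * f k) n = c * csum f n.
Proof. induction n as [|n IH]; simpl; [reflexivity |]. rewrite IH. ring. Qed.

Lemma csum_first f n : csum f (S n) = f O + csum (fun k => f (S k)) n.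
Proof. induction n as [|n IH]; [reflexivity |]. simpl in *. rewrite IH. ring. Qed.

Fixpoint cprod (f : nat -> C) (n : nat) : C :=
  match n with O => 1 | S m => cprod f m * f m end.

Lemma cprod_ext f g n : (forall k, (k < n)%nat -> f k = g k) -> cprod f n = cprod g n.
Proof.
  induction n as [|n IH]; intros h; simpl; [reflexivity |].
  rewrite IH by (intros; apply h; lia). now rewrite h by lia.
Qed.

Lemma cprod_mult f g n : cprod (fun k => f k * g k) n = cprod f n * cprod g n.
Proof. induction n as [|n IH]; simpl; [ring |]. rewrite IH. ring. Qed.

Lemma cprod_first f n : cprod f (S n) = f O * cprod (fun k => f (S k)) n.
Proof. induction n as [|n IH]; [simpl; ring |]. simpl in *. rewrite IH. ring. Qed.

Lemma cprod_rev f n : cprod f n = cprod (fun k => f (n - 1 - k)%nat) n.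
Proof.
  revert f; induction n as [|n IH]; intros f; [reflexivity |].
  rewrite (cprod_first (fun k => f (S n - 1 - k)%nat)). simpl. rewrite Cmult_comm.
  f_equal; [f_equal; lia |]. rewrite IH. apply cprod_ext. intros k hk. f_equal. lia.
Qed.

Lemma cprod_neq_0 (f : nat -> C) n : (forall k, (k < n)%nat -> f k <> 0) -> cprod f n <> 0.
Proof.
  induction n as [|n IH]; intros h; simpl; [apply C1_nz |].
  apply Cmult_neq_0; [apply IH; intros; apply h; lia | apply h; lia].
Qed.

Lemma qpoch_cprod x q n : qpoch x q n = cprod (fun k => 1 - x * q ^ k) n.
Proof. induction n as [|n IH]; simpl; [reflexivity |]. now rewrite IH. Qed.

Section Newton.

(** The hypotheses amount to w k j = 1 / prod (x j - x i) over i <= k, i <> j, split into the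
    passage from k to k + 1 and the diagonal. In this form they can be checked for the explicit
    weights one q-factor at a time. *)
Variables (x : nat -> C) (w : nat -> nat -> C) (N : nat).
Hypothesis distinct : forall i j, (i < j <= N)%nat -> x i <> x j.
Hypothesis w_step : forall k j, (j <= k < N)%nat -> w (S k) j * (x j - x (S k)) = w k j.
Hypothesis w_diag : forall k, (k <= N)%nat -> w k k * cprod (fun i => x k - x i) k = 1.

Lemma w_quot k j : (j <= k < N)%nat -> w (S k) j = w k j / (x j - x (S k)).
Proof.
  intros h. rewrite <- (w_step k j h). field. apply Cminus_neq_0, distinct. lia.
Qed.

(** At y = x (k + 1) the partial fraction expansion has the diagonal weight on the right and minus
    the other new weights on the left. It enters as a hypothesis because both facts belong to one
    induction. *)
Lemma weights_sum_step k : (k < N)%nat ->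
  (forall y, (forall i, (i <= k)%nat -> y <> x i) ->
     csum (fun j => w k j / (y - x j)) k = / cprod (fun i => y - x i) (S k)) ->
  csum (w (S k)) (S k) = 0.
Proof.
  intros hk hpf. simpl.
  pose proof (hpf (x (S k))) as e. rewrite (csum_ext _ (fun j => - (1) * w (S k) j)) in e.
  - rewrite csum_scal in e.
    assert (hd : cprod (fun i => x (S k) - x i) (S k) <> 0).
    { apply cprod_neq_0. intros i hi. apply Cminus_neq_0, not_eq_sym, distinct. lia. }
    assert (hw : w (S k) (S k) = / cprod (fun i => x (S k) - x i) (S k)).
    { rewrite <- (Cmult_1_r (w _ _)), <- (Cinv_r _ hd), Cmult_assoc, w_diag by lia. ring. }
    rewrite hw, <- e by (intros i hi; apply not_eq_sym, distinct; lia). ring.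
  - intros j hj. rewrite w_quot by lia.
    pose proof (Cminus_neq_0 _ _ (distinct j (S k) ltac:(lia))).
    assert (x (S k) - x j <> 0) by (apply Cminus_neq_0, not_eq_sym, distinct; lia).
    field. split; assumption.
Qed.

Lemma partial_fractions k : (k <= N)%nat ->
  forall y, (forall i, (i <= k)%nat -> y <> x i) ->
  csum (fun j => w k j / (y - x j)) k = / cprod (fun i => y - x i) (S k).
Proof.
  induction k as [|k IH]; intros hk y hy.
  - simpl. pose proof (w_diag 0 hk) as h. simpl in h. rewrite Cmult_1_r in h. rewrite h, Cmult_1_l.
    unfold Cdiv. ring.
  - specialize (IH ltac:(lia)). pose proof (weights_sum_step k ltac:(lia) IH) as h0.
    (* For j <= k, w (k+1) j / (y - x j) = (w k j / (y - x j) + w (k+1) j) / (y - x (k+1)). The test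
       on j drops w k (k+1), about which nothing is assumed; the second summands add up to 0. *)
    rewrite (csum_ext _ (fun j => / (y - x (S k)) * ((match Nat.leb j k with true => w k j / (y - x j)
       | false => 0 end) + w (S k) j))).
    + rewrite csum_scal, csum_plus, h0. cbn [csum].
      rewrite (proj2 (Nat.leb_gt (S k) k)) by lia.
      rewrite (csum_ext _ (fun j => w k j / (y - x j))).
      2: { intros j hj. now rewrite (proj2 (Nat.leb_le j k)). }
      rewrite IH by (intros; apply hy; lia). simpl. rewrite !Cinv_mult_total. ring.
    + intros j hj. pose proof (Cminus_neq_0 _ _ (hy j hj)).
      pose proof (Cminus_neq_0 _ _ (hy (S k) (Nat.le_refl _))).
      destruct (Nat.leb_spec j k) as [hl | hl].
      * rewrite w_quot by lia. pose proof (Cminus_neq_0 _ _ (distinct j (S k) ltac:(lia))).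
        field. repeat split; assumption.
      * replace j with (S k) by lia. field. assumption.
Qed.

(** The divided difference of t^n at the nodes x 0, ..., x k. *)
Definition divdiff n k : C := csum (fun j => w k j * x j ^ n) k.

Lemma divdiff_0_S k : (k < N)%nat -> divdiff 0 (S k) = 0.
Proof.
  intros hk. rewrite <- (weights_sum_step k hk (partial_fractions k ltac:(lia))).
  apply csum_ext. intros; simpl; ring.
Qed.

(** The Leibniz rule for t t^n: in x j = x (k+1) + (x j - x (k+1)) the second part turns w (k+1) j
    into w k j. *)
Lemma divdiff_step n k : (k < N)%nat ->
  divdiff (S n) (S k) = x (S k) * divdiff n (S k) + divdiff n k.
Proof.
  intros hk. unfold divdiff. simpl.
  rewrite (csum_ext (fun j => w (S k) j * (x j * x j ^ n))
    (fun j => x (S k) * (w (S k) j * x j ^ n) + w k j * x j ^ n)).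
  - rewrite csum_plus, csum_scal. ring.
  - intros j hj. rewrite <- (w_step k j) by lia. ring.
Qed.

Lemma divdiff_high n : forall k, (n < k <= N)%nat -> divdiff n k = 0.
Proof.
  induction n as [|n IH]; intros [|k] hk; try lia.
  - apply divdiff_0_S; lia.
  - rewrite divdiff_step, !IH by lia. ring.
Qed.

(** On the Newton basis y acts by y N_k = x_k N_k + N_(k+1), and [divdiff_step] is the matching
    recurrence for the coefficients. *)
Lemma newton_monomial y n : (n <= N)%nat ->
  y ^ n = csum (fun k => divdiff n k * cprod (fun i => y - x i) k) n.
Proof.
  induction n as [|n IH]; intros hn.
  - simpl. unfold divdiff. simpl. pose proof (w_diag 0 (Nat.le_0_l _)) as h. simpl in h.
    rewrite Cmult_1_r in h. rewrite h. ring.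
  - rewrite Cpow_S, IH by lia. rewrite <- csum_scal, csum_first.
    rewrite (csum_ext (fun k => divdiff (S n) (S k) * cprod (fun i => y - x i) (S k))
      (fun k => x (S k) * divdiff n (S k) * cprod (fun i => y - x i) (S k)
         + divdiff n k * cprod (fun i => y - x i) (S k))).
    2: { intros k hk. rewrite divdiff_step by lia. ring. }
    rewrite csum_plus, Cplus_assoc.
    replace (divdiff (S n) 0) with (x O * divdiff n 0) by (unfold divdiff; simpl; ring).
    rewrite <- (csum_first (fun k => x k * divdiff n k * cprod (fun i => y - x i) k)).
    cbn [csum]. rewrite (divdiff_high n (S n)) by lia.
    rewrite Cmult_0_r, Cmult_0_l, Cplus_0_r, <- csum_plus.
    apply csum_ext. intros k hk. simpl. ring.
Qed.

End Newton.

(** * Nodes and weights of the moment formula *)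

Section Moments.

Variables q a : C.
Hypothesis hq : (Cmod q < 1)%R.
Hypothesis hq0 : q <> 0.
Hypothesis ha : a <> 0.

Definition node (j : nat) : C := q ^ j * a + / q ^ j / a.

(** The inner summand of the theorem without the power, with q^k moved inside. Times [scale k] it is
    the reciprocal of the product of [node j - node i] over i <= k, i <> j. *)
Definition weight (k j : nat) : C :=
  q ^ k * (/ q ^ (j ^ 2) * / a ^ (2 * j)
    / (qpochs [q; q / q ^ (2 * j) / a ^ 2] q j * qpochs [q; q ^ (2 * j + 1) * a ^ 2] q (k - j))).

(* [scale k] is (-a)^k q^(k (k - 1) / 2). *)
Fixpoint scale (k : nat) : C :=
  match k with O => 1 | S m => - scale m * a * q ^ m end.

(** (1 - a z q^k) (1 - a q^k / z) = -a q^k (z + 1 / z - [node k]): the nodes are the values of z + 1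
    / z at the zeros of the basis products. *)
Lemma basis_cprod (z : C) k : z <> 0 ->
  qpoch (a * z) q k * qpoch (a / z) q k = scale k * cprod (fun i => z + / z - node i) k.
Proof.
  intros hz. induction k as [|k IH]; simpl; [ring |].
  transitivity (qpoch (a * z) q k * qpoch (a / z) q k
    * ((1 - a * z * q ^ k) * (1 - a / z * q ^ k))); [ring |].
  rewrite IH. unfold node. pose proof (Cpow_nz _ k hq0). field. repeat split; assumption.
Qed.

Lemma one_sub_pow_S_neq_0 m : 1 - q ^ S m <> 0.
Proof. apply one_sub_pow_neq_0; [exact hq | exact hq]. Qed.

(** One [scale k] comes from the basis and one from [node_prod]; with q^k they account for the
    prefactor q^(-j^2) a^(-2j) of the theorem. *)
Lemma scale_sq k : scale k * scale k * q ^ k = q ^ (k ^ 2) * a ^ (2 * k).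
Proof.
  induction k as [|k IH]; [simpl; ring |].
  replace (S k ^ 2)%nat with (k ^ 2 + (k + k + 1))%nat by (simpl; lia).
  replace (2 * S k)%nat with (2 * k + 2)%nat by lia.
  rewrite !Cpow_add_r.
  transitivity (scale k * scale k * q ^ k * (q ^ k * q ^ k * q * (a * a))); [simpl; ring |].
  rewrite IH. simpl. ring.
Qed.

(** The difference to a later node shows the factors that (q, q^(2j+1) a^2; q)_m gains when m grows
    by one; [node_sub_down] is arranged to yield (q, q^(1-2k) / a^2; q)_k from the earlier nodes.
    These are the two denominators of the formula. *)
Lemma node_sub_up j m : node j - node (j + S m)
  = - (1) / (q ^ (j + S m) * a) * (1 - q * q ^ m) * (1 - q ^ (2 * j + 1) * a ^ 2 * q ^ m).
Proof.
  unfold node. replace (2 * j + 1)%nat with (j + j + 1)%nat by lia.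
  rewrite !Cpow_add_r, Cpow_S.
  pose proof (Cpow_nz _ j hq0). pose proof (Cpow_nz _ m hq0).
  simpl. field. repeat split; assumption.
Qed.

Lemma node_sub_down i m : node (i + S m) - node i
  = - (q ^ i * a) * (1 - q ^ S m) * (1 - / (q ^ (i + i + S m) * a ^ 2)).
Proof.
  unfold node. rewrite !Cpow_add_r.
  pose proof (Cpow_nz _ i hq0). pose proof (Cpow_nz _ (S m) hq0).
  set (P := q ^ S m) in *. set (Q := q ^ i) in *. simpl. field. repeat split; assumption.
Qed.

Lemma node_prod k : cprod (fun i => node k - node i) k
  = scale k * (qpoch q q k * qpoch (q / q ^ (2 * k) / a ^ 2) q k).
Proof.
  rewrite (cprod_ext _ (fun i => (- (q ^ i * a)) * ((1 - q ^ (k - i)) * (1 - / (q ^ (i + k) * a ^ 2))))).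
  - rewrite cprod_mult. f_equal.
    + clear. induction k as [|k IH]; simpl; [reflexivity |]. rewrite IH. ring.
    (* The exponents k - i and i + k run against the order of the factors in the q-shifted
       factorials, hence the reversal i -> k - 1 - i. *)
    + rewrite cprod_mult. rewrite (cprod_rev (fun i => 1 - q ^ (k - i))).
      rewrite (cprod_rev (fun i => 1 - / (q ^ (i + k) * a ^ 2))). rewrite !qpoch_cprod.
      f_equal; apply cprod_ext; intros i hi.
      * replace (k - (k - 1 - i))%nat with (S i) by lia. reflexivity.
      * replace (2 * k)%nat with (S i + (k - 1 - i + k))%nat by lia.
        rewrite (Cpow_add_r q (S i)), Cpow_S. f_equal. f_equal.
        pose proof (Cpow_nz _ i hq0). pose proof (Cpow_nz _ (k - 1 - i + k) hq0).
        set (P := q ^ (k - 1 - i + k)) in *. simpl. field. repeat split; assumption.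
  - intros i hi. replace (node k) with (node (i + S (k - i - 1))) by (f_equal; lia).
    rewrite node_sub_down. replace (S (k - i - 1)) with (k - i)%nat by lia.
    replace (i + i + (k - i))%nat with (i + k)%nat by lia. ring.
Qed.

Section Nodes.

Variable n : nat.
Hypothesis nondeg : forall m, (0 < m < 2 * n)%nat -> 1 - a ^ 2 * q ^ m <> 0.

Lemma qpoch_up_neq_0 j m : (j + m <= n)%nat -> qpoch (q ^ (2 * j + 1) * a ^ 2) q m <> 0.
Proof.
  intros h. apply qpoch_neq_0. intros i hi.
  replace (q ^ (2 * j + 1) * a ^ 2 * q ^ i) with (a ^ 2 * q ^ (2 * j + 1 + i))
    by (rewrite Cpow_add_r; ring).
  apply nondeg. lia.
Qed.

Lemma qpoch_down_neq_0 j : (j <= n)%nat -> qpoch (q / q ^ (2 * j) / a ^ 2) q j <> 0.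
Proof.
  intros h. apply qpoch_neq_0. intros i hi e.
  assert (hd : 1 - a ^ 2 * q ^ (2 * j - 1 - i) <> 0) by (apply nondeg; lia).
  apply hd. revert e.
  replace (2 * j)%nat with (S i + (2 * j - 1 - i))%nat at 1 by lia. rewrite Cpow_add_r, Cpow_S.
  pose proof (Cpow_nz _ i hq0). pose proof (Cpow_nz _ (2 * j - 1 - i) hq0).
  set (P := q ^ (2 * j - 1 - i)) in *. intros e.
  replace (1 - a ^ 2 * P) with (- (a ^ 2 * P) * (1 - q / (q * q ^ i * P) / a ^ 2 * q ^ i)).
  - rewrite e. ring.
  - field. repeat split; assumption.
Qed.

(** Equal nodes would force q^(j-i) = 1 or a^2 q^(i+j) = 1, and i + j runs through the range of
    [nondeg]. *)
Lemma node_distinct i j : (i < j <= n)%nat -> node i <> node j.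
Proof.
  intros h e. apply (f_equal (fun u => u - node j)) in e.
  replace (node j - node j) with (RtoC 0) in e by ring.
  revert e. replace j with (i + S (j - i - 1))%nat by lia. rewrite node_sub_up.
  match goal with |- ?u = _ -> False => change (u <> 0) end.
  rewrite !Cmult_neq_0_iff. refine (conj (conj _ _) _).
  - apply Cmult_neq_0; [| apply Cinv_neq_0, Cmult_neq_0; [now apply Cpow_nz | assumption]].
    intros e. apply C1_nz. replace (RtoC 1) with (- - (1)) by ring. rewrite e. ring.
  - apply (one_sub_pow_S_neq_0 (j - i - 1)).
  - replace (q ^ (2 * i + 1) * a ^ 2 * q ^ (j - i - 1)) with (a ^ 2 * q ^ (2 * i + 1 + (j - i - 1)))
      by (rewrite Cpow_add_r; ring).
    apply nondeg. lia.
Qed.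

Lemma weight_step k j : (j <= k < n)%nat ->
  scale (S k) * weight (S k) j * (node j - node (S k)) = scale k * weight k j.
Proof.
  intros h. replace k with (j + (k - j))%nat by lia. set (m := (k - j)%nat).
  rewrite <- Nat.add_succ_r, node_sub_up. unfold weight.
  replace (j + S m - j)%nat with (S m) by lia. replace (j + m - j)%nat with m by lia.
  cbn [qpochs fold_right]. rewrite (Nat.add_succ_r j m). cbn [scale qpoch].
  pose proof (qpoch_up_neq_0 j (S m) ltac:(lia)) as h1. cbn [qpoch] in h1.
  apply Cmult_neq_0_iff in h1. destruct h1 as [h1 h2].
  pose proof (one_sub_pow_S_neq_0 m) as h3. rewrite Cpow_S in h3.
  pose proof (Cpow_nz _ (j + m) hq0) as h4.
  unfold Cdiv. rewrite !Cinv_mult_total, (Cpow_S q (j + m)).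
  set (u := 1 - q * q ^ m) in *. set (v := 1 - q ^ (2 * j + 1) * a ^ 2 * q ^ m) in *.
  set (Z := / q ^ (j ^ 2) * / a ^ (2 * j)).
  set (Y := / qpoch q q j * (/ qpoch (q * / q ^ (2 * j) * / a ^ 2) q j * / RtoC 1)).
  set (X := / qpoch q q m * (/ qpoch (q ^ (2 * j + 1) * a ^ 2) q m * / RtoC 1)).
  transitivity (scale (j + m) * q ^ (j + m) * Z * Y * X
    * ((a * / a) * (q ^ (j + m) * / q ^ (j + m)) * (q * / q) * (u * / u) * (v * / v))).
  - rewrite !Cinv_mult_total. unfold X. ring.
  - rewrite !Cinv_r by assumption. ring.
Qed.

Lemma weight_diag k : (k <= n)%nat ->
  scale k * weight k k * cprod (fun i => node k - node i) k = 1.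
Proof.
  intros hk. rewrite node_prod. unfold weight. rewrite Nat.sub_diag. cbn [qpochs fold_right qpoch].
  pose proof (qpoch_down_neq_0 k hk) as h1.
  assert (h2 : qpoch q q k <> 0).
  { apply qpoch_neq_0. intros i _. apply (one_sub_pow_S_neq_0 i). }
  pose proof (Cpow_nz _ (k ^ 2) hq0) as h3. pose proof (Cpow_nz _ (2 * k) ha) as h4.
  set (A := qpoch q q k) in *. set (B := qpoch (q / q ^ (2 * k) / a ^ 2) q k) in *.
  transitivity (scale k * scale k * q ^ k * / (q ^ (k ^ 2) * a ^ (2 * k))).
  - field. repeat split; assumption.
  - rewrite scale_sq. field. split; assumption.
Qed.

Lemma monomial_expansion (z : C) : z <> 0 -> (z + / z) ^ n
  = csum (fun k => csum (fun j => weight k j * node j ^ n) k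
      * (qpoch (a * z) q k * qpoch (a / z) q k)) n.
Proof.
  intros hz. rewrite (newton_monomial node (fun k j => scale k * weight k j) n node_distinct
    weight_step weight_diag (z + / z) n (Nat.le_refl _)).
  apply csum_ext. intros k hk. rewrite basis_cprod by assumption. unfold divdiff.
  rewrite (csum_ext _ (fun j => scale k * (weight k j * node j ^ n))) by (intros; ring).
  rewrite csum_scal. ring.
Qed.

End Nodes.
End Moments.

(** * The moment integral on the polydisc *)

Lemma is_mean_csum (f : nat -> C -> C) (v : nat -> C) n :
  (forall k, (k <= n)%nat -> is_mean (f k) (v k)) ->
  is_mean (fun z => csum (fun k => f k z) n) (csum v n).
Proof.
  induction n as [|n IH]; intros h; simpl; [now apply h |].
  apply (is_mean_plus (fun z => csum (fun k => f k z) n) (f (S n))); [| now apply h].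
  apply IH. intros; apply h; lia.
Qed.

Definition aw_sum (q : C) (n : nat) (p : C4) : C :=
  let '(a, b, c, d) := p in
  / 2 ^ n * csum (fun k => qpochs [a * b; a * c; a * d] q k / qpoch (a * b * c * d) q k
    * csum (fun j => weight q a k j * node q a j ^ n) k) n.

Section ContourValue.

Variables (q : C) (n : nat).
Hypothesis hq : (Cmod q < 1)%R.
Hypothesis hq0 : q <> 0.

Variables a b c d : C.
Hypothesis ha : (Cmod a < 1)%R.
Hypothesis hb : (Cmod b < 1)%R.
Hypothesis hc : (Cmod c < 1)%R.
Hypothesis hd : (Cmod d < 1)%R.

Definition aw_integrand (z : C) : C :=
  / (4 * PI * Ci * z) * aw_weight (a, b, c, d) q z * ((z + / z) / 2) ^ n.

Lemma aw_integrand_W z : aw_integrand z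
  = / (4 * PI * Ci) * / z * (W q a b c d z / h0 (a, b, c, d) q) * ((z + / z) / 2) ^ n.
Proof.
  unfold aw_integrand. rewrite Cinv_mult_total. f_equal. f_equal.
  unfold aw_weight, W, theta. cbn [qpochs_inf fold_right].
  unfold Cdiv. rewrite !Cinv_mult_total. replace (/ RtoC 1) with (RtoC 1) by field. ring.
Qed.

Lemma Cmod_prod_lt_1 x y : (Cmod x < 1)%R -> (Cmod y < 1)%R -> (Cmod (x * y) < 1)%R.
Proof.
  intros hx hy. rewrite Cmod_mult. pose proof (Cmod_ge_0 y). nra.
Qed.

Lemma h0_ratio k : h0 (a * q ^ k, b, c, d) q
  = qpochs [a * b; a * c; a * d] q k / qpoch (a * b * c * d) q k * h0 (a, b, c, d) q.
Proof.
  assert (h4 : qpoch_inf (a * b * c * d) q <> 0).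
  { apply qpoch_inf_neq_0_lt_1; [exact hq |]. repeat apply Cmod_prod_lt_1; assumption. }
  pose proof (qpoch_of_qpoch_inf_neq_0 q hq _ k h4) as h4'.
  unfold h0. cbn [qpochs_inf qpochs fold_right].
  rewrite (qpoch_inf_shift q hq (a * b * c * d) k).
  assert (e : forall x, (Cmod x < 1)%R -> qpoch (a * x) q k * / qpoch_inf (a * x) q
    = / qpoch_inf (a * q ^ k * x) q).
  { intros x hx.
    assert (hn : qpoch_inf (a * x) q <> 0).
    { apply qpoch_inf_neq_0_lt_1; [exact hq |]. now apply Cmod_prod_lt_1. }
    pose proof (qpoch_of_qpoch_inf_neq_0 q hq _ k hn) as hn'.
    rewrite (qpoch_inf_shift q hq (a * x) k), Cinv_mult_total, Cmult_assoc, Cinv_r by assumption.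
    replace (a * x * q ^ k) with (a * q ^ k * x) by ring. ring. }
  unfold Cdiv. rewrite !Cinv_mult_total, <- !e by assumption.
  replace (a * q ^ k * b * c * d) with (a * b * c * d * q ^ k) by ring.
  transitivity (qpoch (a * b * c * d) q k * / qpoch (a * b * c * d) q k
    * (qpoch_inf (a * b * c * d * q ^ k) q * (/ qpoch_inf q q *
    (qpoch (a * b) q k * / qpoch_inf (a * b) q *
     (qpoch (a * c) q k * / qpoch_inf (a * c) q *
      (qpoch (a * d) q k * / qpoch_inf (a * d) q *
       (/ qpoch_inf (b * c) q * (/ qpoch_inf (b * d) q * (/ qpoch_inf (c * d) q * / 1))))))))).
  - rewrite Cinv_r by assumption. ring.
  - ring.
Qed.

Lemma h0_neq_0 : h0 (a, b, c, d) q <> 0.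
Proof.
  assert (hn : forall x, (Cmod x < 1)%R -> qpoch_inf x q <> 0)
    by (intros; now apply qpoch_inf_neq_0_lt_1).
  unfold h0. apply Cmult_neq_0.
  - apply hn. repeat apply Cmod_prod_lt_1; assumption.
  - apply Cinv_neq_0. cbn [qpochs_inf fold_right]. rewrite !Cmult_neq_0_iff.
    repeat split; try apply C1_nz; apply hn; try assumption; now apply Cmod_prod_lt_1.
Qed.

Lemma nondegenerate_lt_1 m : 1 - a ^ 2 * q ^ m <> 0.
Proof.
  apply one_sub_pow_neq_0; [exact hq |]. simpl. rewrite Cmult_1_r. now apply Cmod_prod_lt_1.
Qed.

(** Multiplying the Newton expansion by W replaces the k-th basis product by the weight with a q^k,
    whose mean is known; [h0_ratio] then produces the quotient of q-shifted factorials. *)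
Lemma is_mean_moment : a <> 0 ->
  is_mean (fun z => W q a b c d z * (z + / z) ^ n)
    (2 * h0 (a, b, c, d) q * csum (fun k => qpochs [a * b; a * c; a * d] q k / qpoch (a * b * c * d) q k
      * csum (fun j => weight q a k j * node q a j ^ n) k) n).
Proof.
  intros ha0. rewrite <- csum_scal.
  apply is_mean_ext with (fun z => csum (fun k => csum (fun j => weight q a k j * node q a j ^ n) k
    * W q (a * q ^ k) b c d z) n).
  { intros z hz. rewrite (monomial_expansion q a hq hq0 ha0 n); [| intros; apply nondegenerate_lt_1 |].
    - rewrite <- csum_scal. apply csum_ext. intros k hk. rewrite (W_shift q hq) by assumption. ring.
    - now apply Cmod_1_neq_0. }
  rewrite (csum_ext _ (fun k => csum (fun j => weight q a k j * node q a j ^ n) k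
    * (2 * h0 (a * q ^ k, b, c, d) q))).
  - apply is_mean_csum. intros k hk. apply is_mean_scal. apply askey_wilson_integral; try assumption.
    now apply Cmod_mult_pow_lt_1.
  - intros k hk. rewrite h0_ratio. ring.
Qed.

Lemma circle_separates : separates_poles (circle 1) (a, b, c, d) q.
Proof.
  assert (he : forall e, In e [a; b; c; d] -> (Cmod e < 1)%R).
  { simpl. intros e [<- | [<- | [<- | [<- | []]]]]; assumption. }
  split.
  - apply circle_encloses. rewrite Cmod_0, Cmod_1. lra.
  - intros e hin k. split.
    + apply circle_encloses. rewrite Cmod_1. apply Cmod_mult_pow_lt_1; auto.
    + intros z hz. apply circle_excludes; [apply C1_nz |]. rewrite Cmod_1.
      apply (pole_outside q hq e k); auto.
Qed.

Lemma circle_moment : a <> 0 ->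
  is_contour_integral aw_integrand (circle 1) (aw_sum q n (a, b, c, d)).
Proof.
  intros ha0. pose proof h0_neq_0 as hn. pose proof two_PI_i_neq_0 as hpi.
  pose proof (RtoC_neq_0 2 ltac:(lra)) as h2. pose proof (Cpow_nz _ n h2) as h2n.
  assert (hm : is_mean (fun z => z * aw_integrand z)
    (/ (4 * PI * Ci) * / h0 (a, b, c, d) q * / 2 ^ n * (2 * h0 (a, b, c, d) q
      * csum (fun k => qpochs [a * b; a * c; a * d] q k / qpoch (a * b * c * d) q k
      * csum (fun j => weight q a k j * node q a j ^ n) k) n))).
  { apply is_mean_ext with (2 := is_mean_scal (/ (4 * PI * Ci) * / h0 (a, b, c, d) q * / 2 ^ n) _ _
      (is_mean_moment ha0)).
    intros z hz. pose proof (Cmod_1_neq_0 z hz). rewrite aw_integrand_W.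
    unfold Cdiv. rewrite Cpow_mult_l, Cpow_inv by assumption.
    transitivity (z * / z * (/ (4 * PI * Ci) * / h0 (a, b, c, d) q * / 2 ^ n
      * (W q a b c d z * (z + / z) ^ n))); [| ring].
    rewrite Cinv_r by assumption. ring. }
  unfold aw_sum. set (Sm := csum _ n) in *.
  replace (/ 2 ^ n * Sm) with (2 * PI * Ci * (/ (4 * PI * Ci) * / h0 (a, b, c, d) q * / 2 ^ n
    * (2 * h0 (a, b, c, d) q * Sm))).
  - apply circle_integral. apply is_RInt_C_ext with (3 := hm); [lra |]. intros t _. cbv beta.
    now rewrite Cmult_1_l.
  - replace (4 * PI * Ci) with (2 * (2 * PI * Ci))
      by (replace (RtoC 4) with (2 * 2) by (rewrite <- RtoC_mult; f_equal; ring); ring).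
    set (P := 2 * PI * Ci) in *. set (H := h0 (a, b, c, d) q) in *. clearbody P H.
    set (T := 2 ^ n) in *. clearbody T. field. repeat split; assumption.
Qed.

Definition aw_pole (p : C) : Prop :=
  p = 0 \/ exists e k, In e [a; b; c; d] /\ (p = e * q ^ k \/ e * q ^ k * p = 1).

Lemma separating_same_int g : separates_poles g (a, b, c, d) q -> same_int g (circle 1) aw_integrand.
Proof.
  intros hg. pose proof circle_separates as hs.
  assert (hp : forall p, aw_pole p ->
    (encloses g p /\ encloses (circle 1) p) \/ (excludes g p /\ excludes (circle 1) p)).
  { destruct hg as [g0 ge], hs as [s0 se].
    intros p [-> | [e [k [he [-> | hk]]]]].
    - left. now split.
    - left. split; [apply (ge e he k) | apply (se e he k)].
    - right. split; [now apply (ge e he k) | now apply (se e he k)]. }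
  clear hs.
  assert (av1 : forall p, aw_pole p -> forall t, (0 <= t <= 1)%R -> path g t <> p).
  { intros p h. now destruct (hp p h) as [[[h1 _] _] | [[h1 _] _]]. }
  assert (av2 : forall p, aw_pole p -> forall t, (0 <= t <= 1)%R -> path (circle 1) t <> p).
  { intros p h. now destruct (hp p h) as [[_ [h1 _]] | [_ [h1 _]]]. }
  assert (hw : forall p, aw_pole p -> same_int g (circle 1) (fun z => / (z - p))).
  { intros p h. destruct (hp p h) as [[h1 h2] | [h1 h2]].
    - now apply encloses_same_int.
    - now apply excludes_same_int. }
  assert (p0 : aw_pole 0) by now left.
  (* The integrand is [f] times the kernel with c = 1; [f] is rational with 0 as its only pole,
     which is seen by induction on the exponent. *)
  set (f := fun z => / (4 * PI * Ci) * / z * / h0 (a, b, c, d) q * ((z + / z) / 2) ^ n).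
  apply (same_int_ext _ _ _ av1 av2) with (fun z => f z * kernel q 1 [a; b; c; d] [a; b; c; d] z).
  { intros z hz. rewrite aw_integrand_W. unfold f, kernel, W, theta. cbn [map qpochs_inf fold_right].
    unfold Cdiv. rewrite !Cinv_mult_total, Cmult_1_l.
    replace (/ RtoC 1) with (RtoC 1) by field. ring. }
  assert (cf : forall g', (forall p, aw_pole p -> forall t, (0 <= t <= 1)%R -> path g' t <> p) ->
    cont01 (fun t => f (path g' t))).
  { intros g' av t ht. pose proof (av 0 p0 t ht).
    pose proof (path_continuous g' t ht).
    apply (continuous_comp (path g') f); [assumption |]. unfold f. ccont; try assumption.
    apply RtoC_neq_0; lra. }
  apply (same_int_kernel q hq g (circle 1) aw_pole); try assumption; try (now apply cf).
  - intros e he k z hz. right. exists e, k. auto.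
  - intros e he k. right. exists e, k. auto.
  - unfold f. generalize n as m. intros m. induction m as [|m IH].
    + apply (ratl_ext _ _ _ av1 av2) with (2 := ratl_scal _ _ _ av1 av2
        (/ (4 * PI * Ci) * / h0 (a, b, c, d) q) _ (ratl_mult_inv _ _ _ av1 av2 _ 0 p0
          (ratl_1 _ _ _ av1 av2 hw))).
      intros z _. replace (z - 0) with z by ring. simpl. ring.
    + apply (ratl_ext _ _ _ av1 av2) with (2 := ratl_scal _ _ _ av1 av2 (/ 2) _
        (ratl_plus _ _ _ av1 av2 _ _ (ratl_mult_id _ _ _ av1 av2 _ IH)
          (ratl_mult_inv _ _ _ av1 av2 _ 0 p0 IH))).
      intros z _. replace (z - 0) with z by ring. rewrite Cpow_S. unfold Cdiv. ring.
Qed.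

Theorem aw_integral_value v : a <> 0 ->
  is_aw_integral q n (a, b, c, d) v <-> v = aw_sum q n (a, b, c, d).
Proof.
  intros ha0. split.
  - intros [g [hg hi]].
    destruct (separating_same_int g hg) as [u [h1 h2]].
    rewrite (is_RInt_C_unique _ _ _ _ _ hi h1).
    apply (is_RInt_C_unique _ _ _ _ _ h2 (circle_moment ha0)).
  - intros ->. exists (circle 1). split; [apply circle_separates | now apply circle_moment].
Qed.

End ContourValue.

(** * Goursat's lemma and the identity theorem *)

Section Goursat.

Variable H : C -> C.
Variables X0 X1 : R.
Hypothesis holo : forall z : C, (X0 <= fst z <= X1)%R -> exists l, cderiv H z l.

Definition hor (y x0 x1 : R) : C := RInt (V := C_R_CompleteNormedModule) (fun u => H (u, y)) x0 x1.
Definition ver (x y0 y1 : R) : C := RInt (V := C_R_CompleteNormedModule) (fun v => H (x, v)) y0 y1.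

Lemma continuous_hor y x : (X0 <= x <= X1)%R -> continuous (fun u : R => H (u, y)) x.
Proof.
  intros hx. destruct (holo (x, y) hx) as [l hl].
  apply (continuous_comp (fun u : R => (u, y) : C) H).
  - apply continuous_C_parts; simpl; [apply continuous_id | apply continuous_const].
  - eapply cderiv_continuous, hl.
Qed.

Lemma continuous_ver x y : (X0 <= x <= X1)%R -> continuous (fun v : R => H (x, v)) y.
Proof.
  intros hx. destruct (holo (x, y) hx) as [l hl].
  apply (continuous_comp (fun v : R => (x, v) : C) H).
  - apply continuous_C_parts; simpl; [apply continuous_const | apply continuous_id].
  - eapply cderiv_continuous, hl.
Qed.

Lemma hor_correct y x0 x1 : (X0 <= x0)%R -> (x0 <= x1)%R -> (x1 <= X1)%R ->
  is_RInt_C (fun u => H (u, y)) x0 x1 (hor y x0 x1).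
Proof.
  intros h1 h2 h3. apply (RInt_correct (V := C_R_CompleteNormedModule)).
  apply ex_RInt_C; [assumption |]. intros t ht. apply continuous_hor. lra.
Qed.

Lemma ver_correct x y0 y1 : (X0 <= x <= X1)%R -> (y0 <= y1)%R ->
  is_RInt_C (fun v => H (x, v)) y0 y1 (ver x y0 y1).
Proof.
  intros h1 h2. apply (RInt_correct (V := C_R_CompleteNormedModule)).
  apply ex_RInt_C; [assumption |]. intros t ht. now apply continuous_ver.
Qed.

(** The integral of H dz around the rectangle, counterclockwise, with dz = i dy on the vertical
    sides. *)
Definition boundary (x0 x1 y0 y1 : R) : C :=
  hor y0 x0 x1 - hor y1 x0 x1 + Ci * (ver x1 y0 y1 - ver x0 y0 y1).

Lemma hor_Chasles y x0 x1 x2 : (X0 <= x0)%R -> (x0 <= x1)%R -> (x1 <= x2)%R -> (x2 <= X1)%R ->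
  hor y x0 x2 = hor y x0 x1 + hor y x1 x2.
Proof.
  intros h1 h2 h3 h4. apply (is_RInt_C_unique (fun u => H (u, y)) x0 x2).
  - apply hor_correct; lra.
  - apply is_RInt_C_Chasles with x1; apply hor_correct; lra.
Qed.

Lemma ver_Chasles x y0 y1 y2 : (X0 <= x <= X1)%R -> (y0 <= y1)%R -> (y1 <= y2)%R ->
  ver x y0 y2 = ver x y0 y1 + ver x y1 y2.
Proof.
  intros h1 h2 h3. apply (is_RInt_C_unique (fun v => H (x, v)) y0 y2).
  - apply ver_correct; lra.
  - apply is_RInt_C_Chasles with y1; apply ver_correct; lra.
Qed.

Lemma boundary_quarters x0 xm x1 y0 ym y1 :
  (X0 <= x0)%R -> (x0 <= xm)%R -> (xm <= x1)%R -> (x1 <= X1)%R -> (y0 <= ym)%R -> (ym <= y1)%R ->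
  boundary x0 x1 y0 y1 = boundary x0 xm y0 ym + boundary xm x1 y0 ym
    + boundary x0 xm ym y1 + boundary xm x1 ym y1.
Proof.
  intros. unfold boundary.
  rewrite (hor_Chasles y0 x0 xm x1), (hor_Chasles y1 x0 xm x1) by lra.
  rewrite (ver_Chasles x0 y0 ym y1), (ver_Chasles x1 y0 ym y1) by lra. ring.
Qed.

(** Opposite sides are subtracted first. The affine approximation of H contributes a constant to
    each difference, and these two contributions cancel in [boundary]; the remaining integrands are
    at most 2 eps L, with L half the perimeter. *)
Lemma boundary_local (z : C) eps : (X0 <= fst z <= X1)%R -> (0 < eps)%R ->
  exists delta, (0 < delta)%R /\ forall x0 x1 y0 y1,
    (X0 <= x0)%R -> (x1 <= X1)%R -> (x0 <= fst z <= x1)%R -> (y0 <= snd z <= y1)%R ->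
    ((x1 - x0) + (y1 - y0) < delta)%R ->
    (Cmod (boundary x0 x1 y0 y1) <= 2 * eps * ((x1 - x0) + (y1 - y0)) ^ 2)%R.
Proof.
  intros hz he. destruct (holo z hz) as [l [phi [h1 [h2 h3]]]].
  apply (proj1 (continuous_C_eps phi z)) with (eps := eps) in h1; [| assumption].
  pose proof (filter_and _ _ h1 h3) as h. apply locally_C_Cmod in h.
  destruct h as [delta [hdelta hd]]. exists delta. split; [assumption |].
  intros x0 x1 y0 y1 k1 k2 kx ky hL. set (L := ((x1 - x0) + (y1 - y0))%R) in *.
  assert (est : forall x y, (x0 <= x <= x1)%R -> (y0 <= y <= y1)%R ->
    (Cmod (H (x, y) - (H z + l * ((x, y) - z))) <= eps * L)%R).
  { intros x y hx hy.
    assert (hdist : (Cmod ((x, y) - z) <= L)%R).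
    { eapply Rle_trans; [apply Cmod_le_sum |]. simpl.
      assert (Rabs (x + - fst z) <= x1 - x0)%R by (apply Rabs_le; lra).
      assert (Rabs (y + - snd z) <= y1 - y0)%R by (apply Rabs_le; lra).
      unfold L. lra. }
    destruct (hd (x, y) ltac:(lra)) as [e1 e2].
    replace (H (x, y) - (H z + l * ((x, y) - z)))
      with ((phi (x, y) - phi z) * ((x, y) - z)).
    - rewrite Cmod_mult. apply Rmult_le_compat; try apply Cmod_ge_0; lra.
    - replace (H (x, y)) with (H (x, y) - H z + H z) by ring. rewrite e2, h2. ring. }
  assert (hh : (Cmod (hor y0 x0 x1 - hor y1 x0 x1 - (x1 - x0)%R * (l * (0, (y0 - y1)%R)))
    <= (x1 - x0) * (2 * eps * L))%R).
  { apply (is_RInt_C_bound (fun u => H (u, y0) - H (u, y1) - l * (0, (y0 - y1)%R))).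
    - lra.
    - intros u hu. pose proof (est u y0 hu ltac:(lra)) as b0. pose proof (est u y1 hu ltac:(lra)) as b1.
      replace (H (u, y0) - H (u, y1) - l * (0, (y0 - y1)%R))
        with ((H (u, y0) - (H z + l * ((u, y0) - z))) - (H (u, y1) - (H z + l * ((u, y1) - z)))).
      + unfold Cminus at 1. eapply Rle_trans; [apply Cmod_triangle |]. rewrite Cmod_opp. lra.
      + replace ((0, (y0 - y1)%R) : C) with (((u, y0) : C) - (u, y1)) by (apply C_eq; simpl; ring).
        ring.
    - apply is_RInt_C_minus; [apply is_RInt_C_minus; apply hor_correct; lra | apply is_RInt_C_const]. }
  assert (hv : (Cmod (ver x1 y0 y1 - ver x0 y0 y1 - (y1 - y0)%R * (l * ((x1 - x0)%R : C)))
    <= (y1 - y0) * (2 * eps * L))%R).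
  { apply (is_RInt_C_bound (fun v => H (x1, v) - H (x0, v) - l * ((x1 - x0)%R : C))).
    - lra.
    - intros v hv. pose proof (est x0 v ltac:(lra) hv) as b0. pose proof (est x1 v ltac:(lra) hv) as b1.
      replace (H (x1, v) - H (x0, v) - l * ((x1 - x0)%R : C))
        with ((H (x1, v) - (H z + l * ((x1, v) - z))) - (H (x0, v) - (H z + l * ((x0, v) - z)))).
      + unfold Cminus at 1. eapply Rle_trans; [apply Cmod_triangle |]. rewrite Cmod_opp. lra.
      + replace ((x1 - x0)%R : C) with (((x1, v) : C) - (x0, v)) by (apply C_eq; simpl; ring).
        ring.
    - apply is_RInt_C_minus; [apply is_RInt_C_minus; apply ver_correct; lra | apply is_RInt_C_const]. }
  replace (boundary x0 x1 y0 y1)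
    with ((hor y0 x0 x1 - hor y1 x0 x1 - (x1 - x0)%R * (l * (0, (y0 - y1)%R)))
      + Ci * (ver x1 y0 y1 - ver x0 y0 y1 - (y1 - y0)%R * (l * ((x1 - x0)%R : C)))).
  - eapply Rle_trans; [apply Cmod_triangle |]. rewrite Cmod_mult, Cmod_Ci, Rmult_1_l.
    replace (2 * eps * L ^ 2)%R with ((x1 - x0) * (2 * eps * L) + (y1 - y0) * (2 * eps * L))%R
      by (unfold L; ring). lra.
  - unfold boundary. replace ((0, (y0 - y1)%R) : C) with (Ci * (y0 - y1)%R) by (apply C_eq; simpl; ring).
    rewrite !RtoC_minus. ring.
Qed.

Record rect : Type := Rect { rx0 : R; rx1 : R; ry0 : R; ry1 : R }.

Definition half_perimeter (r : rect) : R := (rx1 r - rx0 r + (ry1 r - ry0 r))%R.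

(** The bound scales with the square of the half perimeter so that the defect is inherited: quarters
    have half the size, and one of the four boundary integrals exceeds a quarter of the bound. *)
Definition bad (c : R) (r : rect) : Prop :=
  (X0 <= rx0 r)%R /\ (rx0 r <= rx1 r)%R /\ (rx1 r <= X1)%R /\ (ry0 r <= ry1 r)%R /\
  (c * half_perimeter r ^ 2 < Cmod (boundary (rx0 r) (rx1 r) (ry0 r) (ry1 r)))%R.

Definition quarter (r s : rect) : Prop :=
  (rx0 r <= rx0 s)%R /\ (rx1 s <= rx1 r)%R /\ (ry0 r <= ry0 s)%R /\ (ry1 s <= ry1 r)%R /\
  half_perimeter s = (half_perimeter r / 2)%R.

Lemma bad_quarter c r : bad c r -> exists s, quarter r s /\ bad c s.
Proof.
  destruct r as [x0 x1 y0 y1]. unfold bad, quarter, half_perimeter; simpl.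
  intros [h1 [h2 [h3 [h4 h5]]]]. set (xm := ((x0 + x1) / 2)%R). set (ym := ((y0 + y1) / 2)%R).
  assert (hxm : (x1 - xm = (x1 - x0) / 2 /\ xm - x0 = (x1 - x0) / 2)%R) by (unfold xm; lra).
  assert (hym : (y1 - ym = (y1 - y0) / 2 /\ ym - y0 = (y1 - y0) / 2)%R) by (unfold ym; lra).
  set (L := (x1 - x0 + (y1 - y0))%R) in *.
  rewrite (boundary_quarters x0 xm x1 y0 ym y1) in h5 by lra.
  assert (ht : forall u v w t : C,
    (Cmod (u + v + w + t) <= Cmod u + Cmod v + Cmod w + Cmod t)%R).
  { intros u v w t. pose proof (Cmod_triangle (u + v + w) t).
    pose proof (Cmod_triangle (u + v) w). pose proof (Cmod_triangle u v). lra. }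
  pose proof (ht (boundary x0 xm y0 ym) (boundary xm x1 y0 ym) (boundary x0 xm ym y1)
    (boundary xm x1 ym y1)) as hsum.
  assert (hc : forall a b a' b', (b - a + (b' - a') = L / 2)%R ->
    (c * ((b - a + (b' - a')) * ((b - a + (b' - a')) * 1)) = c * (L * (L * 1)) / 4)%R).
  { intros a b a' b' ->. field. }
  destruct (Rlt_dec (c * (L * (L * 1)) / 4) (Cmod (boundary x0 xm y0 ym))) as [k1 | k1].
  { exists (Rect x0 xm y0 ym); simpl. rewrite hc by (unfold L; lra).
    repeat split; try lra; unfold L; lra. }
  destruct (Rlt_dec (c * (L * (L * 1)) / 4) (Cmod (boundary xm x1 y0 ym))) as [k2 | k2].
  { exists (Rect xm x1 y0 ym); simpl. rewrite hc by (unfold L; lra).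
    repeat split; try lra; unfold L; lra. }
  destruct (Rlt_dec (c * (L * (L * 1)) / 4) (Cmod (boundary x0 xm ym y1))) as [k3 | k3].
  { exists (Rect x0 xm ym y1); simpl. rewrite hc by (unfold L; lra).
    repeat split; try lra; unfold L; lra. }
  exists (Rect xm x1 ym y1); simpl. rewrite hc by (unfold L; lra).
  repeat split; try lra; unfold L; lra.
Qed.

Lemma nested_point (lo hi : nat -> R) :
  (forall n, (lo n <= lo (S n))%R) -> (forall n, (hi (S n) <= hi n)%R) -> (forall n, (lo n <= hi n)%R) ->
  exists x, forall n, (lo n <= x <= hi n)%R.
Proof.
  intros h1 h2 h3.
  assert (ml : forall n m, (n <= m)%nat -> (lo n <= lo m)%R).
  { intros n m hnm; induction hnm as [|m hnm IH]; [lra |]. specialize (h1 m). lra. }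
  assert (mh : forall n m, (n <= m)%nat -> (hi m <= hi n)%R).
  { intros n m hnm; induction hnm as [|m hnm IH]; [lra |]. specialize (h2 m). lra. }
  assert (lh : forall n m, (lo n <= hi m)%R).
  { intros n m. specialize (ml n (max n m) ltac:(lia)). specialize (mh m (max n m) ltac:(lia)).
    specialize (h3 (max n m)). lra. }
  destruct (completeness (fun x => exists n, x = lo n)) as [x [hx1 hx2]].
  - exists (hi O). intros x [n ->]. apply lh.
  - exists (lo O). now exists O.
  - exists x. intros n. split; [apply hx1; now exists n |].
    apply hx2. intros y [m ->]. apply lh.
Qed.

Lemma boundary_small c r : (0 < c)%R -> ~ bad c r.
Proof.
  intros hc hbad.
  assert (hnext : forall s, exists s', bad c s -> quarter s s' /\ bad c s').
  { intros s. destruct (classic (bad c s)) as [h | h].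
    - destruct (bad_quarter c s h) as [s' hs']. now exists s'.
    - exists s. intros; contradiction. }
  set (next := fun s => proj1_sig (constructive_indefinite_description _ (hnext s))).
  assert (hn : forall s, bad c s -> quarter s (next s) /\ bad c (next s)).
  { intros s. unfold next. now destruct constructive_indefinite_description. }
  set (R := fun n => Nat.iter n next r).
  assert (hb : forall n, bad c (R n)).
  { induction n as [|n IH]; [exact hbad | apply (hn _ IH)]. }
  assert (hqr : forall n, quarter (R n) (R (S n))) by (intros n; apply (hn _ (hb n))).
  assert (hL : forall n, half_perimeter (R n) = (half_perimeter r * (/ 2) ^ n)%R).
  { induction n as [|n IH]; [simpl; ring |].
    destruct (hqr n) as [_ [_ [_ [_ e]]]]. rewrite e, IH. simpl. field. }
  destruct (nested_point (fun n => rx0 (R n)) (fun n => rx1 (R n))) as [x hx].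
  1, 2 : intros n; apply (hqr n). { intros n; apply (hb n). }
  destruct (nested_point (fun n => ry0 (R n)) (fun n => ry1 (R n))) as [y hy].
  1, 2 : intros n; apply (hqr n). { intros n; apply (hb n). }
  (* The local estimate then reads 2 (c / 4) L^2 = c L^2 / 2, against the lower bound c L^2 of a bad
     rectangle. *)
  destruct (boundary_local (x, y) (c / 4)) as [delta [hd hest]].
  { simpl. specialize (hx O). destruct (hb O) as [k1 [_ [k2 _]]]. lra. }
  { lra. }
  destruct (pow_lt_1_zero (/ 2)) with (y := (delta / (Rabs (half_perimeter r) + 1))%R) as [N hN].
  { rewrite Rabs_pos_eq; lra. }
  { apply Rdiv_lt_0_compat; [assumption |]. pose proof (Rabs_pos (half_perimeter r)). lra. }
  specialize (hN N (Nat.le_refl _)). destruct (hb N) as [k1 [k2 [k3 [k4 k5]]]].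
  assert (hsmall : (half_perimeter (R N) < delta)%R).
  { rewrite hL. pose proof (Rle_abs (half_perimeter r)). pose proof (Rabs_pos (half_perimeter r)).
    assert (hp : (0 < (/ 2) ^ N)%R) by (apply pow_lt; lra). rewrite Rabs_pos_eq in hN by lra.
    apply Rle_lt_trans with ((Rabs (half_perimeter r) + 1) * (/ 2) ^ N)%R; [nra |].
    apply Rlt_le_trans with ((Rabs (half_perimeter r) + 1) * (delta / (Rabs (half_perimeter r) + 1)))%R.
    - apply Rmult_lt_compat_l; lra.
    - right; field; lra. }
  specialize (hest (rx0 (R N)) (rx1 (R N)) (ry0 (R N)) (ry1 (R N)) k1 k3 (hx N) (hy N) hsmall).
  change (rx1 (R N) - rx0 (R N) + (ry1 (R N) - ry0 (R N)))%R with (half_perimeter (R N)) in hest.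
 nra.
Qed.

Lemma goursat x0 x1 y0 y1 : (X0 <= x0)%R -> (x0 <= x1)%R -> (x1 <= X1)%R -> (y0 <= y1)%R ->
  boundary x0 x1 y0 y1 = 0.
Proof.
  intros h1 h2 h3 h4. apply Cmod_eq_0. apply Rle_antisym; [| apply Cmod_ge_0].
  apply le_epsilon. intros eps he. rewrite Rplus_0_l.
  set (r := Rect x0 x1 y0 y1). set (L := half_perimeter r).
  assert (hL : (0 < L ^ 2 + 1)%R) by (pose proof (pow2_ge_0 L); lra).
  assert (hc : (0 < eps / (L ^ 2 + 1))%R) by now apply Rdiv_lt_0_compat.
  apply Rnot_lt_le. intros hlt. apply (boundary_small _ r hc).
  unfold bad; simpl rx0; simpl rx1; simpl ry0; simpl ry1. repeat split; try assumption.
  fold L. apply Rle_lt_trans with (2 := hlt).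
  apply Rle_trans with (eps / (L ^ 2 + 1) * (L ^ 2 + 1))%R.
  - apply Rmult_le_compat_l; lra.
  - right; field; lra.
Qed.

(** With period i the integrals over the two horizontal sides cancel in Goursat's lemma. *)
Lemma vertical_means_equal : (forall x y, H (x, y + 1)%R = H (x, y)) -> (X0 <= X1)%R ->
  ver X0 0 1 = ver X1 0 1.
Proof.
  intros hp hX. pose proof (goursat X0 X1 0 1 (Rle_refl _) hX (Rle_refl _) Rle_0_1) as h.
  unfold boundary in h.
  assert (e : hor 1 X0 X1 = hor 0 X0 X1).
  { unfold hor. apply (RInt_ext (V := C_R_CompleteNormedModule)). intros u _.
    rewrite <- (Rplus_0_l 1) at 1. apply hp. }
  rewrite e in h.
  assert (h' : Ci * (ver X1 0 1 - ver X0 0 1) = 0) by (rewrite <- h; ring).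
  apply (f_equal (fun u => Ci * u)) in h'.
  replace (ver X0 0 1) with (ver X1 0 1 + Ci * (Ci * (ver X1 0 1 - ver X0 0 1))).
  - rewrite h'. ring.
  - assert (i2 : Ci * Ci = - (1)) by (apply C_eq; simpl; ring).
    rewrite Cmult_assoc, i2. ring.
Qed.

End Goursat.

(** * Holomorphic functions on annuli and discs *)

(** The map exp (2 pi z): vertical segments of length 1 become full circles, and a strip becomes an
    annulus. *)
Definition ez (z : C) : C := exp (2 * PI * fst z) * cis (snd z).

(** The increment is P dx + Q dy with P -> l and Q -> i l. This Cauchy-Riemann relation makes the
    quotient by dx + i dy tend to l. *)
Lemma cderiv_ez z : cderiv ez z (2 * PI * ez z).
Proof.
  set (l := 2 * PI * ez z).
  set (A := rquot (fun s => RtoC (exp (2 * PI * s))) (fst z) (RtoC (2 * PI * exp (2 * PI * fst z)))).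
  set (B := rquot cis (snd z) (2 * PI * Ci * cis (snd z))).
  assert (cA : continuous A (fst z)).
  { apply continuous_rquot, is_derive_RC_parts; simpl; auto_derive; trivial; ring. }
  assert (cB : continuous B (snd z)) by apply continuous_rquot, is_derive_cis.
  assert (A0 : A (fst z) = RtoC (2 * PI * exp (2 * PI * fst z))) by apply rquot_at.
  assert (B0 : B (snd z) = 2 * PI * Ci * cis (snd z)) by apply rquot_at.
  set (P := fun w : C => A (fst w) * cis (snd w)).
  set (Q := fun w : C => exp (2 * PI * fst z) * B (snd w)).
  assert (cf : continuous (fun w : C => fst w) z) by (destruct z; apply continuous_fst).
  assert (cs : continuous (fun w : C => snd w) z) by (destruct z; apply continuous_snd).
  assert (cP : continuous P z).
  { apply continuous_Cmult.
    - now apply (continuous_comp (fun w : C => fst w) A).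
    - apply (continuous_comp (fun w : C => snd w) cis); [assumption | apply continuous_cis]. }
  assert (cQ : continuous Q z).
  { apply continuous_Cmult; [apply continuous_const |].
    now apply (continuous_comp (fun w : C => snd w) B). }
  assert (eP : P z = l).
  { unfold P, l, ez. rewrite A0, !RtoC_mult. ring. }
  assert (eQ : Q z = Ci * l).
  { unfold Q, l, ez. rewrite B0. ring. }
  assert (D : forall w, ez w - ez z
    = P w * (fst w - fst z)%R + Q w * (snd w - snd z)%R).
  { intros w. unfold P, Q, ez.
    pose proof (rquot_eq (fun s => RtoC (exp (2 * PI * s))) (fst z)
      (RtoC (2 * PI * exp (2 * PI * fst z))) (fst w)) as e1. fold A in e1.
    pose proof (rquot_eq cis (snd z) (2 * PI * Ci * cis (snd z)) (snd w)) as e2. fold B in e2.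
    cbv beta in e1.
    transitivity ((exp (2 * PI * fst w) - exp (2 * PI * fst z)) * cis (snd w)
      + exp (2 * PI * fst z) * (cis (snd w) - cis (snd z))); [ring |].
    rewrite e1, e2. ring. }
  exists (dquot ez z l). refine (conj _ (conj _ _)).
  - apply continuous_C_eps. intros eps he.
    rewrite continuous_C_eps in cP, cQ.
    pose proof (cP (eps / 2)%R ltac:(lra)) as cP'. pose proof (cQ (eps / 2)%R ltac:(lra)) as cQ'.
    generalize (filter_and _ _ cP' cQ'). apply filter_imp. intros w [k1 k2].
    rewrite eP in k1. rewrite eQ in k2.
    pose proof (dquot_at ez z l) as e0.
    rewrite e0. destruct (classic (w = z)) as [-> | hne].
    + rewrite e0. replace (l - l) with (RtoC 0) by ring. rewrite Cmod_0. assumption.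
    + rewrite dquot_neq, D by assumption. pose proof (Cminus_neq_0 _ _ hne) as hd.
      assert (hdec : w - z = (fst w - fst z)%R + Ci * (snd w - snd z)%R)
        by (apply C_eq; simpl; ring).
      set (x := (fst w - fst z)%R) in *. set (y := (snd w - snd z)%R) in *.
      assert (hx : (Rabs x <= Cmod (w - z))%R) by apply (re_le_Cmod (w - z)).
      assert (hy : (Rabs y <= Cmod (w - z))%R) by apply (im_le_Cmod (w - z)).
      replace ((P w * x + Q w * y) / (w - z) - l)
        with (((P w - l) * x + (Q w - Ci * l) * y) / (w - z)).
      2: { replace l with (l * (w - z) / (w - z)) at 3 by (field; assumption).
           rewrite hdec at 3. unfold Cdiv. ring. }
      rewrite Cmod_div by assumption. apply (proj1 (Cmod_gt_0 _)) in hd.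
      apply Rmult_lt_reg_r with (Cmod (w - z)); [assumption |].
      unfold Rdiv. rewrite Rmult_assoc, Rinv_l, Rmult_1_r by lra.
      eapply Rle_lt_trans; [apply Cmod_triangle |]. rewrite !Cmod_mult, !Cmod_R.
      pose proof (Cmod_ge_0 (P w - l)). pose proof (Cmod_ge_0 (Q w - Ci * l)). nra.
  - apply dquot_at.
  - apply filter_forall. intros w. apply dquot_eq.
Qed.

Lemma Cmod_scal_cis (r : R) t : (0 < r)%R -> Cmod (r * cis t) = r.
Proof. intros h. rewrite Cmod_mult, Cmod_cis, Cmod_R, Rabs_pos_eq; lra. Qed.

Lemma cis_plus_1 t : cis (t + 1) = cis t.
Proof.
  unfold cis. replace (2 * PI * (t + 1))%R with (2 * PI * t + 2 * PI)%R by ring.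
  rewrite cos_plus, sin_plus, cos_2PI, sin_2PI. apply C_eq; simpl; ring.
Qed.

Lemma annulus_mean (K : C -> C) (r s : R) v :
  (0 < r)%R -> (r <= s)%R ->
  (forall z, (r <= Cmod z <= s)%R -> exists l, cderiv K z l) ->
  is_RInt_C (fun t => K (r * cis t)) 0 1 v <-> is_RInt_C (fun t => K (s * cis t)) 0 1 v.
Proof.
  intros hr hrs hK.
  set (x0 := (ln r / (2 * PI))%R). set (x1 := (ln s / (2 * PI))%R).
  pose proof PI_RGT_0 as hpi.
  assert (e0 : exp (2 * PI * x0) = r).
  { unfold x0. replace (2 * PI * (ln r / (2 * PI)))%R with (ln r) by (field; lra). now apply exp_ln. }
  assert (e1 : exp (2 * PI * x1) = s).
  { unfold x1. replace (2 * PI * (ln s / (2 * PI)))%R with (ln s) by (field; lra). apply exp_ln; lra. }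
  assert (hx : (x0 <= x1)%R).
  { unfold x0, x1, Rdiv. apply Rmult_le_compat_r; [left; apply Rinv_0_lt_compat; lra |].
    destruct hrs as [hrs | ->]; [left; now apply ln_increasing | right; reflexivity]. }
  set (H := fun z => K (ez z)).
  assert (holo : forall z : C, (x0 <= fst z <= x1)%R -> exists l, cderiv H z l).
  { intros z hz. destruct (hK (ez z)) as [l hl].
    - unfold ez. rewrite Cmod_scal_cis by apply exp_pos. rewrite <- e0, <- e1.
      assert (mono : forall u v, (u <= v)%R -> (exp u <= exp v)%R).
      { intros u u' [h | ->]; [left; now apply exp_increasing | right; reflexivity]. }
      split; apply mono; apply Rmult_le_compat_l; lra.
    - exists (l * (2 * PI * ez z)). apply (cderiv_comp K ez); [apply cderiv_ez | assumption]. }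
  pose proof (vertical_means_equal H x0 x1 holo) as hv.
  assert (hp : forall x y, H (x, (y + 1)%R) = H (x, y)).
  { intros x y. unfold H, ez; simpl. now rewrite cis_plus_1. }
  specialize (hv hp hx).
  pose proof (ver_correct H x0 x1 holo x0 0 1 ltac:(lra) ltac:(lra)) as c0.
  pose proof (ver_correct H x0 x1 holo x1 0 1 ltac:(lra) ltac:(lra)) as c1.
  assert (f0 : is_RInt_C (fun t => K (r * cis t)) 0 1 (ver H x0 0 1)).
  { apply is_RInt_C_ext with (3 := c0); [lra |]. intros t _. unfold H, ez; simpl. now rewrite e0. }
  assert (f1 : is_RInt_C (fun t => K (s * cis t)) 0 1 (ver H x1 0 1)).
  { apply is_RInt_C_ext with (3 := c1); [lra |]. intros t _. unfold H, ez; simpl. now rewrite e1. }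
  rewrite hv in f0. split; intros hi.
  - now rewrite (is_RInt_C_unique _ _ _ _ _ hi f0).
  - now rewrite (is_RInt_C_unique _ _ _ _ _ hi f1).
Qed.

(** Continuity gives for each angle a margin in angle and radius; compactness of [0, 1] yields a
    common margin for the radius. *)
Lemma unif_cv_circles (K : C -> C) (rho : R) (r : nat -> R) :
  (0 < rho)%R -> (forall t, continuous K (rho * cis t)) ->
  (forall eps, (0 < eps)%R -> exists N, forall n, (N <= n)%nat -> (Rabs (r n - rho) < eps)%R) ->
  unif_cv (fun n t => K (r n * cis t)) (fun t => K (rho * cis t)).
Proof.
  intros hrho hK hr eps he.
  assert (hloc : forall t, exists d : posreal, forall t' r', (Rabs (t' - t) < d)%R ->
    (Rabs (r' - rho) < d)%R -> (Cmod (K (r' * cis t')%C - K (rho * cis t')%C) < eps)%R).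
  { intros t. pose proof (hK t) as h. rewrite continuous_C_eps in h.
    specialize (h (eps / 2)%R ltac:(lra)). apply locally_C_Cmod in h. destruct h as [d1 [hd1 h]].
    pose proof (continuous_cis t) as hc. rewrite continuous_C_eps in hc.
    destruct (hc (d1 / 2 / rho)%R) as [d2 hd2]; [repeat apply Rdiv_lt_0_compat; lra |].
    assert (hd : (0 < Rmin d2 (d1 / 2))%R) by (apply Rmin_glb_lt; [apply cond_pos | lra]).
    exists (mkposreal _ hd). simpl. intros t' r' ht hr'.
    apply Rmin_Rgt_l in ht, hr'. destruct ht as [ht _], hr' as [_ hr'].
    specialize (hd2 t' ht). cbv beta in hd2.
    assert (b : (Cmod (rho * cis t' - rho * cis t) < d1 / 2)%R).
    { replace (rho * cis t' - rho * cis t) with (rho * (cis t' - cis t)) by ring.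
      rewrite Cmod_mult, Cmod_R, Rabs_pos_eq by lra.
      apply Rlt_le_trans with (rho * (d1 / 2 / rho))%R.
      - now apply Rmult_lt_compat_l.
      - right; field; lra. }
    assert (b' : (Cmod (r' * cis t' - rho * cis t') < d1 / 2)%R).
    { replace (r' * cis t' - rho * cis t') with ((r' - rho)%R * cis t') by (rewrite RtoC_minus; ring).
      rewrite Cmod_mult, Cmod_cis, Cmod_R. lra. }
    pose proof (h (rho * cis t') ltac:(lra)) as k1.
    pose proof (h (r' * cis t')) as k2.
    assert (Cmod (r' * cis t' - rho * cis t) < d1)%R.
    { eapply Rle_lt_trans; [apply (Cmod_triangle_sub _ (rho * cis t')) |]. lra. }
    specialize (k2 H). eapply Rle_lt_trans; [apply (Cmod_triangle_sub _ (K (rho * cis t))) |].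
    rewrite (Cmod_dist_sym (K (rho * cis t))). lra. }
  set (delta := fun t => proj1_sig (constructive_indefinite_description _ (hloc t))).
  assert (hdelta : forall t t' r', (Rabs (t' - t) < delta t)%R ->
    (Rabs (r' - rho) < delta t)%R -> (Cmod (K (r' * cis t')%C - K (rho * cis t')%C) < eps)%R).
  { intros t. unfold delta. destruct constructive_indefinite_description; simpl. assumption. }
  destruct (compactness_value_1d 0 1 delta) as [d hd].
  destruct (hr d (cond_pos d)) as [N hN]. exists N. intros n hn t ht.
  destruct (NNPP _ (hd t ht)) as [t0 [_ [h1 h2]]].
  apply (hdelta t0); [assumption |]. specialize (hN n hn). lra.
Qed.

Lemma shrink_lim (rho sgn : R) : (0 < rho)%R -> (Rabs sgn <= 1)%R ->
  forall eps, (0 < eps)%R -> exists N, forall n, (N <= n)%nat ->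
    (Rabs (rho * (1 + sgn / (INR n + 2)) - rho) < eps)%R.
Proof.
  intros hrho hs eps he.
  destruct (nfloor_ex (rho / eps)) as [N [_ hN]]; [left; now apply Rdiv_lt_0_compat |].
  exists N. intros n hn. apply le_INR in hn. pose proof (pos_INR n).
  replace (rho * (1 + sgn / (INR n + 2)) - rho)%R with (rho * sgn / (INR n + 2))%R by (field; lra).
  unfold Rdiv. rewrite !Rabs_mult, (Rabs_pos_eq rho), (Rabs_pos_eq (/ (INR n + 2)))
    by (try left; try apply Rinv_0_lt_compat; lra).
  apply Rmult_lt_reg_r with (INR n + 2)%R; [lra |]. rewrite Rmult_assoc, Rinv_l, Rmult_1_r by lra.
  apply Rle_lt_trans with (rho * 1)%R; [apply Rmult_le_compat_l; lra |].
  apply (Rmult_lt_compat_r eps) in hN; [| assumption].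
  unfold Rdiv in hN. rewrite Rmult_assoc, Rinv_l in hN by lra. nra.
Qed.

Section Identity.

Variables (h : C -> C) (Rad delta : R).
Hypothesis hdelta : (0 < delta)%R.
Hypothesis holo : forall z, (Cmod z < Rad)%R -> exists l, cderiv h z l.
Hypothesis vanish : forall z, (Cmod z < delta)%R -> h z = 0.

(* Cauchy's formula for h(z) z^-k: the mean over |z| = s of z (g(z) - g(w)) / (z - w), where
   g(z) = h(z) z^-k, does not depend on s and is 0 for small s because h vanishes there. At
   s = |w| one only has continuity in s. *)
Lemma cauchy_power_bound (w : C) k : (0 < Cmod w < Rad)%R ->
  forall r M, (Cmod w < r < Rad)%R ->
  (forall t, (0 <= t <= 1)%R -> (Cmod (h (r * cis t)%C) <= M)%R) ->
  (Cmod (h w) <= M * (r / (r - Cmod w)) * (Cmod w / r) ^ k)%R.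
Proof.
  intros [hw0 hwR] r M hr hM. set (rho := Cmod w) in *.
  assert (hwn : w <> 0) by (apply Cmod_gt_0; exact hw0).
  set (g := fun z => h z * (/ z) ^ k).
  assert (hg : forall z, (0 < Cmod z < Rad)%R -> exists l, cderiv g z l).
  { intros z [z0 zR]. destruct (holo z zR) as [l hl].
    assert (hz : z <> 0) by now apply Cmod_gt_0.
    assert (hi : exists m, cderiv (fun z => (/ z) ^ k) z m).
    { destruct k as [|k'].
      - exists 0. apply (cderiv_const 1).
      - eexists. apply (cderiv_pow (fun z => / z)).
        apply (cderiv_inv (fun z => z)); [apply cderiv_id | assumption]. }
    destruct hi as [m hm]. eexists. apply (cderiv_mult h (fun z => (/ z) ^ k)); eassumption. }
  destruct (hg w ltac:(fold rho; lra)) as [l hl].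
  set (K := fun z => z * dquot g w l z).
  assert (hKd : forall z, z <> w -> (0 < Cmod z < Rad)%R -> exists m, cderiv K z m).
  { intros z hne hz. destruct (hg z hz) as [m hm].
    assert (hq : exists m', cderiv (fun z => (g z + - g w) * / (z - w)) z m').
    { eexists. apply (cderiv_mult (fun z => g z + - g w) (fun z => / (z - w))).
      - apply (cderiv_plus g (fun _ => - g w)); [exact hm | apply cderiv_const].
      - apply (cderiv_inv (fun z => z - w)); [apply cderiv_sub_const | now apply Cminus_neq_0]. }
    destruct hq as [m' hm']. eexists. apply (cderiv_mult (fun z => z) (dquot g w l)); [apply cderiv_id |].
    eapply cderiv_ext_loc; [| exact hm'].
    assert (hloc : locally z (fun y : C => y - w <> 0)).
    { apply (continuous_C_neq_0 (fun y : C => y - w)); [ccont | now apply Cminus_neq_0]. }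
    revert hloc; apply filter_imp. intros y hy. rewrite dquot_neq; [reflexivity |].
    intros ->. apply hy. ring. }
  assert (hKc : forall z, (0 < Cmod z < Rad)%R -> continuous K z).
  { intros z hz. destruct (classic (z = w)) as [-> | hne].
    - apply (continuous_Cmult (fun z : C => z) (dquot g w l));
        [apply continuous_id | now apply continuous_dquot].
    - destruct (hKd z hne hz) as [m hm]. eapply cderiv_continuous, hm. }
  assert (hKcirc : forall s : R, (0 < s < Rad)%R -> cont01 (fun t => K (s * cis t))).
  { intros s hs t _. apply (continuous_comp (fun t : R => s * cis t) K).
    - ccont. apply continuous_cis.
    - apply hKc. rewrite Cmod_scal_cis; lra. }
  assert (hmean : forall s v : R, (0 < s)%R -> (s <= v)%R -> (v < Rad)%R ->
    (v < rho \/ rho < s)%R -> forall J, is_RInt_C (fun t => K (s * cis t)) 0 1 J <->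
    is_RInt_C (fun t => K (v * cis t)) 0 1 J).
  { intros s v h1 h2 h3 h4 J. apply annulus_mean; try assumption.
    intros z hz. apply hKd; [| lra]. intros ->. fold rho in hz. lra. }
  set (r0 := (Rmin delta rho / 2)%R).
  assert (hr0 : (0 < r0 /\ r0 < delta /\ r0 < rho)%R).
  { assert (0 < Rmin delta rho)%R by (apply Rmin_glb_lt; lra).
    pose proof (Rmin_l delta rho). pose proof (Rmin_r delta rho). unfold r0. lra. }
  assert (kern : forall s : R, (0 < s)%R -> s <> rho -> forall t, s * cis t * (/ (s * cis t - w))
    = cis t / (cis t - w / s)).
  { intros s hs hsr t. assert (hs0 : RtoC s <> 0) by (apply RtoC_neq_0; lra).
    rewrite circle_kernel_eq, Cinv_mult_total by assumption. unfold Cdiv.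
    transitivity (s * / s * (cis t * / (cis t - w * / s))); [ring |]. rewrite Cinv_r by assumption. ring. }
  assert (circ_ne : forall s t, (0 < s)%R -> s <> rho -> RtoC s * cis t <> w).
  { intros s t hs hsr e. apply hsr. unfold rho. rewrite <- e. now rewrite Cmod_scal_cis. }
  (* On the small circle g = 0, so K z = -g(w) z / (z - w), and w lies outside. *)
  assert (hJ0 : is_RInt_C (fun t => K (r0 * cis t)) 0 1 (RtoC 0)).
  { assert (hout : (1 < Cmod (w / r0))%R).
    { rewrite Cmod_div by (apply RtoC_neq_0; lra). rewrite Cmod_R, Rabs_pos_eq by lra. fold rho.
      apply Rmult_lt_reg_r with r0; [lra |]. unfold Rdiv. rewrite Rmult_assoc, Rinv_l; lra. }
    pose proof (is_RInt_C_scal _ _ _ (- g w) _ (mean_kernel_outside _ hout)) as hk.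
    replace (- g w * 0) with (RtoC 0) in hk by ring.
    apply is_RInt_C_ext with (3 := hk); [lra |]. intros t _.
    rewrite <- kern by lra. unfold K. rewrite dquot_neq by (apply circ_ne; lra).
    assert (gz : g (r0 * cis t) = 0).
    { unfold g. rewrite vanish; [ring |]. rewrite Cmod_scal_cis; lra. }
    rewrite gz. unfold Cdiv. ring. }
  assert (hlim : forall (m : nat -> R) (J : C),
    (forall eps, (0 < eps)%R -> exists N, forall n, (N <= n)%nat -> (Rabs (m n - rho) < eps)%R) ->
    (forall n, is_RInt_C (fun t => K (m n * cis t)) 0 1 J) ->
    is_RInt_C (fun t => K (rho * cis t)) 0 1 J).
  { intros m J hm hi.
    destruct (is_RInt_unif_cv (fun n t => K (m n * cis t)) (fun t => K (rho * cis t)) (fun _ => J))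
      as [J' [k1 k2]]; [| exact hi |].
    - apply unif_cv_circles; [lra | | exact hm].
      intros t. apply hKc. rewrite Cmod_scal_cis; lra.
    - rewrite (filterlim_C_unique (fun _ => J) J J') by (assumption || apply filterlim_const).
      exact k2. }
  assert (hfrac : forall n, (0 < / (INR n + 2))%R).
  { intros n. pose proof (pos_INR n). apply Rinv_0_lt_compat; lra. }
  assert (hJrho : is_RInt_C (fun t => K (rho * cis t)) 0 1 (RtoC 0)).
  (* Radii tending to rho from below; the maximum with [r0] keeps them at or above the circle on
     which the mean is already known. *)
  { set (m := fun n => Rmax r0 (rho * (1 + (-1) / (INR n + 2)))%R).
    assert (hm : forall n, (r0 <= m n < rho)%R).
    { intros n. split; [apply Rmax_l |]. apply Rmax_lub_lt; [lra |].
      specialize (hfrac n). unfold Rdiv. nra. }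
    apply (hlim m).
    - intros eps he. destruct (shrink_lim rho (-1) hw0) with (eps := eps) as [N hN]; [| assumption |].
      { rewrite Rabs_left; lra. }
      exists N. intros n hn. specialize (hN n hn). specialize (hm n).
      unfold m in *. pose proof (Rmax_r r0 (rho * (1 + -1 / (INR n + 2)))).
      rewrite Rabs_left1 by lra. rewrite Rabs_left1 in hN by lra. lra.
    - intros n. specialize (hm n). apply (hmean r0 (m n)); try lra. exact hJ0. }
  destruct (ex_RInt_C (fun t => K (r * cis t)) 0 1) as [J1 hJ1]; [lra | apply hKcirc; lra |].
  assert (hJ1z : J1 = RtoC 0).
  { set (m := fun n => Rmin r (rho * (1 + 1 / (INR n + 2)))%R).
    assert (hm : forall n, (rho < m n <= r)%R).
    { intros n. split; [| apply Rmin_l]. apply Rmin_glb_lt; [lra |].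
      specialize (hfrac n). unfold Rdiv. nra. }
    apply (is_RInt_C_unique (fun t => K (rho * cis t)) 0 1); [| exact hJrho]. apply (hlim m).
    - intros eps he. destruct (shrink_lim rho 1 hw0) with (eps := eps) as [N hN]; [| assumption |].
      { rewrite Rabs_pos_eq; lra. }
      exists N. intros n hn. specialize (hN n hn). specialize (hm n).
      unfold m in *. pose proof (Rmin_r r (rho * (1 + 1 / (INR n + 2)))).
      rewrite Rabs_pos_eq by lra. rewrite Rabs_pos_eq in hN by lra. lra.
    - intros n. specialize (hm n). apply (hmean (m n) r); try lra. exact hJ1. }
  rewrite hJ1z in hJ1.
  assert (hin : (Cmod (w / r) < 1)%R).
  { rewrite Cmod_div by (apply RtoC_neq_0; lra). rewrite Cmod_R, Rabs_pos_eq by lra. fold rho.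
    apply Rmult_lt_reg_r with r; [lra |]. unfold Rdiv. rewrite Rmult_assoc, Rinv_l; lra. }
  (* Adding g(w) times the mean of z / (z - w), which is 1, removes g(w) from the numerator: g(w) is
     the mean of z g(z) / (z - w) over |z| = r. *)
  pose proof (is_RInt_C_plus _ _ _ _ _ _ hJ1 (is_RInt_C_scal _ _ _ (g w) _ (mean_kernel_inside _ hin))) as hk.
  replace (0 + g w * 1) with (g w) in hk by ring.
  assert (hb : (Cmod (g w) <= (1 - 0) * (M * (/ r) ^ k * (r / (r - rho))))%R).
  { apply is_RInt_C_bound with (3 := hk); [lra |]. intros t ht.
    rewrite <- kern by lra. unfold K. rewrite dquot_neq by (apply circ_ne; lra).
    replace (r * cis t * ((g (r * cis t) - g w) / (r * cis t - w))
      + g w * (r * cis t * / (r * cis t - w)))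
      with (h (r * cis t) * (/ (r * cis t)) ^ k * (r * cis t * / (r * cis t - w)))
      by (unfold g, Cdiv; ring).
    assert (hne : r * cis t - w <> 0) by (apply Cminus_neq_0, circ_ne; lra).
    assert (hne' : r * cis t <> 0).
    { apply Cmult_neq_0; [apply RtoC_neq_0; lra | apply cis_neq_0]. }
    rewrite !Cmod_mult, Cmod_pow, !Cmod_inv, <- !Cmod_mult, Cmod_scal_cis by (assumption || lra).
    assert (hpk : (0 <= (/ r) ^ k)%R) by (apply pow_le; left; apply Rinv_0_lt_compat; lra).
    apply Rmult_le_compat.
    - apply Rmult_le_pos; [apply Cmod_ge_0 | assumption].
    - apply Rmult_le_pos; [lra | left; apply Rinv_0_lt_compat; now apply Cmod_gt_0].
    - apply Rmult_le_compat_r; [assumption |]. now apply hM.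
    - apply Rmult_le_compat_l; [lra |]. apply Rinv_le_contravar; [lra |].
      pose proof (Cmod_triangle_rev (r * cis t) w). rewrite Cmod_scal_cis in H by lra. fold rho in H. lra. }
  unfold g in hb. rewrite Cmod_mult, Cmod_pow, Cmod_inv in hb by assumption. fold rho in hb.
  assert (hpr : (0 < rho ^ k)%R) by (apply pow_lt; lra).
  rewrite !pow_inv in hb. unfold Rdiv at 2. rewrite Rpow_mult_distr, pow_inv.
  apply (Rmult_le_compat_r (rho ^ k)) in hb; [| lra].
  rewrite Rmult_assoc, Rinv_l, Rmult_1_r in hb by lra.
  eapply Rle_trans; [exact hb |]. right. ring.
Qed.

(** The exponent k in [cauchy_power_bound] is arbitrary, and (|w| / r)^k tends to 0 while the other
    factors stay fixed. This takes the place of a Taylor expansion. *)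
Lemma identity_disc w : (Cmod w < Rad)%R -> h w = 0.
Proof.
  intros hw. destruct (Rlt_dec (Cmod w) delta) as [hl | hl]; [now apply vanish |].
  assert (hw0 : (0 < Cmod w)%R) by lra.
  set (r := ((Cmod w + Rad) / 2)%R).
  assert (hr : (Cmod w < r < Rad)%R) by (unfold r; lra).
  destruct (cont01_bounded (fun t => h (r * cis t))) as [M [hM0 hM]].
  { intros t _. apply (continuous_comp (fun t : R => r * cis t) h).
    - ccont. apply continuous_cis.
    - destruct (holo (r * cis t)) as [l hl']; [rewrite Cmod_scal_cis; lra |].
      eapply cderiv_continuous, hl'. }
  apply Cmod_eq_0. apply Rle_antisym; [| apply Cmod_ge_0].
  apply le_epsilon. intros eps he. rewrite Rplus_0_l.
  set (B := (M * (r / (r - Cmod w)))%R).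
  assert (hB : (0 < B)%R) by (unfold B; apply Rmult_lt_0_compat; [| apply Rdiv_lt_0_compat]; lra).
  destruct (pow_lt_1_zero (Cmod w / r)) with (y := (eps / B)%R) as [N hN].
  { rewrite Rabs_pos_eq by (left; apply Rdiv_lt_0_compat; lra).
    apply Rmult_lt_reg_r with r; [lra |]. unfold Rdiv. rewrite Rmult_assoc, Rinv_l; lra. }
  { now apply Rdiv_lt_0_compat. }
  specialize (hN N (Nat.le_refl _)).
  rewrite Rabs_pos_eq in hN by (apply pow_le; left; apply Rdiv_lt_0_compat; lra).
  eapply Rle_trans; [apply (cauchy_power_bound w N (conj hw0 hw) r M hr hM) |]. fold B.
  left. apply Rlt_le_trans with (B * (eps / B))%R; [now apply Rmult_lt_compat_l | right; field; lra].
Qed.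

End Identity.

(** * The identity theorem in four variables *)

Notation locally4 := (locally (T := C4_NormedModule)).
Notation open4 := (open (T := C4_NormedModule)).

Lemma locally_C4 (a b c d : C) (P : C4 -> Prop) :
  locally4 (a, b, c, d) P <->
  exists r, (0 < r)%R /\ forall a' b' c' d', (Cmod (a' - a) < r)%R -> (Cmod (b' - b) < r)%R ->
    (Cmod (c' - c) < r)%R -> (Cmod (d' - d) < r)%R -> P (a', b', c', d').
Proof.
  split.
  - intros [e he]. exists e. split; [apply cond_pos |]. intros a' b' c' d' h1 h2 h3 h4.
    apply he. refine (conj (conj (conj _ _) _) _); now apply ball_of_Cmod.
  - intros [e [he hP]]. assert (he2 : (0 < e / 2)%R) by lra.
    exists (mkposreal _ he2). intros [[[a' b'] c'] d'] [[[h1 h2] h3] h4].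
    apply hP; now apply Cmod_of_ball.
Qed.

Lemma quad_eq (a b c d a' b' c' d' : C) :
  a = a' -> b = b' -> c = c' -> d = d' -> (a, b, c, d) = (a', b', c', d').
Proof. now intros -> -> -> ->. Qed.

Definition line (p0 p1 : C4) (z : C) : C4 :=
  let '(a0, b0, c0, d0) := p0 in
  let '(a1, b1, c1, d1) := p1 in
  (a0 + z * (a1 - a0), b0 + z * (b1 - b0), c0 + z * (c1 - c0), d0 + z * (d1 - d0)).

Lemma line_0 p0 p1 : line p0 p1 0 = p0.
Proof. destruct p0 as [[[a b] c] d], p1 as [[[a' b'] c'] d']. apply quad_eq; ring. Qed.

Lemma line_1 p0 p1 : line p0 p1 1 = p1.
Proof. destruct p0 as [[[a b] c] d], p1 as [[[a' b'] c'] d']. apply quad_eq; ring. Qed.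

Lemma line_locally p0 p1 z (P : C4 -> Prop) :
  locally4 (line p0 p1 z) P -> locally z (fun w : C => P (line p0 p1 w)).
Proof.
  destruct p0 as [[[a b] c] d], p1 as [[[a' b'] c'] d']. simpl. intros h.
  apply locally_C4 in h. destruct h as [r [hr h]]. apply locally_C_Cmod.
  set (M := (Cmod (a' - a) + Cmod (b' - b) + Cmod (c' - c) + Cmod (d' - d) + 1)%R).
  pose proof (Cmod_ge_0 (a' - a)). pose proof (Cmod_ge_0 (b' - b)).
  pose proof (Cmod_ge_0 (c' - c)). pose proof (Cmod_ge_0 (d' - d)).
  exists (r / M)%R. split; [apply Rdiv_lt_0_compat; unfold M; lra |]. intros w hw.
  assert (key : forall u v : C, (Cmod (v - u) <= M)%R ->
    (Cmod (u + w * (v - u) - (u + z * (v - u))) < r)%R).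
  { intros u v hv. replace (u + w * (v - u) - (u + z * (v - u))) with ((w - z) * (v - u)) by ring.
    rewrite Cmod_mult.
    assert (hM : (0 < M)%R) by (unfold M; lra).
    apply Rle_lt_trans with (Cmod (w - z) * M)%R; [apply Rmult_le_compat_l; [apply Cmod_ge_0 | assumption] |].
    apply (Rmult_lt_compat_r M) in hw; [| assumption].
    unfold Rdiv in hw. rewrite Rmult_assoc, Rinv_l in hw; lra. }
  apply h; apply key; unfold M; lra.
Qed.

(** The derivative is the Frechet differential applied to the direction [v] of the line; the
    tolerance eps / (N + 1) also covers the direction 0. *)
Lemma line_cderiv (f : C4 -> C) p0 p1 z :
  ex_filterdiff (U := C4_NormedModule) (V := C_NormedModule) f
    (locally4 (line p0 p1 z)) ->
  exists l, cderiv (fun w => f (line p0 p1 w)) z l.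
Proof.
  intros [L [hlin hL]]. specialize (hL (line p0 p1 z) (fun P H => H)).
  set (v := let '(a0, b0, c0, d0) := p0 in let '(a1, b1, c1, d1) := p1 in
    (a1 - a0, b1 - b0, c1 - c0, d1 - d0)).
  assert (hv : forall w, minus (G := C4_NormedModule) (line p0 p1 w) (line p0 p1 z)
    = scal (V := C4_NormedModule) (w - z) v).
  { intros w. unfold v. destruct p0 as [[[a b] c] d], p1 as [[[a' b'] c'] d']. simpl.
    match goal with |- _ = ?r => change ((a + w * (a' - a) - (a + z * (a' - a)),
      b + w * (b' - b) - (b + z * (b' - b)), c + w * (c' - c) - (c + z * (c' - c)),
      d + w * (d' - d) - (d + z * (d' - d))) = r) end.
    match goal with |- ?l = _ => change (l = ((w - z) * (a' - a), (w - z) * (b' - b),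
      (w - z) * (c' - c), (w - z) * (d' - d))) end.
    apply quad_eq; ring. }
  set (l := L v). set (N := norm (V := C4_NormedModule) v).
  assert (hN : (0 <= N)%R) by apply norm_ge_0.
  exists l, (dquot (fun w => f (line p0 p1 w)) z l). refine (conj _ (conj _ _)).
  - apply continuous_C_eps. intros eps he.
    pose proof (dquot_at (fun w => f (line p0 p1 w)) z l) as e0.
    rewrite e0.
    assert (he' : (0 < eps / (N + 1))%R) by (apply Rdiv_lt_0_compat; lra).
    specialize (hL (mkposreal _ he')). apply line_locally in hL.
    revert hL; apply filter_imp. intros w hw.
    destruct (classic (w = z)) as [-> | hne].
    + rewrite e0. replace (l - l) with (RtoC 0) by ring. now rewrite Cmod_0.
    + rewrite dquot_neq by assumption. pose proof (Cminus_neq_0 _ _ hne) as hd.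
      rewrite hv in hw. rewrite (linear_scal L hlin) in hw.
      pose proof (norm_scal (V := C4_NormedModule) (w - z) v) as hs. fold N in hs.
      change (Cmod (f (line p0 p1 w) - f (line p0 p1 z) - (w - z) * l)
        <= eps / (N + 1) * norm (V := C4_NormedModule) (scal (V := C4_NormedModule) (w - z)%C v))%R in hw.
      change (norm (V := C4_NormedModule) (scal (V := C4_NormedModule) (w - z)%C v)
        <= Cmod (w - z)%C * N)%R in hs.
      replace ((f (line p0 p1 w) - f (line p0 p1 z)) / (w - z) - l)
        with ((f (line p0 p1 w) - f (line p0 p1 z) - (w - z) * l) / (w - z)) by (field; assumption).
      rewrite Cmod_div by assumption. apply (proj1 (Cmod_gt_0 _)) in hd.
      apply Rmult_lt_reg_r with (Cmod (w - z)); [assumption |].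
      unfold Rdiv at 1. rewrite Rmult_assoc, Rinv_l, Rmult_1_r by lra.
      eapply Rle_lt_trans; [exact hw |].
      apply Rle_lt_trans with (eps / (N + 1) * (Cmod (w - z) * N))%R; [apply Rmult_le_compat_l; lra |].
      replace (eps * Cmod (w - z))%R with (eps / (N + 1) * (Cmod (w - z) * (N + 1)))%R by (field; lra).
      apply Rmult_lt_compat_l; [assumption |]. apply Rmult_lt_compat_l; lra.
  - apply dquot_at.
  - apply filter_forall. intros w. apply (dquot_eq (fun w => f (line p0 p1 w))).
Qed.

(** The set U of points near which h vanishes is open, so by connectedness it suffices that its
    complement in D is open. By [spread], a point p of D close to some p' in U lies in U: each p''
    near p is joined to p' by a complex line, on which h vanishes near p'. *)
Theorem identity_C4 (D : C4 -> Prop) (h : C4 -> C) (p1 : C4) :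
  open4 D -> connected_set (T := C4_NormedModule) D ->
  (forall p0 p1 z, D (line p0 p1 z) -> exists l, cderiv (fun w => h (line p0 p1 w)) z l) ->
  D p1 -> locally4 p1 (fun p => h p = 0) ->
  forall p, D p -> h p = 0.
Proof.
  intros hopen hconn hol hp1 hloc p hp.
  set (U := fun p : C4 => locally4 p (fun p' => h p' = 0)).
  assert (spread : forall p, D p -> exists r, (0 < r)%R /\
    let '(a, b, c, d) := p in
    forall a' b' c' d', (Cmod (a' - a) < r)%R -> (Cmod (b' - b) < r)%R ->
      (Cmod (c' - c) < r)%R -> (Cmod (d' - d) < r)%R ->
      D (a', b', c', d') /\ (U (a', b', c', d') -> U p)).
  { intros [[[a b] c] d] hD. apply hopen, locally_C4 in hD. destruct hD as [r [hr hD]].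
    exists (r / 4)%R. split; [lra |]. intros a' b' c' d' h1 h2 h3 h4.
    split; [apply hD; lra |]. intros hU.
    apply (proj2 (locally_C4 a b c d _)). exists (r / 4)%R. split; [lra |].
    intros a'' b'' c'' d'' k1 k2 k3 k4.
    set (p' := (a', b', c', d')) in *. set (p'' := (a'', b'', c'', d'')).
    assert (hU0 : U (line p' p'' 0)) by now rewrite line_0.
    pose proof (line_locally p' p'' 0 (fun x => h x = 0) hU0) as hv0.
    apply (proj1 (locally_C_Cmod _ _)) in hv0. destruct hv0 as [delta [hdelta hv]].
    rewrite <- (line_1 p' p'').
    (* The radius 3 / 2 includes z = 1, the parameter of p''. Since p' and p'' are within r / 4 of
       p, the line stays within r / 4 + (3 / 2) (r / 2) = r of p there. *)
    apply (identity_disc (fun z => h (line p' p'' z)) (3 / 2) delta hdelta).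
    - intros z hz. apply hol. unfold p', p''. simpl.
      assert (key : forall u u' u'' : C, (Cmod (u' - u) < r / 4)%R -> (Cmod (u'' - u) < r / 4)%R ->
        (Cmod (u' + z * (u'' - u') - u) < r)%R).
      { intros u u' u'' m1 m2.
        replace (u' + z * (u'' - u') - u) with ((u' - u) + z * (u'' - u')) by ring.
        eapply Rle_lt_trans; [apply Cmod_triangle |]. rewrite Cmod_mult.
        pose proof (Cmod_triangle_sub u'' u u') as m3. rewrite (Cmod_dist_sym u u') in m3.
        pose proof (Cmod_ge_0 z). pose proof (Cmod_ge_0 (u'' - u')).
        assert (Cmod z * Cmod (u'' - u') <= 3 / 2 * (r / 2))%R by (apply Rmult_le_compat; lra). lra. }
      apply hD; now apply key.
    - intros z hz. apply hv. now replace (z - 0) with z by ring.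
    - rewrite Cmod_1. lra. }
  assert (goal : U p).
  { apply NNPP. intros hnU.
    destruct (hconn U (fun p => D p /\ ~ U p)) as [x [_ [x1 [_ x2]]]].
    - intros x hx. apply (locally_locally (T := C4_NormedModule)). exact hx.
    - intros x [hx hxU]. destruct (spread x hx) as [r [hr hs]].
      destruct x as [[[a b] c] d]. apply (proj2 (locally_C4 a b c d _)). exists r. split; [assumption |].
      intros a' b' c' d' h1 h2 h3 h4. destruct (hs a' b' c' d' h1 h2 h3 h4). split; tauto.
    - intros x hx. destruct (classic (U x)); [now left | right; now split].
    - now exists p1.
    - now exists p.
    - contradiction. }
  exact (locally_singleton (T := C4_NormedModule) p (fun p' => h p' = 0) goal).
Qed.

(** * Polynomials in four variables *)

Definition par_a (p : C4) : C := fst (fst (fst p)).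
Definition par_b (p : C4) : C := snd (fst (fst p)).
Definition par_c (p : C4) : C := snd (fst p).
Definition par_d (p : C4) : C := snd p.

Inductive poly4 : (C4 -> C) -> Prop :=
| poly4_const k : poly4 (fun _ => k)
| poly4_a : poly4 par_a
| poly4_b : poly4 par_b
| poly4_c : poly4 par_c
| poly4_d : poly4 par_d
| poly4_plus f g : poly4 f -> poly4 g -> poly4 (fun p => f p + g p)
| poly4_mult f g : poly4 f -> poly4 g -> poly4 (fun p => f p * g p).

Notation C2_NormedModule := (prod_NormedModule C_AbsRing C_NormedModule C_NormedModule).

Lemma norm_pair (x y : C) :
  (Cmod x <= norm (V := C2_NormedModule) (x, y))%R /\
  (Cmod y <= norm (V := C2_NormedModule) (x, y))%R.
Proof.
  destruct (norm_prod (U := C_NormedModule) (V := C_NormedModule) x y) as [h _].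
  split; (eapply Rle_trans; [| exact h]); [apply Rmax_l | apply Rmax_r].
Qed.

Lemma filterdiff_Cmult (u v : C) :
  filterdiff (U := C2_NormedModule) (V := C_NormedModule) (fun t => fst t * snd t)
    (locally (T := C2_NormedModule) (u, v)) (fun t => fst t * v + u * snd t).
Proof.
  split.
  - constructor.
    + intros [x1 x2] [y1 y2]. simpl. unfold plus; simpl. cring.
    + intros k [x1 x2]. simpl. unfold scal; simpl. unfold mult; simpl. cring.
    + exists (Cmod v + Cmod u + 1)%R. pose proof (Cmod_ge_0 u). pose proof (Cmod_ge_0 v).
      split; [lra |]. intros [x1 x2]. destruct (norm_pair x1 x2) as [h1 h2].
      assert (hN : forall N, (Cmod x1 <= N)%R -> (Cmod x2 <= N)%R ->
        (Cmod (x1 * v + u * x2) <= (Cmod v + Cmod u + 1) * N)%R).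
      { intros N k1 k2. eapply Rle_trans; [apply Cmod_triangle |]. rewrite !Cmod_mult.
        pose proof (Cmod_ge_0 x1).
        assert (Cmod x1 * Cmod v <= N * Cmod v)%R by now apply Rmult_le_compat_r.
        assert (Cmod u * Cmod x2 <= Cmod u * N)%R by now apply Rmult_le_compat_l.
        lra. }
      exact (hN _ h1 h2).
  - intros x hx. apply (is_filter_lim_locally_unique (V := C2_NormedModule)) in hx. subst x.
    intros eps.
    assert (hl : locally (T := C2_NormedModule) (u, v) (fun t => (Cmod (fst t - u) < eps)%R)).
    { pose proof (continuous_fst u v) as hc.
      apply (hc (fun w => (Cmod (w - u) < eps)%R)). apply locally_C_Cmod.
      exists eps. split; [apply cond_pos | auto]. }
    revert hl; apply filter_imp. intros [x y] hxy. simpl in hxy.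
    destruct (norm_pair (x - u) (y - v)) as [_ h2].
    change (Cmod (x * y - u * v - ((x - u) * v + u * (y - v)))
      <= eps * norm (V := C2_NormedModule) (x - u, y - v)%C)%R.
    replace (x * y - u * v - ((x - u) * v + u * (y - v))) with ((x - u) * (y - v)) by ring.
    rewrite Cmod_mult. apply Rmult_le_compat; [apply Cmod_ge_0 | apply Cmod_ge_0 | lra | exact h2].
Qed.

(** The remainder 1 / y - 1 / u + (y - u) / u^2 equals (y - u)^2 / (y u^2). *)
Lemma filterdiff_Cinv (u : C) : u <> 0 ->
  filterdiff (U := C_NormedModule) (V := C_NormedModule) Cinv (locally u) (fun t => - / (u * u) * t).
Proof.
  intros hu. split.
  - constructor.
    + intros x y. unfold plus; simpl. cring.
    + intros k x. unfold scal; simpl. unfold mult; simpl. cring.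
    + exists (Cmod (- / (u * u)) + 1)%R. pose proof (Cmod_ge_0 (- / (u * u))).
      split; [lra |]. intros x. change (Cmod (- / (u * u) * x) <= (Cmod (- / (u * u)) + 1) * Cmod x)%R.
      rewrite Cmod_mult. pose proof (Cmod_ge_0 x). nra.
  - intros x hx. apply (is_filter_lim_locally_unique (V := C_NormedModule)) in hx. subst x.
    intros eps.
    assert (hc : continuous (fun y : C => (y - u) / (y * (u * u))) u).
    { ccont. rewrite !Cmult_neq_0_iff. tauto. }
    rewrite continuous_C_eps in hc. specialize (hc eps (cond_pos eps)).
    assert (hn : locally u (fun y : C => y <> 0)).
    { apply (continuous_C_neq_0 (fun y : C => y)); [apply continuous_id | assumption]. }
    generalize (filter_and _ _ hc hn). apply filter_imp. intros y [h1 h2].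
    change (Cmod (/ y - / u - - / (u * u) * (y - u)) <= eps * Cmod (y - u))%R.
    replace (/ y - / u - - / (u * u) * (y - u)) with ((y - u) / (y * (u * u)) * (y - u))
      by (field; split; assumption).
    rewrite Cmod_mult. apply Rmult_le_compat_r; [apply Cmod_ge_0 |].
    replace ((y - u) / (y * (u * u))) with ((y - u) / (y * (u * u)) - (u - u) / (u * (u * u)))
      by (field; split; assumption).
    lra.
Qed.

Notation ex_diff4 f p :=
  (ex_filterdiff (U := C4_NormedModule) (V := C_NormedModule) f (locally4 p)).

Lemma ex_diff4_mult (f g : C4 -> C) (p : C4) :
  ex_diff4 f p -> ex_diff4 g p -> ex_diff4 (fun x => f x * g x) p.
Proof.
  intros [lf hf] [lg hg]. eexists.
  apply (filterdiff_comp'_2 (U := C_NormedModule) (V := C_NormedModule) f g Cmult p lf lg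
    (fun x y => x * g p + f p * y) hf hg).
  apply filterdiff_Cmult.
Qed.

Lemma ex_diff4_inv (f : C4 -> C) (p : C4) : ex_diff4 f p -> f p <> 0 -> ex_diff4 (fun x => / f x) p.
Proof.
  intros [lf hf] hn. eexists.
  exact (filterdiff_comp' (V := C_NormedModule) f Cinv p lf _ hf (filterdiff_Cinv _ hn)).
Qed.

Lemma poly4_ex_diff f : poly4 f -> forall p, ex_diff4 f p.
Proof.
  induction 1 as [k | | | | | f g _ IHf _ IHg | f g _ IHf _ IHg]; intros p.
  - apply (ex_filterdiff_const (U := C4_NormedModule) (V := C_NormedModule)).
  - apply ex_filterdiff_linear.
    apply (is_linear_comp (fun t => fst (fst t)) fst); [| apply is_linear_fst].
    apply (is_linear_comp fst fst); apply is_linear_fst.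
  - apply ex_filterdiff_linear.
    apply (is_linear_comp (fun t => fst (fst t)) snd); [| apply is_linear_snd].
    apply (is_linear_comp fst fst); apply is_linear_fst.
  - apply ex_filterdiff_linear.
    apply (is_linear_comp fst snd); [apply is_linear_fst | apply is_linear_snd].
  - apply ex_filterdiff_linear. apply is_linear_snd.
  - apply (ex_filterdiff_plus_fct (U := C4_NormedModule) (V := C_NormedModule)); auto.
  - now apply ex_diff4_mult.
Qed.

Fixpoint peval (l : list C) (z : C) : C :=
  match l with [] => 0 | k :: l' => k + z * peval l' z end.

Definition polynomial (g : C -> C) : Prop := exists l, forall z, g z = peval l z.

Lemma polynomial_plus f g : polynomial f -> polynomial g -> polynomial (fun z => f z + g z).
Proof.
  intros [l hl] [m hm].
  assert (h : forall l m, exists s, forall z, peval l z + peval m z = peval s z).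
  { clear. induction l as [|k l IH]; intros m.
    - exists m. intros; simpl; ring.
    - destruct m as [|k' m].
      + exists (k :: l). intros; simpl; ring.
      + destruct (IH m) as [s hs]. exists (k + k' :: s). intros z. simpl. rewrite <- hs. ring. }
  destruct (h l m) as [s hs]. exists s. intros z. now rewrite hl, hm.
Qed.

Lemma polynomial_scal k f : polynomial f -> polynomial (fun z => k * f z).
Proof.
  intros [l hl]. exists (map (Cmult k) l). intros z. rewrite hl. clear hl.
  induction l as [|m l IH]; simpl; [ring |]. rewrite <- IH. ring.
Qed.

Lemma polynomial_mult f g : polynomial f -> polynomial g -> polynomial (fun z => f z * g z).
Proof.
  intros [l hl] hg.
  assert (h : polynomial (fun z => peval l z * g z)).
  { clear hl. induction l as [|k l IH]; simpl.
    - exists []. intros; simpl; ring.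
    - destruct (polynomial_scal k g hg) as [s hs], IH as [m hm].
      destruct (polynomial_plus (fun z => k * g z) (fun z => z * (peval l z * g z))) as [u hu].
      + now exists s.
      + exists (RtoC 0 :: m). intros z. simpl. rewrite hm. ring.
      + exists u. intros z. rewrite <- hu. ring. }
  destruct h as [s hs]. exists s. intros z. now rewrite hl.
Qed.

Lemma peval_factor l r : exists l', (length l' <= pred (length l))%nat /\
  forall z, peval l z - peval l r = (z - r) * peval l' z.
Proof.
  induction l as [|k l IH].
  - exists []. split; [simpl; lia |]. intros; simpl; ring.
  - destruct IH as [l' [h1 h2]]. destruct l as [|k' l].
    + exists []. split; [simpl; lia |]. intros; simpl; ring.
    + exists (peval (k' :: l) r :: l'). split; [simpl in *; lia |]. intros z.
      change (peval (k :: k' :: l) z) with (k + z * peval (k' :: l) z).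
      change (peval (k :: k' :: l) r) with (k + r * peval (k' :: l) r).
      transitivity ((z - r) * peval (k' :: l) r + z * (peval (k' :: l) z - peval (k' :: l) r)); [ring |].
      rewrite h2. simpl. ring.
Qed.

Lemma polynomial_roots g : polynomial g -> (exists z, g z <> 0) ->
  exists roots, forall z, g z = 0 -> In z roots.
Proof.
  intros [l hl] [z0 hz0].
  assert (h : forall n l, (length l <= n)%nat -> peval l z0 <> 0 ->
    exists roots, forall z, peval l z = 0 -> In z roots).
  { clear. induction n as [|n IH]; intros l hlen hz0.
    - destruct l; [| simpl in hlen; lia]. now elim hz0.
    - destruct (classic (exists r, peval l r = 0)) as [[r hr] | hno].
      + destruct (peval_factor l r) as [l' [h1 h2]].
        assert (h3 : forall z, peval l z = (z - r) * peval l' z).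
        { intros z. rewrite <- h2, hr. ring. }
        destruct (IH l') as [roots hroots].
        * destruct l; [now elim hz0 |]. simpl in *. lia.
        * intros e. apply hz0. rewrite h3, e. ring.
        * exists (r :: roots). intros z hz. rewrite h3 in hz.
          destruct (classic (z = r)) as [-> | hne]; [now left | right].
          apply hroots. apply NNPP. intros hn. revert hz.
          apply Cmult_neq_0; [now apply Cminus_neq_0 | assumption].
      + exists []. intros z hz. elim hno. now exists z. }
  destruct (h (length l) l (Nat.le_refl _)) as [roots hroots].
  - now rewrite <- hl.
  - exists roots. intros z hz. apply hroots. now rewrite <- hl.
Qed.

Lemma poly4_line f p0 p1 : poly4 f -> polynomial (fun z => f (line p0 p1 z)).
Proof.
  induction 1 as [k | | | | | f g _ IHf _ IHg | f g _ IHf _ IHg].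
  - exists [k]. intros; simpl; ring.
  - exists [par_a p0; par_a p1 - par_a p0]. intros z.
    destruct p0 as [[[a b] c] d], p1 as [[[a' b'] c'] d']. unfold par_a; simpl; ring.
  - exists [par_b p0; par_b p1 - par_b p0]. intros z.
    destruct p0 as [[[a b] c] d], p1 as [[[a' b'] c'] d']. unfold par_b; simpl; ring.
  - exists [par_c p0; par_c p1 - par_c p0]. intros z.
    destruct p0 as [[[a b] c] d], p1 as [[[a' b'] c'] d']. unfold par_c; simpl; ring.
  - exists [par_d p0; par_d p1 - par_d p0]. intros z.
    destruct p0 as [[[a b] c] d], p1 as [[[a' b'] c'] d']. unfold par_d; simpl; ring.
  - now apply polynomial_plus.
  - now apply polynomial_mult.
Qed.

(** * Connectedness of the complement of a zero set *)

Lemma avoid_list (l : list R) : exists s, ~ In s l.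
Proof.
  assert (h : exists M, forall x, In x l -> (x < M)%R).
  { induction l as [|x l [M hM]].
    - exists 0%R. intros x [].
    - exists (Rmax M (x + 1)). intros y [<- | hy].
      + pose proof (Rmax_r M (x + 1)). lra.
      + specialize (hM y hy). pose proof (Rmax_l M (x + 1)). lra. }
  destruct h as [M hM]. exists M. intros hin. specialize (hM M hin). lra.
Qed.

Definition arc (s t : R) : C := (t, (s * (t * (1 - t)))%R).

(* The arcs for distinct [s] meet only in their end points 0 and 1. *)
Lemma polynomial_arc g : polynomial g -> g 0 <> 0 -> g 1 <> 0 ->
  exists s, forall t, (0 <= t <= 1)%R -> g (arc s t) <> 0.
Proof.
  intros hg h0 h1.
  destruct (polynomial_roots g hg) as [roots hroots]; [now exists 0 |].
  (* A root on the interior of an arc determines its [s] by this quotient. Roots with real part 0 or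
     1 get the value 0 from the division, which merely excludes one more [s]; the end points are
     covered by the hypotheses on g. *)
  destruct (avoid_list (map (fun r : C => (snd r / (fst r * (1 - fst r)))%R) roots)) as [s hs].
  exists s. intros t ht hz.
  destruct (Req_dec t 0) as [-> | ht0].
  { apply h0. assert (e : arc s 0 = RtoC 0) by (apply C_eq; simpl; ring). now rewrite e in hz. }
  destruct (Req_dec t 1) as [-> | ht1].
  { apply h1. assert (e : arc s 1 = RtoC 1) by (apply C_eq; simpl; ring). now rewrite e in hz. }
  apply hs. apply in_map_iff. exists (arc s t). split; [| now apply hroots].
  unfold arc; simpl. field. split; lra.
Qed.

(** Extends a path constantly beyond [0, 1], since [IVT] takes functions that are continuous on the
    whole line. *)
Definition clamp (t : R) : R := Rmax 0 (Rmin t 1).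

Lemma clamp_bounds t : (0 <= clamp t <= 1)%R.
Proof. unfold clamp, Rmax, Rmin. repeat destruct Rle_dec; lra. Qed.

Lemma continuous_clamp t : continuous clamp t.
Proof.
  intros P [e he]. exists e. intros s hs. apply he.
  change (Rabs (s - t) < e)%R in hs. change (Rabs (clamp s - clamp t) < e)%R.
  eapply Rle_lt_trans; [| exact hs].
  unfold clamp, Rmax, Rmin. repeat destruct Rle_dec; unfold Rabs; repeat destruct Rcase_abs; lra.
Qed.

(** On the complex line through two points the polynomial depends on one variable and has finitely
    many zeros, which some arc from 0 to 1 avoids. A separation would yield a continuous function
    along that arc with values -1 and 1 only. *)
Lemma connected_nonzero (Den : C4 -> C) : poly4 Den ->
  connected_set (T := C4_NormedModule) (fun p => Den p <> 0).
Proof.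
  intros hD U V hU hV hcov [p0 [d0 u0]] [p1 [d1 v1]].
  destruct (polynomial_arc (fun z => Den (line p0 p1 z))) as [s hs].
  { now apply poly4_line. }
  { now rewrite line_0. }
  { now rewrite line_1. }
  set (gamma := fun t => line p0 p1 (arc s (clamp t))).
  assert (gD : forall t, Den (gamma t) <> 0) by (intros t; apply hs, clamp_bounds).
  assert (gcont : forall t (P : C4 -> Prop),
    locally4 (gamma t) P -> locally t (fun u : R => P (gamma u))).
  { intros t P hP. apply line_locally in hP.
    assert (hc : continuous (fun u : R => arc s (clamp u)) t).
    { pose proof (continuous_clamp t) as hcl. apply continuous_C_parts; simpl; [exact hcl |].
      apply (continuous_Rprod (fun _ => s)); [apply continuous_const |].
      apply (continuous_Rprod clamp); [exact hcl |].
      apply (continuous_minus (V := R_NormedModule)); [apply continuous_const | exact hcl]. }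
    apply (hc _ hP). }
  apply NNPP. intros hno.
  assert (excl : forall p, Den p <> 0 -> U p -> V p -> False).
  { intros p k1 k2 k3. apply hno. now exists p. }
  set (f := fun t => if excluded_middle_informative (U (gamma t)) then (-1)%R else 1%R).
  assert (fcont : continuity f).
  { intros t. apply continuity_pt_filterlim. change (continuous f t).
    destruct (hcov (gamma t) (gD t)) as [hu | hv].
    - apply continuous_ext_loc with (g := fun _ => (-1)%R); [| apply continuous_const].
      generalize (gcont t U (hU _ hu)). apply filter_imp. intros u k. unfold f.
      destruct excluded_middle_informative; [reflexivity | contradiction].
    - apply continuous_ext_loc with (g := fun _ => 1%R); [| apply continuous_const].
      generalize (gcont t V (hV _ hv)). apply filter_imp. intros u k. unfold f.
      destruct excluded_middle_informative as [k' |]; [| reflexivity].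
      elim (excl _ (gD u) k' k). }
  assert (g0 : gamma 0%R = p0).
  { unfold gamma. replace (arc s (clamp 0)) with (RtoC 0); [apply line_0 |].
    unfold arc, clamp. rewrite Rmin_left, Rmax_left by lra. apply C_eq; simpl; ring. }
  assert (g1 : gamma 1%R = p1).
  { unfold gamma. replace (arc s (clamp 1)) with (RtoC 1); [apply line_1 |].
    unfold arc, clamp. rewrite Rmin_left, Rmax_right by lra. apply C_eq; simpl; ring. }
  destruct (IVT f 0 1 fcont Rlt_0_1) as [t [_ ht]].
  - unfold f. rewrite g0. destruct excluded_middle_informative; [lra | contradiction].
  - unfold f. rewrite g1. destruct excluded_middle_informative as [k |]; [| lra].
    elim (excl _ d1 k v1).
  - unfold f in ht. destruct excluded_middle_informative; lra.
Qed.

Lemma open_nonzero (Den : C4 -> C) : poly4 Den -> open4 (fun p => Den p <> 0).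
Proof.
  intros hD p hp.
  apply (continuous_C_neq_0 (T := C4_NormedModule) Den p); [| exact hp].
  apply (filterdiff_continuous (U := C4_NormedModule) (V := C_NormedModule)). now apply poly4_ex_diff.
Qed.

(** * Rational functions regular where [Den] does not vanish *)

Section Rational4.

Variable Den : C4 -> C.

(** The quotient N / E kept in the form f E = N: where [Den] vanishes nothing is said about f, but E
    and N are still polynomials there, as the uniqueness of continuations requires. *)
Definition rat4 (f : C4 -> C) : Prop := exists E N, poly4 E /\ poly4 N /\
  forall p, Den p <> 0 -> E p <> 0 /\ f p * E p = N p.

Lemma rat4_poly f : poly4 f -> rat4 f.
Proof.
  intros h. exists (fun _ => 1), f. refine (conj (poly4_const 1) (conj h _)).
  intros p _. split; [apply C1_nz | ring].
Qed.

Lemma rat4_const k : rat4 (fun _ => k).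
Proof. apply rat4_poly, poly4_const. Qed.

Lemma rat4_plus f g : rat4 f -> rat4 g -> rat4 (fun p => f p + g p).
Proof.
  intros [E1 [N1 [e1 [n1 h1]]]] [E2 [N2 [e2 [n2 h2]]]].
  exists (fun p => E1 p * E2 p), (fun p => N1 p * E2 p + E1 p * N2 p).
  refine (conj _ (conj _ _)).
  - now apply poly4_mult.
  - apply (poly4_plus (fun p => N1 p * E2 p) (fun p => E1 p * N2 p)); now apply poly4_mult.
  - intros p hp. destruct (h1 p hp) as [k1 k2], (h2 p hp) as [k3 k4].
    split; [now apply Cmult_neq_0 |]. rewrite <- k2, <- k4. ring.
Qed.

Lemma rat4_mult f g : rat4 f -> rat4 g -> rat4 (fun p => f p * g p).
Proof.
  intros [E1 [N1 [e1 [n1 h1]]]] [E2 [N2 [e2 [n2 h2]]]].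
  exists (fun p => E1 p * E2 p), (fun p => N1 p * N2 p).
  refine (conj (poly4_mult _ _ e1 e2) (conj (poly4_mult _ _ n1 n2) _)).
  intros p hp. destruct (h1 p hp) as [k1 k2], (h2 p hp) as [k3 k4].
  split; [now apply Cmult_neq_0 |]. rewrite <- k2, <- k4. ring.
Qed.

Lemma rat4_inv (f : C4 -> C) :
  (forall p, Den p <> 0 -> f p <> 0) -> rat4 f -> rat4 (fun p => / f p).
Proof.
  intros hn [E [N [e [n h]]]]. exists N, E. refine (conj n (conj e _)).
  intros p hp. destruct (h p hp) as [k1 k2]. specialize (hn p hp). rewrite <- k2.
  split; [now apply Cmult_neq_0 |]. field. assumption.
Qed.

Lemma rat4_pow f n : rat4 f -> rat4 (fun p => f p ^ n).
Proof.
  intros h; induction n as [|n IH]; simpl; [apply rat4_const |]. now apply (rat4_mult f (fun p => f p ^ n)).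
Qed.

Lemma rat4_ex_diff f p : open4 (fun p => Den p <> 0) ->
  rat4 f -> Den p <> 0 -> ex_diff4 f p.
Proof.
  intros ho [E [N [e [n h]]]] hp.
  apply (ex_filterdiff_ext_locally (U := C4_NormedModule) (V := C_NormedModule) (fun x => N x * / E x)).
  - generalize (ho p hp). apply filter_imp. intros x hx. destruct (h x hx) as [k1 k2].
    rewrite <- k2. cfield. assumption.
  - apply ex_diff4_mult; [now apply poly4_ex_diff |].
    apply ex_diff4_inv; [now apply poly4_ex_diff | now apply h].
Qed.

End Rational4.

(** * The moments *)

Section Moment.

Variables (q : C) (n : nat).
Hypothesis hq0 : q <> 0.
Hypothesis hq1 : (Cmod q < 1)%R.

(** Its zeros are those of the denominators: a, the factors of (abcd; q)_n, and 1 - a^2 q^m for 0 <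
    m < 2 n, to which both kinds of denominators in a^2 reduce. For n = 0 the truncated 2 n - 1 is 0
    and the last product is empty. *)
Definition aw_den (p : C4) : C :=
  par_a p * (qpoch (par_a p * par_b p * par_c p * par_d p) q n
    * qpoch (par_a p * par_a p * q) q (2 * n - 1)).

Lemma poly4_qpoch (f : C4 -> C) m : poly4 f -> poly4 (fun p => qpoch (f p) q m).
Proof.
  intros hf. induction m as [|m IH]; simpl; [apply poly4_const |].
  apply (poly4_mult (fun p => qpoch (f p) q m) (fun p => 1 - f p * q ^ m)); [exact IH |].
  unfold Cminus. apply (poly4_plus (fun _ => 1) (fun p => - (f p * q ^ m))); [apply poly4_const |].
  replace (fun p => - (f p * q ^ m)) with (fun p => f p * - q ^ m).
  - apply (poly4_mult f (fun _ => - q ^ m)); [assumption | apply poly4_const].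
  - apply functional_extensionality. intros p. ring.
Qed.

Lemma poly4_aw_den : poly4 aw_den.
Proof.
  apply (poly4_mult par_a); [constructor |].
  apply (poly4_mult (fun p => qpoch (par_a p * par_b p * par_c p * par_d p) q n)
    (fun p => qpoch (par_a p * par_a p * q) q (2 * n - 1)));
    apply poly4_qpoch; repeat apply poly4_mult; constructor.
Qed.

Lemma aw_den_neq_0 p : aw_den p <> 0 <->
  par_a p <> 0 /\
  (forall k, (k <= n)%nat -> qpoch (par_a p * par_b p * par_c p * par_d p) q k <> 0) /\
  (forall m, (0 < m < 2 * n)%nat -> 1 - par_a p ^ 2 * q ^ m <> 0).
Proof.
  unfold aw_den. rewrite !Cmult_neq_0_iff, !qpoch_neq_0. split.
  - intros [h1 [h2 h3]]. refine (conj h1 (conj _ _)).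
    + intros k hk. apply qpoch_neq_0. intros i hi. apply h2. lia.
    + intros m hm. replace (par_a p ^ 2 * q ^ m) with (par_a p * par_a p * q * q ^ (m - 1)).
      * apply h3. lia.
      * replace m with (S (m - 1)) at 2 by lia. simpl. ring.
  - intros [h1 [h2 h3]]. refine (conj h1 (conj _ _)).
    + apply qpoch_neq_0. now apply h2.
    + intros i hi. replace (par_a p * par_a p * q * q ^ i) with (par_a p ^ 2 * q ^ S i) by (simpl; ring).
      apply h3. lia.
Qed.

Lemma aw_den_polydisc p : polydisc p -> par_a p <> 0 -> aw_den p <> 0.
Proof.
  destruct p as [[[a b] c] d]. intros [h1 [h2 [h3 h4]]] ha. apply aw_den_neq_0.
  unfold par_a, par_b, par_c, par_d in *; simpl fst in *; simpl snd in *.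
  refine (conj ha (conj _ _)).
  - intros k _. apply qpoch_of_qpoch_inf_neq_0; [exact hq1 |].
    apply qpoch_inf_neq_0_lt_1; [exact hq1 |]. repeat apply Cmod_prod_lt_1; assumption.
  - intros m _. now apply nondegenerate_lt_1.
Qed.

Notation rat := (rat4 aw_den).

Lemma rat_ext (f g : C4 -> C) : (forall p, f p = g p) -> rat f -> rat g.
Proof.
  intros e [E [N [h1 [h2 h3]]]]. exists E, N. refine (conj h1 (conj h2 _)).
  intros p hp. rewrite <- e. now apply h3.
Qed.

Lemma rat_qpoch (f : C4 -> C) m : rat f -> rat (fun p => qpoch (f p) q m).
Proof.
  intros hf. induction m as [|m IH]; simpl; [apply rat4_const |].
  apply (rat4_mult _ (fun p => qpoch (f p) q m)); [exact IH |].
  apply rat_ext with (fun p => 1 + f p * - q ^ m); [intros; ring |].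
  apply (rat4_plus _ (fun _ => 1)); [apply rat4_const |].
  apply rat4_mult; [exact hf | apply rat4_const].
Qed.

Lemma rat_csum (f : C4 -> nat -> C) m : (forall k, (k <= m)%nat -> rat (fun p => f p k)) ->
  rat (fun p => csum (f p) m).
Proof.
  induction m as [|m IH]; intros h; simpl; [now apply h |].
  apply (rat4_plus _ (fun p => csum (f p) m)); [| now apply h].
  apply IH. intros; apply h; lia.
Qed.

Lemma rat_par_a : rat par_a.
Proof. apply rat4_poly. constructor. Qed.

Lemma rat_inv_a_pow m : rat (fun p => / par_a p ^ m).
Proof.
  apply rat4_inv; [| apply rat4_pow, rat_par_a].
  intros p hp. apply aw_den_neq_0 in hp. now apply Cpow_nz.
Qed.

Lemma rat_weight k j : (j <= k <= n)%nat -> rat (fun p => weight q (par_a p) k j).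
Proof.
  intros hjk. unfold weight, Cdiv. apply rat4_mult; [apply rat4_const |].
  apply rat4_mult; [apply rat4_mult; [apply rat4_const | apply rat_inv_a_pow] |].
  apply rat4_inv.
  - intros p hp. apply aw_den_neq_0 in hp. destruct hp as [ha [_ hm]].
    assert (hqq : forall m, qpoch q q m <> 0).
    { intros m. apply qpoch_neq_0. intros i _. now apply (one_sub_pow_S_neq_0 q hq1 i). }
    cbn [qpochs fold_right]. rewrite !Cmult_neq_0_iff. repeat split; try apply hqq; try apply C1_nz.
    + apply (qpoch_down_neq_0 q (par_a p) hq0 ha n hm). lia.
    + apply (qpoch_up_neq_0 q (par_a p) n hm). lia.
  - cbn [qpochs fold_right].
    apply rat4_mult; apply rat4_mult; try apply rat4_const;
      (apply rat4_mult; [apply rat_qpoch | apply rat4_const]).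
    + apply rat4_mult; [apply rat4_const | apply rat_inv_a_pow].
    + apply rat4_mult; [apply rat4_const | apply rat4_pow, rat_par_a].
Qed.

Lemma rat_node j : rat (fun p => node q (par_a p) j).
Proof.
  unfold node. apply rat4_plus.
  - apply rat4_mult; [apply rat4_const | apply rat_par_a].
  - unfold Cdiv. apply rat4_mult; [apply rat4_const |].
    apply rat_ext with (2 := rat_inv_a_pow 1). intros p. simpl. now rewrite Cmult_1_r.
Qed.

Lemma rat_aw_sum : rat (aw_sum q n).
Proof.
  apply rat_ext with (fun p => / 2 ^ n * csum (fun k =>
    qpochs [par_a p * par_b p; par_a p * par_c p; par_a p * par_d p] q k
      * / qpoch (par_a p * par_b p * par_c p * par_d p) q k
    * csum (fun j => weight q (par_a p) k j * node q (par_a p) j ^ n) k) n).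
  { intros [[[a b] c] d]. reflexivity. }
  apply rat4_mult; [apply rat4_const |]. apply rat_csum. intros k hk.
  apply rat4_mult; [apply rat4_mult |].
  - cbn [qpochs fold_right].
    apply rat4_mult; [| apply rat4_mult; [| apply rat4_mult; [| apply rat4_const]]];
      apply rat_qpoch, rat4_poly; apply poly4_mult; constructor.
  - apply rat4_inv.
    + intros p hp. apply aw_den_neq_0 in hp. now apply hp.
    + apply rat_qpoch, rat4_poly. repeat apply poly4_mult; constructor.
  - apply rat_csum. intros j hj. apply rat4_mult; [apply rat_weight; lia |].
    apply rat4_pow, rat_node.
Qed.

Lemma polydisc_open : open4 polydisc.
Proof.
  intros [[[a b] c] d] [h1 [h2 [h3 h4]]]. apply (proj2 (locally_C4 a b c d polydisc)).
  exists (Rmin (Rmin (1 - Cmod a) (1 - Cmod b)) (Rmin (1 - Cmod c) (1 - Cmod d))).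
  split; [repeat apply Rmin_glb_lt; lra |]. intros a' b' c' d' k1 k2 k3 k4.
  apply Rmin_Rgt_l in k1, k2, k3, k4.
  destruct k1 as [k1 _], k2 as [k2 _], k3 as [_ k3], k4 as [_ k4].
  apply Rmin_Rgt_l in k1, k2, k3, k4.
  assert (key : forall z z' : C, (Cmod (z' - z) < 1 - Cmod z)%R -> (Cmod z' < 1)%R).
  { intros z z' h. pose proof (Cmod_triangle_rev z' z). lra. }
  simpl. repeat split; eapply key; [apply k1 | apply k2 | apply k3 | apply k4].
Qed.

Lemma polydisc_value p v : polydisc p -> par_a p <> 0 -> is_aw_integral q n p v <-> v = aw_sum q n p.
Proof.
  destruct p as [[[a b] c] d]. intros [h1 [h2 [h3 h4]]] ha. now apply aw_integral_value.
Qed.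

Lemma aw_sum_continuation : is_aw_continuation q n (fun p => aw_den p <> 0) (aw_sum q n).
Proof.
  pose proof (open_nonzero _ poly4_aw_den) as ho.
  refine (conj ho (conj (connected_nonzero _ poly4_aw_den) (conj _ (conj _ _)))).
  - intros p hp. apply (rat4_ex_diff aw_den); [exact ho | apply rat_aw_sum | exact hp].
  (* The origin will not do, since [aw_den] vanishes at a = 0. *)
  - assert (hd : polydisc (RtoC (/ 2), RtoC 0, RtoC 0, RtoC 0)).
    { unfold polydisc. rewrite !Cmod_R, Rabs_R0, Rabs_pos_eq; lra. }
    eexists. split; [| exact hd]. apply aw_den_polydisc; [exact hd |].
    apply RtoC_neq_0. simpl. lra.
  - intros p hp hd. apply polydisc_value; [exact hd | | reflexivity].
    apply aw_den_neq_0 in hp. apply hp.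
Qed.

(** The identity theorem is applied to f E - N, which is differentiable on all of D, including the
    zeros of [aw_den]; the division by E takes place only at the given point. *)
Lemma continuation_unique D f p :
  is_aw_continuation q n D f -> D p -> aw_den p <> 0 -> f p = aw_sum q n p.
Proof.
  intros [hopen [hconn [hana [[p1 [hp1 hd1]] hval]]]] hp hden.
  destruct rat_aw_sum as [E [N [hE [hN hEN]]]].
  set (h := fun x => f x * E x + - (1) * N x).
  (* The integral is identified with [aw_sum] only for a <> 0. Both D and the polydisc are open, so
     a can be moved from 0 to r / 2. *)
  assert (hpt : exists p2, D p2 /\ polydisc p2 /\ par_a p2 <> 0).
  { destruct (classic (par_a p1 = 0)) as [ha | ha]; [| now exists p1].
    pose proof (filter_and (F := locally4 p1) _ _ (hopen p1 hp1) (polydisc_open p1 hd1)) as hl.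
    destruct p1 as [[[a b] c] d]. apply (proj1 (locally_C4 a b c d _)) in hl.
    destruct hl as [r [hr hl]]. change (a = 0) in ha. subst a.
    destruct (hl (r / 2)%R b c d) as [k1 k2].
    - replace (RtoC (r / 2)%R - 0) with (RtoC (r / 2)%R) by ring.
      rewrite Cmod_R, Rabs_pos_eq; lra.
    - replace (b - b) with (RtoC 0) by ring. now rewrite Cmod_0.
    - replace (c - c) with (RtoC 0) by ring. now rewrite Cmod_0.
    - replace (d - d) with (RtoC 0) by ring. now rewrite Cmod_0.
    - eexists. refine (conj k1 (conj k2 _)). apply RtoC_neq_0. simpl. lra. }
  destruct hpt as [p2 [k1 [k2 k3]]].
  assert (hz : forall x, D x -> h x = 0).
  { apply (identity_C4 D h p2 hopen hconn); [| exact k1 |].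
    - intros x0 x1 z hx.
      destruct (line_cderiv f x0 x1 z (hana _ hx)) as [l1 m1].
      destruct (line_cderiv E x0 x1 z (poly4_ex_diff E hE _)) as [l2 m2].
      destruct (line_cderiv N x0 x1 z (poly4_ex_diff N hN _)) as [l3 m3].
      eexists. apply (cderiv_plus (fun w => f (line x0 x1 w) * E (line x0 x1 w))
        (fun w => - (1) * N (line x0 x1 w))).
      + apply (cderiv_mult (fun w => f (line x0 x1 w)) (fun w => E (line x0 x1 w))); eassumption.
      + apply (cderiv_mult (fun w => - (1)) (fun w => N (line x0 x1 w))); [apply cderiv_const | exact m3].
    - pose proof (open_nonzero _ poly4_aw_den p2 (aw_den_polydisc _ k2 k3)) as ho.
      generalize (filter_and (F := locally4 p2) _ _
        (filter_and (F := locally4 p2) _ _ (hopen p2 k1) (polydisc_open p2 k2)) ho).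
      apply filter_imp. intros x [[j1 j2] j3]. destruct (hEN x j3) as [_ e].
      pose proof (proj1 (aw_den_neq_0 x) j3) as [ja _].
      pose proof (proj1 (polydisc_value x (f x) j2 ja) (hval x j1 j2)) as ev.
      unfold h. rewrite ev, e. cring. }
  specialize (hz p hp). destruct (hEN p hden) as [e1 e2]. unfold h in hz. rewrite <- e2 in hz.
  replace (f p) with ((f p * E p + - (1) * (aw_sum q n p * E p)) / E p + aw_sum q n p).
  - rewrite hz. field. assumption.
  - field. assumption.
Qed.

Lemma is_aw_moment_iff a b c d v : aw_den (a, b, c, d) <> 0 ->
  is_aw_moment n a b c d q v <-> v = aw_sum q n (a, b, c, d).
Proof.
  intros hden. pose proof (proj1 (proj1 (aw_den_neq_0 _) hden)) as ha.
  unfold is_aw_moment. split.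
  - intros [[hd hi] | [_ [D [f [hc [hD <-]]]]]].
    + now apply polydisc_value in hi.
    + now apply continuation_unique with D.
  - intros ->. destruct (classic (polydisc (a, b, c, d))) as [hd | hd].
    + left. split; [exact hd |]. now apply polydisc_value.
    + right. split; [exact hd |]. exists (fun p => aw_den p <> 0), (aw_sum q n).
      refine (conj aw_sum_continuation (conj hden eq_refl)).
Qed.

End Moment.

Theorem theorem1p12 (n : nat) (a b c d q : C)
  (hq0 : q <> 0) (hq1 : (Cmod q < 1)%R) (ha : a <> 0)
  (habcd : forall k : nat, (k <= n)%nat -> qpoch (a * b * c * d) q k <> 0)
  (hden : forall k j : nat, (j <= k <= n)%nat ->
     qpoch (q / q ^ (2 * j) / a ^ 2) q j <> 0 /\
     qpoch (q ^ (2 * j + 1) * a ^ 2) q (k - j) <> 0) :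
  aw_moment n a b c d q =
  / 2 ^ n *
  sum_n (fun k : nat =>
    qpochs [a * b; a * c; a * d] q k / qpoch (a * b * c * d) q k * q ^ k *
    sum_n (fun j : nat =>
      / q ^ (j ^ 2) * / a ^ (2 * j) *
      ((q ^ j * a + / q ^ j / a) ^ n
       / (qpochs [q; q / q ^ (2 * j) / a ^ 2] q j
          * qpochs [q; q ^ (2 * j + 1) * a ^ 2] q (k - j)))) k) n.
Proof.
  assert (hD : aw_den q n (a, b, c, d) <> 0).
  { apply aw_den_neq_0. refine (conj ha (conj habcd _)). intros m hm e.
    (* For this j, the factor of (q^(1-2j) / a^2; q)_j with index i = 2 j - 1 - m is 1 - q^(-m) /
       a^2. The minimum gives j <= n and 0 <= i < j for every 0 < m < 2 n. *)
    set (j := min m n). set (i := (2 * j - 1 - m)%nat).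
    assert (hi : (i < j)%nat /\ (2 * j = i + 1 + m)%nat) by (unfold i, j; lia).
    destruct hi as [hij h2j].
    destruct (hden j j) as [h1 _]; [unfold j; lia |].
    apply (proj1 (qpoch_neq_0 _ _ _)) with (k := i) in h1; [| exact hij].
    apply h1. change (1 - a ^ 2 * q ^ m = 0) in e.
    rewrite h2j, !Cpow_add_r, Cpow_1_r.
    pose proof (Cpow_nz _ i hq0) as n1. pose proof (Cpow_nz _ m hq0) as n2.
    pose proof (Cpow_nz _ 2 ha) as n3.
    set (A := a ^ 2) in *. set (Q := q ^ m) in *. set (P := q ^ i) in *. clearbody A Q P.
    replace (1 - q / (P * q * Q) / A * P) with (- (1 - A * Q) / (A * Q))
      by (field; repeat split; assumption).
    rewrite e. field. split; assumption. }
  transitivity (aw_sum q n (a, b, c, d)).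
  - apply (is_aw_moment_iff q n hq0 hq1 a b c d _ hD). unfold aw_moment.
    apply (iota_correct (V := C_CompleteNormedModule) (is_aw_moment n a b c d q)).
    exists (aw_sum q n (a, b, c, d)). split.
    + now apply is_aw_moment_iff.
    + intros v hv. symmetry. now apply (is_aw_moment_iff q n hq0 hq1 a b c d v hD).
  - unfold aw_sum. f_equal. rewrite sum_n_csum. apply csum_ext. intros k hk.
    rewrite sum_n_csum, <- (Cmult_assoc _ (q ^ k)), <- (csum_scal (q ^ k)).
    f_equal. apply csum_ext. intros j hj.
    unfold weight, node, Cdiv. ring.
Qed.
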